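(* Let $M$ be a spacetime with particles and let $S$ be a closed smooth space-like surface in $M$ orthogonal to the particles. If $V$ is a transverse vector field on $S$, then the left and right metrics $\mu_l$ and $\mu_r$ defined by $V$ on $S$ are hyperbolic metrics with cone singularities. Moreover, if $p$ is the intersection point of $S$ with a particle of angle $\theta$, then $p$ is a cone point for both $\mu_l$ and $\mu_r$, of the same angle $\theta$.
   Context: $AdS_3=\{x\in\mathbb R^{2,2}:\langle x,x\rangle=-1\}$ with its induced Lorentzian metric of curvature $-1$. An AdS manifold is an oriented, time-oriented Lorentzian 3-manifold locally isometric to $AdS_3$. A spacetime with particles $M$ is an AdS manifold $M_{reg}$ completed by singular lines called particles: a particle of angle $\theta\in(0,2\pi)$ is modeled on the space obtained from the wedge of $AdS_3$ bounded by two time-like half-planes meeting along a time-like geodesic $l$ with angle $\theta$, by gluing the two faces by a rotation around $l$ (the particle being the image of $l$). On an AdS manifold with Levi-Civita connection $\nabla$, set $D^l_vu=\nabla_vu+u\times v$ and $D^r_vu=\nabla_vu-u\times v$, where $\times$ is the cross product, $(v\times y)^*=*(v^*\wedge y^* )$ ($v^*$ the 1-form dual to $v$, $*$ the Hodge star). Near an intersection point $p$ of $S$ with a particle, a neighborhood $W$ of $p$ in $M$ is obtained by gluing the faces of a wedge $\hat W\subset AdS_3$ of angle $\theta$; $S\cap W$ corresponds to a surface $\hat\Delta\subset\hat W$, and $p$ to a point $\hat p\in\hat\Delta$. $S$ is smooth at $p$ if $\hat\Delta$ extends to a smooth surface in a neighborhood of $\hat p$. A transverse vector field on $S$ is a unit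 time-like vector field $V$ along $S_{reg}=S\cap M_{reg}$ such that, at each $x\in S_{reg}$, the maps $v\mapsto D^l_vV$ and $v\mapsto D^r_vV$ on $T_xS$ have rank 2, and at each particle: (i) $V$ extends at $p$ to a unit vector tangent to the particle; (ii) the induced field $\hat V$ on $\hat W$ extends to a smooth vector field in a neighborhood of $\hat W$ in $AdS_3$; (iii) $D^l\hat V$ and $D^r\hat V$ have rank 2 at $\hat p$. The left and right metrics on $S_{reg}$ are $\mu_l(v,v)=\|D^l_vV\|^2$ and $\mu_r(v,v)=\|D^r_vV\|^2$. *)

(* Defs.v *)
From HB Require Import structures.
From mathcomp Require Import all_boot all_order all_algebra.
From mathcomp Require Import all_classical all_reals all_analysis.

Set Implicit Arguments.
Unset Strict Implicit.
Unset Printing Implicit Defensive.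

Import Order.TTheory GRing.Theory Num.Theory.
Import numFieldNormedType.Exports.

Local Open Scope classical_set_scope.
Local Open Scope ring_scope.

Fixpoint Ck (R : realType) (m n k : nat) (U : set 'rV[R]_m)
    (f : 'rV[R]_m -> 'rV[R]_n) : Prop :=
  match k with
  | 0%N => forall x, U x -> {for x, continuous f}
  | k'.+1 => (forall x, U x -> differentiable f x) /\
             (forall v, Ck k' U (fun x => 'D_v f x))
  end.

(* Meant for open [U]. *)
Definition smooth (R : realType) (m n : nat) (U : set 'rV[R]_m)
    (f : 'rV[R]_m -> 'rV[R]_n) : Prop := forall k, Ck k U f.

(* [f] maps [A] onto a relatively open subset of [Y0] (take [B := f @` A])
   that carries the quotient topology of the one of [A].  For [f] injective on
   [A]: a homeomorphism from [A] onto an open subset of [Y0]. *)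
Definition open_quotient (X Y : topologicalType) (A : set X) (Y0 : set Y)
    (f : X -> Y) : Prop :=
  f @` A `<=` Y0 /\
  forall B : set Y, B `<=` f @` A ->
    (open (B : set (subspace Y0)) <->
     open ((A `&` f @^-1` B) : set (subspace A))).

Definition open_embedding (X Y : topologicalType) (A : set X) (Y0 : set Y)
    (f : X -> Y) : Prop :=
  (forall x y, A x -> A y -> f x = f y -> x = y) /\ open_quotient A Y0 f.

Definition immersive_at (R : realType) (n : nat) (f : 'rV[R]_2 -> 'rV[R]_n)
    (u : 'rV[R]_2) : Prop := \rank (jacobian f u) = 2%N.

Definition form22 (R : realType) (x y : 'rV[R]_4) : R :=
  x 0 0 * y 0 0 + x 0 1 * y 0 1 - x 0 2 * y 0 2 - x 0 3 * y 0 3.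

Definition AdS3 (R : realType) : set 'rV[R]_4 := [set x | form22 x x = -1].

Definition tangent (R : realType) (x v : 'rV[R]_4) : Prop := form22 x v = 0.

(* The volume form of AdS3 at [x], on vectors tangent at [x]; it fixes the
   orientation of AdS3. *)
Definition vol (R : realType) (x u v w : 'rV[R]_4) : R :=
  \det (col_mx (col_mx x u) (col_mx v w) : 'M[R]_4).

(* *(u^* /\ v^* ) is the 1-form vol_x(u, v, .), so that u x v is the vector
   tangent at [x] such that <u x v, w> = vol_x(u, v, w) for all w. *)
Definition cross (R : realType) (x u v : 'rV[R]_4) : 'rV[R]_4 :=
  \row_(k < 4) ((if (k < 2)%N then 1 else -1) * vol x u v (delta_mx 0 k)).

(* A time-like field on AdS3, which fixes its time orientation.  It is a unit
   field along the geodesic [axis] below, and tangent to it. *)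
Definition time_field (R : realType) (x : 'rV[R]_4) : 'rV[R]_4 :=
  \row_(k < 4) (if k == 2 then - x 0 3 else if k == 3 then x 0 2 else 0).

Definition future (R : realType) (x v : 'rV[R]_4) : Prop :=
  [/\ tangent x v, form22 v v < 0 & form22 v (time_field x) < 0].

(* The isometries of AdS3 preserving orientation and time orientation, acting
   on row vectors from the right. *)
Definition AdS_isom (R : realType) (g : 'M[R]_4) : Prop :=
  [/\ forall x y, form22 (x *m g) (y *m g) = form22 x y,
      \det g = 1 &
      forall x v, AdS3 x -> future x v -> future (x *m g) (v *m g)].

(* In the next three definitions [f] is a map from a parameter domain of R^2 to
   AdS3, [F] a vector field along [f] and [a] a vector tangent to R^2 at [u].
   The Levi-Civita connection of AdS3 is the tangential part of the flat
   derivative of R^{2,2}; [f u] is a normal vector of norm -1. *)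
Definition nabla (R : realType) (f F : 'rV[R]_2 -> 'rV[R]_4)
    (u a : 'rV[R]_2) : 'rV[R]_4 :=
  'd F u a + form22 ('d F u a) (f u) *: f u.

Definition Dl (R : realType) (f F : 'rV[R]_2 -> 'rV[R]_4)
    (u a : 'rV[R]_2) : 'rV[R]_4 :=
  nabla f F u a + cross (f u) (F u) ('d f u a).

Definition Dr (R : realType) (f F : 'rV[R]_2 -> 'rV[R]_4)
    (u a : 'rV[R]_2) : 'rV[R]_4 :=
  nabla f F u a - cross (f u) (F u) ('d f u a).

Definition rotation (R : realType) (t : R) (x : 'rV[R]_4) : 'rV[R]_4 :=
  \row_(k < 4) (if k == 0 then cos t * x 0 0 - sin t * x 0 1
                else if k == 1 then sin t * x 0 0 + cos t * x 0 1
                else x 0 k).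

(* The time-like geodesic fixed by all the [rotation t]. *)
Definition axis (R : realType) : set 'rV[R]_4 :=
  [set x | [/\ AdS3 x, x 0 0 = 0 & x 0 1 = 0]].

(* The other face of the wedge of angle [t] is the image of this one by
   [rotation t]. *)
Definition face (R : realType) : set 'rV[R]_4 :=
  [set x | [/\ AdS3 x, 0 <= x 0 0 & x 0 1 = 0]].

Definition wedge (R : realType) (t : R) : set 'rV[R]_4 :=
  [set x | exists b y, [/\ 0 <= b, b <= t, face y & x = rotation b y]].

Definition glued (R : realType) (t : R) (x y : 'rV[R]_4) : Prop :=
  [\/ x = y, face x /\ y = rotation t x | face y /\ x = rotation t y].

(* [regular] is an AdS manifold, given by an atlas of charts into AdS3 whose
   changes of charts are locally restrictions of isometries of AdS3 preserving
   orientation and time orientation.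

   The particle chart [pchart j] is a map from a neighborhood [pdom j] in the
   wedge of angle [pangle j], inducing a homeomorphism from the glued space onto
   an open set of the spacetime.  Away from the axis it is a local isometry:
   read in a chart, it is an isometry [g] near [y]; if [y] is in the first face,
   it is moreover equal to [g] composed with the inverse of the gluing map near
   [rotation (pangle j) y], so that together the two sides of the face match up. *)
Record spacetime (R : realType) := Spacetime {
  space :> topologicalType;
  space_hausdorff : hausdorff_space space;
  space_countable : @second_countable space;
  cindex : Type;
  cdom : cindex -> set space;
  chart : cindex -> space -> 'rV[R]_4;
  dom_open : forall i, open (cdom i);
  chart_embedding : forall i, open_embedding (cdom i) (@AdS3 R) (chart i);
  chart_change : forall i j x, cdom i x -> cdom j x ->
    exists2 g, AdS_isom g & \forall y \near x, chart j y = chart i y *m g;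
  regular : set space := \bigcup_i cdom i;
  pindex : Type;
  pangle : pindex -> R;
  pdom : pindex -> set 'rV[R]_4;
  pchart : pindex -> 'rV[R]_4 -> space;
  pangle_bounds : forall j, 0 < pangle j < 2 * pi;
  pdom_sub : forall j, pdom j `<=` wedge (pangle j);
  pdom_open : forall j, open (pdom j : set (subspace (wedge (pangle j))));
  pdom_saturated : forall j y, face y -> (pdom j y <-> pdom j (rotation (pangle j) y));
  pchart_quotient : forall j, open_quotient (pdom j) setT (pchart j);
  pchart_glued : forall j x y, pdom j x -> pdom j y ->
    (pchart j x = pchart j y <-> glued (pangle j) x y);
  pchart_regular : forall j y, pdom j y -> (regular (pchart j y) <-> ~ axis y);
  pchart_isom : forall j i y, pdom j y -> cdom i (pchart j y) ->
    exists2 g, AdS_isom g &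
      (\forall z \near y, pdom j z -> chart i (pchart j z) = z *m g) /\
      (face y -> \forall z \near rotation (pangle j) y, pdom j z ->
         chart i (pchart j z) = rotation (- pangle j) z *m g);
  particles_covered : forall p, ~ regular p ->
    exists j y, pdom j y /\ pchart j y = p
}.

Definition surface_param (R : realType) (M : spacetime R) (S : set M)
    (U : set 'rV[R]_2) (s : 'rV[R]_2 -> M) : Prop :=
  [/\ open U, s @` U `<=` @regular R M, open_embedding U S s &
      forall i, smooth (U `&` s @^-1` cdom i) (chart i \o s) /\
        forall u, U u -> cdom i (s u) -> immersive_at (chart i \o s) u].

(* The part of the wedge corresponding to [S] in a particle chart. *)
Definition lifted_surface (R : realType) (M : spacetime R) (S : set M)
    (j : pindex M) : set 'rV[R]_4 := [set y | pdom j y /\ S (pchart j y)].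

(* [tau] parametrizes, near [tau 0 = y], a smooth surface of AdS3 extending
   [lifted_surface S j] through the point [y]. *)
Definition extends_at (R : realType) (M : spacetime R) (S : set M)
    (j : pindex M) (y : 'rV[R]_4) (U : set 'rV[R]_2)
    (tau : 'rV[R]_2 -> 'rV[R]_4) : Prop :=
  [/\ [/\ open U, U 0 & tau 0 = y],
      tau @` U `<=` @AdS3 R,
      smooth U tau /\ (forall u, U u -> immersive_at tau u),
      open_embedding U (tau @` U) tau &
      \forall z \near y, pdom j z -> ((tau @` U) z <-> lifted_surface S j z)].

Definition closed_spacelike_orthogonal_surface (R : realType)
    (M : spacetime R) (S : set M) : Prop :=
  [/\ compact S,
      forall x, S x -> @regular R M x -> exists U s u,
        [/\ surface_param S U s, U u, s u = x &
            forall i v a, U v -> cdom i (s v) -> a != 0 ->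
              0 < form22 ('d (chart i \o s) v a) ('d (chart i \o s) v a)] &
      forall (j : pindex M) y, lifted_surface S j y -> axis y ->
        exists U tau, extends_at S j y U tau /\
          forall a, form22 ('d tau 0 a) (time_field y) = 0].

Definition rank2 (R : realType) (L : 'rV[R]_2 -> 'rV[R]_4) : Prop :=
  \rank (lin1_mx L) = 2%N.

(* A vector tangent to the regular part is given by its expressions in the
   charts, hence the type of [V].  [X] is the extension of the field induced by
   [V] on the lifted surface: where a chart reads as the isometry [g], that
   field is the image of [V] by the inverse of [g]. *)
Record transverse (R : realType) (M : spacetime R) (S : set M)
    (V : cindex M -> M -> 'rV[R]_4) : Prop := Transverse {
  transverse_change : forall i j x g, S x -> cdom i x -> cdom j x -> AdS_isom g ->
    (\forall y \near x, chart j y = chart i y *m g) -> V j x = V i x *m g;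
  transverse_unit : forall i x, S x -> cdom i x ->
    tangent (chart i x) (V i x) /\ form22 (V i x) (V i x) = -1;
  transverse_smooth : forall i U s, surface_param S U s ->
    smooth (U `&` s @^-1` cdom i) (V i \o s);
  transverse_rank : forall i U s u, surface_param S U s -> U u ->
    cdom i (s u) ->
    rank2 (Dl (chart i \o s) (V i \o s) u) /\
    rank2 (Dr (chart i \o s) (V i \o s) u);
  transverse_particle : forall j y, lifted_surface S j y -> axis y ->
    exists (O : set 'rV[R]_4) (X : 'rV[R]_4 -> 'rV[R]_4),
      [/\ [/\ open O, O y, smooth O X &
              forall z, O z -> AdS3 z -> tangent z (X z)],
          forall i z g, O z -> lifted_surface S j z ->
            cdom i (pchart j z) -> AdS_isom g ->
            (\forall w \near z, pdom j w -> chart i (pchart j w) = w *m g) ->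
            X z *m g = V i (pchart j z),
          (exists c, X y = c *: time_field y) /\ form22 (X y) (X y) = -1 &
          forall U tau, extends_at S j y U tau ->
            rank2 (Dl tau (X \o tau) 0) /\ rank2 (Dr tau (X \o tau) 0)]
}.

(* A metric on the regular part of a surface, through its pull-backs: the value
   at [i, s, u, a] is the squared length of the image of [a] by the differential
   at [u] of the parametrization [s], computed in the chart [i]. *)
Definition surface_metric (R : realType) (M : spacetime R) : Type :=
  cindex M -> ('rV[R]_2 -> M) -> 'rV[R]_2 -> 'rV[R]_2 -> R.

Definition mu_l (R : realType) (M : spacetime R)
    (V : cindex M -> M -> 'rV[R]_4) : surface_metric M :=
  fun i s u a => let w := Dl (chart i \o s) (V i \o s) u a in form22 w w.

Definition mu_r (R : realType) (M : spacetime R)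
    (V : cindex M -> M -> 'rV[R]_4) : surface_metric M :=
  fun i s u a => let w := Dr (chart i \o s) (V i \o s) u a in form22 w w.

Definition sqnorm (R : realType) (u : 'rV[R]_2) : R := u 0 0 ^+ 2 + u 0 1 ^+ 2.

(* Locally isometric to the hyperbolic plane (Poincare disk) on the regular
   part. *)
Definition locally_hyperbolic (R : realType) (M : spacetime R) (S : set M)
    (mu : surface_metric M) : Prop :=
  forall x, S x -> @regular R M x -> exists U s u,
    [/\ surface_param S U s, U u /\ s u = x,
        U `<=` [set v | sqnorm v < 1] &
        forall i v a, U v -> cdom i (s v) ->
          mu i s v a = 4 * sqnorm a / (1 - sqnorm v) ^+ 2].

Definition sinh (R : realType) (r : R) : R := (expR r - expR (- r)) / 2.

(* Near [p], the surface is a hyperbolic cone of angle [t]: polar coordinates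
   (r, b), with 0 <= r < e and b in R / t Z, in which the metric is
   dr^2 + sinh(r)^2 db^2. *)
Definition cone_point (R : realType) (M : spacetime R) (S : set M)
    (mu : surface_metric M) (p : M) (t : R) : Prop :=
  exists (e : R) (c : 'rV[R]_2 -> M),
    let A := [set u : 'rV[R]_2 | 0 <= u 0 0 < e] in
    [/\ 0 < e /\ (forall u : 'rV[R]_2, u 0 0 = 0 -> c u = p),
        open_quotient A S c,
        forall u v, A u -> A v ->
          (c u = c v <-> u 0 0 = v 0 0 /\
             (u 0 0 = 0 \/ exists k : int, u 0 1 = v 0 1 + k%:~R * t)),
        forall u, A u -> 0 < u 0 0 -> exists U, U u /\ surface_param S U c &
        forall i u a, A u -> 0 < u 0 0 -> cdom i (c u) ->
          mu i c u a = a 0 0 ^+ 2 + sinh (u 0 0) ^+ 2 * a 0 1 ^+ 2].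

Definition hyperbolic_with_cone_singularities (R : realType)
    (M : spacetime R) (S : set M) (mu : surface_metric M) : Prop :=
  locally_hyperbolic S mu /\
  forall p, S p -> ~ @regular R M p -> exists2 t, 0 < t & cone_point S mu p t.

(* Main.v *)
Require Import Defs.
From HB Require Import structures.
From mathcomp Require Import all_boot all_order all_algebra.
From mathcomp Require Import all_classical all_reals all_analysis.
From mathcomp Require Import ring lra.

Set Implicit Arguments.
Unset Strict Implicit.
Unset Printing Implicit Defensive.

Import Order.TTheory GRing.Theory Num.Theory.
Import numFieldNormedType.Exports.

Local Open Scope classical_set_scope.
Local Open Scope ring_scope.

(* Translating to the identity of the Lie group AdS_3 the unit time-like vectors
   tangent to AdS_3 sends them to the hyperboloid a^2 + b^2 - c^2 = -1, that is, to
   two copies of the hyperbolic plane; D^l and D^r are the connections that are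
   flat for the translations on one side and on the other.  Hence, in a chart, mu_l
   and mu_r are pulled back from the hyperbolic plane by a Gauss map of V, a local
   diffeomorphism by the rank condition, which is well defined up to isometries of
   the plane.  The rotation of angle t about the axis acts on the hyperboloid as the
   rotation of angle t about (0, 0, 1), the image of a vector tangent to the axis.
   So, near a particle of angle th, the Gauss map of the lifted surface sends the
   particle to the centre of this rotation and the two glued edges to two curves
   that differ by the rotation of angle th: polar coordinates at the centre induce
   the coordinates of a hyperbolic cone of angle th. *)

(** * Functions of class C^k *)

(** The delicate point is the passage from the Gauss map near a particle to coordinates on a whole
    cone. The lifted surface is only the part of a smooth surface lying over a plane sector of angle
    [th], and its Gauss map sends the two sides to curves, not to rays. It must be shown that every
    small circle about the centre crosses this curved sector in exactly one arc, of angular length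
    [th]. The compatibility of the two sides forces the differential at the particle to be
    conformal, except when [th = pi], where it can be any invertible map, even one reversing the
    orientation; this exception is the source of the sign [s] and of the separate cases on
    [th = pi]. The angle [cone_start r] at which the arc begins is merely chosen for each [r], and
    only bounds on it are known; continuity of the cone coordinates is therefore read off the strict
    sign of [sector] outside the arc. A sign [e], equal to 1 or -1, treats both metrics at once. *)

Lemma ord2P (j : 'I_2) : j = 0 \/ j = 1.
Proof. by case: j => -[|[|//]] i; [left|right]; apply: val_inj. Qed.

Lemma near_eq_continuous (T Y : topologicalType) (f g : T -> Y) (x : T) :
  (\forall y \near x, f y = g y) -> {for x, continuous f} ->
  {for x, continuous g}.
Proof.
move=> fg; rewrite /prop_for /continuous_at (nbhs_singleton fg) => cf.
exact: cvg_trans (near_eq_cvg fg) cf.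
Qed.

Section NearEq.
Variables (R : realType).

Lemma diff_near_le (V W : normedModType R) (f : V -> W) x (e : R) :
  differentiable f x -> 0 < e ->
  \forall h \near (0 : V), `|f (h + x) - f x - 'd f x h| <= e * `|h|.
Proof.
move=> df e0; have /eqaddoP/(_ e e0) := diff_locally df.
apply: filterS => h; rewrite -addrA -opprD.
by [].
Qed.

(** Uniqueness of the differential identifies it with [L], so that a candidate differential can be
    checked by inequalities alone. *)
Lemma near_le_diff (V W : normedModType R) (f : V -> W) (x : V)
    (L : {linear V -> W}) : continuous L ->
  (forall e : R, 0 < e -> \forall h \near (0 : V),
     `|f (h + x) - f x - L h| <= e * `|h|) ->
  differentiable f x /\ 'd f x = L :> (V -> W).
Proof.
move=> cL H.
have E : f \o shift x = cst (f x) + L +o_ 0 id.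
  apply/eqaddoP => e e0; have := H e e0; apply: filterS => h.
  by rewrite -addrA -opprD.
have dE := diff_unique cL E.
by split=> //; apply/diff_locallyP; split; rewrite dE.
Qed.

Lemma near_eq_differentiable (V W : normedModType R) (f g : V -> W) (x : V) :
  (\forall y \near x, f y = g y) -> differentiable f x ->
  differentiable g x /\ 'd g x = 'd f x :> (V -> W).
Proof.
move=> fg df; apply: near_le_diff => [|e e0]; first exact: diff_continuous.
have fgh : \forall h \near (0 : V), f (h + x) = g (h + x).
  by have := fg; rewrite (near_shift 0 x); apply: filterS => z /=; rewrite subr0.
apply: filterS2 fgh (diff_near_le df e0) => h E; have E0 := nbhs_singleton fg.
by have -> : g (h + x) - g x = f (h + x) - f x by rewrite E E0.
Qed.

End NearEq.

Section RowDifferentiable.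
Variables (R : realType).

Lemma continuous_row (T : topologicalType) n (f : T -> 'rV[R]_n) x :
  (forall j, {for x, continuous (fun y => f y 0 j : R)}) -> {for x, continuous f}.
Proof.
move=> cf; apply/cvgrPdist_le => /= e e0; near=> y.
rewrite [leLHS]/Num.Def.normr/= mx_normrE (bigmax_le _ (ltW e0))//= => -[i j] _.
rewrite !mxE /= (ord1 i); move: j; near: y; apply: filter_forall => /= j.
exact: ((cvgrPdist_le _ _).1 (cf j)).
Unshelve. all: by end_near. Qed.

Lemma differentiable_entry (V : normedModType R) n (f : V -> 'rV[R]_n) x j :
  differentiable f x -> differentiable (fun y => f y 0 j : R) x.
Proof.
move=> df; apply: (@differentiable_comp _ _ _ _ f (fun N : 'rV[R]_n => N 0 j)) => //.
exact: differentiable_coord.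
Qed.

Lemma differentiable_row (V : normedModType R) n (f : V -> 'rV[R]_n) x :
  (forall j, differentiable (fun y => f y 0 j : R) x) -> differentiable f x.
Proof.
move=> df.
have -> : f = \sum_(j < n) (fun y => f y 0 j *: delta_mx 0 j).
  by rewrite funeqE => y; rewrite fct_sumE [LHS]row_sum_delta.
by apply: differentiable_sum => j; exact: differentiableZl.
Qed.

Lemma diff_entry (V : normedModType R) n (f : V -> 'rV[R]_n) x j a :
  differentiable f x -> 'd f x a 0 j = 'd (fun y => f y 0 j : R) x a.
Proof.
move=> df; rewrite -!deriveE //; last exact: differentiable_entry.
by rewrite derive_mx ?mxE//; exact: diff_derivable.
Qed.

Lemma derive_entry (V : normedModType R) n (f : V -> 'rV[R]_n) x j a :
  differentiable f x -> 'D_a f x 0 j = 'D_a (fun y => f y 0 j : R) x.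
Proof. by move=> df; rewrite derive_mx ?mxE//; exact: diff_derivable. Qed.

End RowDifferentiable.

Section ScalarCk.
Variables (R : realType) (m : nat).
Implicit Types (U : set 'rV[R]_m) (f g : 'rV[R]_m -> R).

(** Scalar counterpart of [Ck]: sums, products and inverses are treated here, and [CkP] carries the
    results to row vectors entry by entry. *)
Fixpoint Cks (k : nat) U f : Prop :=
  match k with
  | 0%N => forall x, U x -> {for x, continuous f}
  | k'.+1 => (forall x, U x -> differentiable f x) /\
             (forall v, Cks k' U (fun x => 'D_v f x))
  end.

(** Openness makes equality on [U] an equality of germs, so that the directional derivatives agree
    as well. *)
Lemma Cks_eq k U f g : open U -> (forall x, U x -> f x = g x) ->
  Cks k U f -> Cks k U g.
Proof.
move=> oU; elim: k f g => [|k IH] f g fg /=.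
  move=> cf x Ux; apply: near_eq_continuous (cf x Ux).
  by have := open_nbhs_nbhs (conj oU Ux); apply: filterS.
have fgn x : U x -> \forall y \near x, f y = g y.
  by move=> Ux; have := open_nbhs_nbhs (conj oU Ux); apply: filterS.
move=> [df cf]; split=> [x Ux|v].
  by have [] := near_eq_differentiable (fgn x Ux) (df x Ux).
by apply: IH (cf v) => x Ux; exact: near_eq_derive (fgn x Ux).
Qed.

Lemma CksW k U f : Cks k.+1 U f -> Cks k U f.
Proof.
elim: k f => [|k IH] f [df cf] /=.
  by move=> x /df; exact: differentiable_continuous.
by split=> // v; exact: IH.
Qed.

Lemma Cks_cst k U (c : R) : open U -> Cks k U (fun=> c).
Proof.
move=> oU; elim: k c => [|k IH] c /=; first by move=> x _; exact: cst_continuous.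
split=> [x _|v]; first exact: differentiable_cst.
by apply: Cks_eq (IH 0) => // x _; rewrite derive_cst.
Qed.

Lemma Cks_entry k U j : open U -> Cks k U (fun x => x 0 j : R).
Proof.
move=> oU; case: k => [|k] /=; first by move=> x _; exact: coord_continuous.
split=> [x _|v]; first exact: differentiable_coord.
apply: Cks_eq (Cks_cst k (v 0 j) oU) => // x _.
by rewrite -(@derive_entry _ _ _ id) ?derive_id//.
Qed.

Lemma CksD k U f g : open U -> Cks k U f -> Cks k U g -> Cks k U (fun x => f x + g x).
Proof.
move=> oU; elim: k f g => [|k IH] f g /=.
  by move=> cf cg x Ux; apply: continuousD; [exact: cf|exact: cg].
move=> [df cf] [dg cg]; split=> [x Ux|v].
  by apply: differentiableD; [exact: df|exact: dg].
apply: Cks_eq (IH _ _ (cf v) (cg v)) => // x Ux.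
by rewrite (@deriveD _ _ _ f g)//; apply: diff_derivable; [exact: df|exact: dg].
Qed.

Lemma CksM k U f g : open U -> Cks k U f -> Cks k U g -> Cks k U (fun x => f x * g x).
Proof.
move=> oU; elim: k f g => [|k IH] f g.
  by move=> cf cg x Ux; apply: continuousM; [exact: cf|exact: cg].
move=> Cf Cg; have [df cf] := Cf; have [dg cg] := Cg; split=> [x Ux|v].
  by apply: (@differentiableM _ _ f g); [exact: df|exact: dg].
(* The product rule uses [f] and [g] themselves at order [k], one less than what is known of
   them. *)
have Cfk := CksW Cf; have Cgk := CksW Cg.
apply: Cks_eq (CksD oU (IH _ _ Cfk (cg v)) (IH _ _ Cgk (cf v))) => // x Ux.
by rewrite (@deriveM _ _ f g)//; apply: diff_derivable; [exact: df|exact: dg].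
Qed.

Lemma CksZ k U c f : open U -> Cks k U f -> Cks k U (fun x => c * f x).
Proof. by move=> oU; apply: CksM => //; exact: Cks_cst. Qed.

Lemma CksN k U f : open U -> Cks k U f -> Cks k U (fun x => - f x).
Proof.
move=> oU Cf; apply: Cks_eq (CksZ (-1) oU Cf) => // x _.
by rewrite mulN1r.
Qed.

Lemma CksB k U f g : open U -> Cks k U f -> Cks k U g -> Cks k U (fun x => f x - g x).
Proof. by move=> oU Cf Cg; apply: CksD => //; exact: CksN. Qed.

Lemma Cks_sum k U n (F : 'I_n -> 'rV[R]_m -> R) : open U ->
  (forall j, Cks k U (F j)) -> Cks k U (fun x => \sum_j F j x).
Proof.
move=> oU; elim: n F => [|n IH] F CF.
  by apply: Cks_eq (Cks_cst k 0 oU) => // x _; rewrite big_ord0.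
apply: Cks_eq (CksD oU (IH (fun j => F (widen_ord (leqnSn n) j)) _) (CF ord_max)) => //.
by move=> x _; rewrite big_ord_recr.
Qed.

Lemma CksV k U f : open U -> (forall x, U x -> f x != 0) ->
  Cks k U f -> Cks k U (fun x => (f x)^-1).
Proof.
move=> oU f0; elim: k => [|k IH].
  by move=> cf x Ux; apply: continuousV; [exact: f0|exact: cf].
move=> Cf; have [df cf] := Cf; have Ck := IH (CksW Cf); split=> [x Ux|v].
  by apply: (@differentiableV _ _ f); [exact: df|exact: f0].
apply: Cks_eq (CksN oU (CksM oU (CksM oU Ck Ck) (cf v))) => // x Ux.
rewrite (@deriveV _ _ f)//; [|exact: f0|exact: diff_derivable (df x Ux)].
by rewrite expr2 invfM scaleNr.
Qed.

(* [h j.+1] is the derivative of [h j], so one induction treats all orders. *)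
Lemma Cks_tower k U (h : nat -> R -> R) f : open U ->
  (forall j t, is_derive t (1 : R) (h j) (h j.+1 t)) ->
  Cks k U f -> forall j, Cks k U (fun x => h j (f x)).
Proof.
move=> oU dh; have diffh j t : differentiable (h j) t.
  by apply/derivable1_diffP; case: (dh j t).
elim: k => [|k IH].
  move=> cf j x Ux; apply: (@continuous_comp _ _ _ f (h j)); first exact: cf.
  by apply: differentiable_continuous.
move=> Cf j; have [df cf] := Cf; split=> [x Ux|v].
  by apply: (@differentiable_comp _ _ _ _ f (h j)); [exact: df|exact: diffh].
apply: Cks_eq (CksM oU (cf v) (IH (CksW Cf) j.+1)) => // x Ux.
have dhf : differentiable (h j \o f) x.
  by apply: (@differentiable_comp _ _ _ _ f (h j)); [exact: df|exact: diffh].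
rewrite [RHS]deriveE // diff_comp; [|exact: df|exact: diffh].
rewrite /= -(@deriveE _ _ _ f); last exact: df.
have [dhj vh] := dh j (f x).
by rewrite deriv1E // derive1E vh.
Qed.

End ScalarCk.

Section CkRow.
Variables (R : realType).

Lemma CkP m n k (U : set 'rV[R]_m) (f : 'rV[R]_m -> 'rV[R]_n) : open U ->
  Ck k U f <-> forall j, Cks k U (fun x => f x 0 j).
Proof.
move=> oU; elim: k f => [|k IH] f /=.
  split=> [cf j x Ux|cf x Ux].
    by apply: (@continuous_comp _ _ _ f (fun N : 'rV[R]_n => N 0 j));
      [exact: cf|exact: coord_continuous].
  by apply: continuous_row => j; exact: cf.
split=> [[df cf] j|cf].
  split=> [x Ux|v]; first exact/differentiable_entry/df.
  have := (IH _).1 (cf v) j; apply: Cks_eq => // x Ux.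
  by rewrite derive_entry //; exact: df.
have df x : U x -> differentiable f x.
  by move=> Ux; apply: differentiable_row => j; exact: (cf j).1.
split=> // v; apply/IH => j.
have := (cf j).2 v; apply: Cks_eq => // x Ux.
by rewrite derive_entry //; exact: df.
Qed.

Lemma Ck_eq m n k (U : set 'rV[R]_m) (f g : 'rV[R]_m -> 'rV[R]_n) : open U ->
  (forall x, U x -> f x = g x) -> Ck k U f -> Ck k U g.
Proof.
move=> oU fg /(CkP k f oU) Cf; apply/CkP => // j; apply: Cks_eq (Cf j) => // x Ux.
by rewrite fg.
Qed.

Lemma CkW m n k (U : set 'rV[R]_m) (f : 'rV[R]_m -> 'rV[R]_n) : 
  Ck k.+1 U f -> Ck k U f.
Proof.
elim: k f => [|k IH] f [df cf] /=.
  by move=> x /df; exact: differentiable_continuous.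
by split=> // v; exact: IH.
Qed.

Lemma Ck_sub m n k (U W : set 'rV[R]_m) (f : 'rV[R]_m -> 'rV[R]_n) :
  W `<=` U -> Ck k U f -> Ck k W f.
Proof.
move=> WU; elim: k f => [|k IH] f /=; first by move=> cf x /WU /cf.
by move=> [df cf]; split=> [x /WU /df//|v]; apply: IH.
Qed.

(** Chain rule: the derivative of the composite along [v] is a sum of entries of the derivative of
    [f] times partial derivatives of [g] at [f x]. These partials are again composites with [f], one
    order lower, which closes an induction on [k] over all [g]. *)
Lemma Cks_comp m n k (U : set 'rV[R]_m) (W : set 'rV[R]_n)
    (f : 'rV[R]_m -> 'rV[R]_n) (g : 'rV[R]_n -> R) : open U ->
  (forall x, U x -> W (f x)) ->
  Ck k U f -> Cks k W g -> Cks k U (fun x => g (f x)).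
Proof.
move=> oU fW; elim: k g => [|k IH] g.
  move=> cf cg x Ux; apply: (@continuous_comp _ _ _ f g); first exact: cf.
  by apply: cg; exact: fW.
move=> Cf [dg cg]; have [df cf] := Cf; split=> [x Ux|v].
  by apply: (@differentiable_comp _ _ _ _ f g); [exact: df|exact/dg/fW].
have H : Cks k U (fun x => \sum_(j < n) ('D_v f x 0 j) * 'D_(delta_mx 0 j) g (f x)).
  apply: Cks_sum => // j; apply: CksM => //.
    exact: ((CkP k _ oU).1 (cf v) j).
  by apply: (IH (fun y => 'D_(delta_mx 0 j) g y)); [exact: CkW Cf|exact: cg].
apply: Cks_eq H => // x Ux.
have dgx : differentiable g (f x) by exact/dg/fW.
have dfx : differentiable f x by exact: df.
rewrite [RHS]deriveE; last exact: differentiable_comp.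
rewrite diff_comp //= -(@deriveE _ _ _ f) // [in RHS](row_sum_delta ('D_v f x)) linear_sum.
by apply: eq_bigr => j _; rewrite linearZ/= (@deriveE _ _ _ g).
Qed.

Lemma Ck_comp m n p k (U : set 'rV[R]_m) (W : set 'rV[R]_n)
    (f : 'rV[R]_m -> 'rV[R]_n) (g : 'rV[R]_n -> 'rV[R]_p) : open U -> open W ->
  (forall x, U x -> W (f x)) ->
  Ck k U f -> Ck k W g -> Ck k U (g \o f).
Proof.
move=> oU oW fW Cf /(CkP k g oW) Cg; apply/CkP => // j.
exact: (Cks_comp (g := fun x => g x 0 j)) Cf (Cg j).
Qed.

End CkRow.

(** * The inverse function theorem *)

Section Strict.
Variables (R : realType).

Lemma norm_entry_le n (v : 'rV[R]_n) j : `|v 0 j| <= `|v|.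
Proof.
rewrite [leRHS]/Num.Def.normr/= mx_normrE.
exact: (le_bigmax _ (fun i : 'I_1 * 'I_n => `|v i.1 i.2|) (0, j)).
Qed.

Lemma norm_row_le n (v : 'rV[R]_n) e : 0 <= e -> (forall j, `|v 0 j| <= e) -> `|v| <= e.
Proof.
move=> e0 ve; rewrite [leLHS]/Num.Def.normr/= mx_normrE (bigmax_le _ e0)//=.
by move=> [i j] _; rewrite /= (ord1 i).
Qed.

Lemma entryB n (u v : 'rV[R]_n) j : (u - v) 0 j = u 0 j - v 0 j.
Proof. by rewrite !mxE. Qed.

Lemma linear_row_sum (W : lmodType R) n (L : {linear 'rV[R]_n -> W}) a :
  L a = \sum_(j < n) a 0 j *: L (delta_mx 0 j).
Proof.
rewrite {1}(row_sum_delta a) linear_sum.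
by apply: eq_bigr => j _; rewrite linearZ.
Qed.

Lemma linear_dist_le (V : normedModType R) n (A B : {linear 'rV[R]_n -> V}) e a :
  (forall j, `|A (delta_mx 0 j) - B (delta_mx 0 j)| <= e) ->
  `|A a - B a| <= n%:R * e * `|a|.
Proof.
move=> AB; rewrite (linear_row_sum A) (linear_row_sum B) -sumrB.
apply: le_trans (ler_norm_sum _ _ _) _.
apply: (@le_trans _ _ (\sum_(j < n) e * `|a|)).
  apply: ler_sum => j _; rewrite -scalerBr normrZ mulrC.
  by apply: ler_pM => //; exact: norm_entry_le.
by rewrite sumr_const card_ord -mulrnAl mulr_natl.
Qed.

Lemma linear_continuous_row (V : normedModType R) n (L : {linear 'rV[R]_n -> V}) :
  continuous L.
Proof.
apply: bounded_linear_continuous; apply/linear_boundedP.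
exists (\sum_(j < n) `|L (delta_mx 0 j)|); split; first by rewrite ger0_real// sumr_ge0.
move=> M MM x; rewrite linear_row_sum.
apply: le_trans (ler_norm_sum _ _ _) _.
apply: (@le_trans _ _ ((\sum_(j < n) `|L (delta_mx 0 j)|) * `|x|)).
  rewrite mulr_suml; apply: ler_sum => j _; rewrite normrZ mulrC.
  by rewrite ler_wpM2l// norm_entry_le.
by rewrite ler_wpM2r// ltW.
Qed.

Lemma is_derive_line (V W : normedModType R) (f : V -> W) (y d : V) t :
  derivable f (t *: d + y) d ->
  is_derive t (1 : R) (fun s => f (s *: d + y)) ('D_d f (t *: d + y)).
Proof.
have E : (fun h : R => h^-1 *: (f ((h *: (1 : R) + t) *: d + y) - f (t *: d + y))) =
         (fun h => h^-1 *: (f (h *: d + (t *: d + y)) - f (t *: d + y))).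
  by rewrite funeqE => h; rewrite (_ : h *: (1 : R) = h) ?scalerDl ?addrA// [LHS]mulr1.
by move=> df; split; rewrite /derivable /derive /= E.
Qed.

Lemma MVT01 (h dh : R -> R) :
  (forall t : R, t \in `[0, 1] -> is_derive t (1 : R) h (dh t)) ->
  exists2 c, c \in `[0, 1] & h 1 - h 0 = dh c.
Proof.
move=> hP.
have H1 (t : R) : t \in `]0, 1[%R -> is_derive t (1 : R) h (dh t).
  by rewrite in_itv /= => /andP[t0 t1]; apply: hP; rewrite in_itv /= !ltW.
have H2 : {within `[0, 1], continuous h}.
  by apply: derivable_within_continuous => t t01; have [] := hP t t01.
have [c c01 E] := MVT_segment ler01 H1 H2.
by exists c => //; rewrite E subr0 mulr1.
Qed.

(** A map of class C^1 is strictly differentiable: increments between any two points near [x0], not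
    only from [x0], are given by the differential at [x0] up to a small relative error. The mean
    value theorem along the segment is applied entry by entry, which suffices for the sup norm. *)
Lemma strict_diff m n (f : 'rV[R]_m -> 'rV[R]_n) (U : set 'rV[R]_m) x0 (e : R) :
  open U -> U x0 -> Ck 1 U f -> 0 < e ->
  exists d, [/\ 0 < d, ball x0 d `<=` U,
    forall x a, ball x0 d x -> `|'d f x a - 'd f x0 a| <= e * `|a| &
    forall x y, ball x0 d x -> ball x0 d y ->
      `|f x - f y - 'd f x0 (x - y)| <= e * `|x - y|].
Proof.
(* Bounding a linear map by its values on the basis costs a factor [m]; dividing by [m.+1] also
   covers [m = 0]. *)
move=> oU Ux0 [df cf] e0; pose e' := e / m.+1%:R.
have e'0 : 0 < e' by rewrite divr_gt0.
have : \forall x \near x0, U x /\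
    forall j : 'I_m, `|'D_(delta_mx 0 j) f x - 'D_(delta_mx 0 j) f x0| <= e'.
  near=> x; split; first by near: x; exact: open_nbhs_nbhs.
  move=> j; move: j; near: x; apply: filter_forall => j.
  exact: ((cvgrPdistC_le _ _).1 (cf (delta_mx 0 j) x0 Ux0)).
move=> /nbhs_ballP[d /= d0 dU]; exists d.
have H (x a : 'rV[R]_m) : ball x0 d x -> `|'d f x a - 'd f x0 a| <= e * `|a|.
  move=> Bx; have [Ux Hx] := dU x Bx.
  apply: le_trans (linear_dist_le (A := 'd f x) (B := 'd f x0) (e := e') a _) _.
    move=> j; have := Hx j.
    by rewrite (deriveE _ (df x0 Ux0)) (deriveE _ (df x Ux)).
  rewrite ler_wpM2r// /e' mulrCA ler_piMr ?(ltW e0)// ler_pdivrMr// mul1r.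
  by rewrite ler_nat.
split=> //; first by move=> x /dU[].
move=> x y Bx By; apply: norm_row_le => [|j]; first by rewrite mulr_ge0// ltW.
pose v : 'rV[R]_m := x - y.
have Bt (t : R) : t \in `[0, 1] -> ball x0 d (t *: v + y).
  rewrite in_itv /= => /andP[t0 t1].
  move: Bx By; rewrite -!ball_normE /= => Bx By.
  have -> : x0 - (t *: v + y) = t *: (x0 - x) + (1 - t) *: (x0 - y).
    by rewrite /v; apply/rowP => k; rewrite !mxE; ring.
  apply: le_lt_trans (ler_normD _ _) _; rewrite !normrZ !ger0_norm ?subr_ge0//.
  move: t0; rewrite le_eqVlt => /predU1P[<-|t0].
    by rewrite mul0r add0r subr0 mul1r.
  rewrite (_ : d = t * d + (1 - t) * d); last by ring.
  by apply: ltr_leD; rewrite ?ltr_pM2l// ler_wpM2l ?subr_ge0// ltW.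
(* With the linear part at [x0] subtracted, the derivative of [h] is the small difference of two
   differentials. *)
pose h (t : R) := f (t *: v + y) 0 j - t * ('d f x0 v 0 j).
have dh (t : R) : t \in `[0, 1] -> is_derive t (1 : R) h (('d f (t *: v + y) v - 'd f x0 v) 0 j).
  move=> t01; have [Ut _] := dU _ (Bt _ t01).
  have dft := df _ Ut.
  have D1 : is_derive t 1 (fun s => f (s *: v + y) 0 j : R) ('d f (t *: v + y) v 0 j).
    rewrite -deriveE // derive_entry //.
    apply: (is_derive_line (f := fun z => f z 0 j : R)).
    exact/diff_derivable/differentiable_entry.
  have D2 : is_derive t (1 : R) (fun s : R => s * ('d f x0 v 0 j)) ('d f x0 v 0 j).
    have := @is_deriveM _ _ id (cst ('d f x0 v 0 j)) t 1 1 0 (is_derive_id _ _) (is_derive_cst _ _ _).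
    by move=> H'; apply: is_derive_eq H' _; rewrite scaler0 add0r [LHS]mulr1.
  rewrite (entryB ('d f (t *: v + y) v) ('d f x0 v) j).
  have D3 := is_deriveB D1 D2.
  exact: D3.
have [c c01] := MVT01 dh.
rewrite /h scale1r scale0r add0r mul1r mul0r subr0 /v subrK => E.
have -> : (f x - f y - 'd f x0 (x - y)) 0 j = ('d f (c *: v + y) v - 'd f x0 v) 0 j.
  by rewrite -E !entryB addrAC.
exact: le_trans (norm_entry_le _ _) (H _ _ (Bt _ c01)).
Unshelve. all: by end_near. Qed.

End Strict.

Arguments linear_continuous_row {R V n} L.

Section DiffEps.
Variables (R : realType).

Lemma linear_row_bijective n (L : {linear 'rV[R]_n -> 'rV[R]_n}) :
  (forall a, L a = 0 -> a = 0) ->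
  exists (L' : {linear 'rV[R]_n -> 'rV[R]_n}) (K : R),
    [/\ 0 < K, cancel L L', cancel L' L & forall a, `|a| <= K * `|L a|].
Proof.
move=> L0; pose J := lin1_mx L.
have JE a : a *m J = L a by rewrite mul_rV_lin1.
have uJ : J \in unitmx.
  by rewrite -row_free_unit; apply/inj_row_free => v; rewrite JE; exact: L0.
pose L' : {linear 'rV[R]_n -> 'rV[R]_n} := mulmxr (invmx J).
have LL' : cancel L L' by move=> a; rewrite -JE /L' /= mulmxK.
have L'L : cancel L' L by move=> a; rewrite -JE /L' /= mulmxKV.
have [K K0 KP] := linear_lipschitz (linear_continuous_row L').
by exists L', K; split=> // a; rewrite -{1}(LL' a).
Qed.

End DiffEps.

Section InverseFunction.
Variables (R : realType).

(** The error contributes at most half of the norm of [a], which is absorbed on the left; hence the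
    factor 2. *)
Lemma norm_le_perturb (V : normedModType R) (K : R) (a p q : V) :
  0 < K -> `|a| <= K * `|q| -> `|p - q| <= (2 * K)^-1 * `|a| ->
  `|a| <= 2 * K * `|p|.
Proof.
move=> K0 aq pq.
have H1 : `|q| <= `|p| + (2 * K)^-1 * `|a|.
  by rewrite -lerBlDl; apply: le_trans pq; rewrite [leRHS]distrC; apply: lerB_dist.
have H3 : K * `|q| <= K * `|p| + `|a| / 2.
  apply: (@le_trans _ _ (K * (`|p| + (2 * K)^-1 * `|a|))).
    by rewrite ler_wpM2l// ltW.
  rewrite mulrDr lerD2l le_eqVlt; apply/orP; left; apply/eqP; field.
  by rewrite gt_eqF.
by lra.
Qed.

(** Surjectivity by minimization: the distance from [f x] to [w] has a minimum [c] on the compact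
    ball. The boundary is too far from [w], and at an interior point with [f c != w] a small step
    along [L' (w - f c)] would decrease the distance. *)
Lemma approx_linear_surj n (f : 'rV[R]_n -> 'rV[R]_n) (x0 : 'rV[R]_n) (r : R)
    (L L' : {linear 'rV[R]_n -> 'rV[R]_n}) (K : R) (w : 'rV[R]_n) :
  0 < r -> 0 < K -> (forall a, `|a| <= K * `|L a|) -> cancel L' L ->
  (forall x y, `|x - x0| <= r -> `|y - x0| <= r ->
     `|f x - f y - L (x - y)| <= (2 * K)^-1 * `|x - y|) ->
  `|w - f x0| < r / (4 * K) -> exists2 x, `|x - x0| < r & f x = w.
Proof.
move=> r0 K0 LK L'L fL wr.
have K2 : 0 < 2 * K by rewrite mulr_gt0.
pose A := [set x : 'rV[R]_n | `|x - x0| <= r].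
have Ax0 : A x0 by rewrite /A /= subrr normr0 ltW.
have inj x y : A x -> A y -> `|x - y| <= 2 * K * `|f x - f y|.
  by move=> Ax Ay; exact: norm_le_perturb K0 (LK _) (fL _ _ Ax Ay).
have Acomp : compact A.
  apply: bounded_closed_compact.
    exists (r + `|x0|); split; first by rewrite ger0_real// addr_ge0// ltW.
    move=> M MM x Ax; apply: le_trans (ltW MM).
    by rewrite -(subrK x0 x); apply: le_trans (ler_normD _ _) _; rewrite lerD2r.
  have -> : A = closed_ball_ (fun z => `|z|) x0 r.
    by apply/seteqP; split=> z; rewrite /A /closed_ball_ /= distrC.
  exact: closed_closed_ball_.
have flip x y : A x -> A y -> `|f x - f y| <= (2 * K)^-1 * `|x - y| + `|L (x - y)|.
  move=> Ax Ay; rewrite -{1}(subrK (L (x - y)) (f x - f y)).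
  apply: le_trans (ler_normD _ _) _; rewrite lerD2r; exact: fL.
have [C C0 CP] := linear_lipschitz (linear_continuous_row L).
have fcont : {within A, continuous (fun x => `|f x - w|)}.
  apply/subspace_continuousP => x Ax; apply/cvgrPdist_le => /= e e0.
  pose C' := (2 * K)^-1 + C.
  have C'0 : 0 < C' by rewrite ltr_wpDl// invr_ge0 ltW.
  rewrite near_withinE; near=> y => Ay.
  apply: le_trans (ler_dist_dist _ _) _.
  rewrite opprB addrA subrK.
  apply: le_trans (flip _ _ Ax Ay) _.
  apply: (@le_trans _ _ (C' * `|x - y|)).
    by rewrite /C' [leRHS]mulrDl lerD2l CP.
  rewrite mulrC -ler_pdivlMr//.
  near: y; apply: cvgr_dist_le; first exact: cvg_id.
  by rewrite divr_gt0.
have [c] := EVT_min_rV (ex_intro _ x0 Ax0) Acomp fcont.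
rewrite inE => Ac cmin.
have cmin' x : A x -> `|f c - w| <= `|f x - w| by move=> Ax; apply: cmin; rewrite inE.
(* If [c] were on the boundary, [f c] would be at distance at least [r / (2 * K)] from [f x0], while
   minimality leaves it at less than twice [r / (4 * K)]. *)
have cr : `|c - x0| < r.
  rewrite lt_neqAle Ac andbT; apply/eqP => cE.
  have := inj c x0 Ac Ax0; rewrite cE => H.
  have H2 := cmin' x0 Ax0.
  have H3 : `|f c - f x0| <= `|f c - w| + `|w - f x0|.
    by have := ler_normD (f c - w) (w - f x0); rewrite addrA subrK.
  have H4 : `|f c - f x0| < r / (2 * K).
    apply: le_lt_trans H3 _.
    have -> : r / (2 * K) = r / (4 * K) + r / (4 * K) by field; rewrite gt_eqF.
    by apply: ltrD => //; apply: le_lt_trans H2 _; rewrite distrC.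
  have : 2 * K * `|f c - f x0| < r by rewrite mulrC -ltr_pdivlMr.
  by rewrite ltNge H.
exists c => //; apply/eqP; rewrite -subr_eq0 -normr_eq0; apply/negPn/negP => fcw.
have rho0 : 0 < `|f c - w| by rewrite lt_neqAle eq_sym fcw /=.
pose s := L' (w - f c).
have Ls : L s = w - f c by rewrite /s L'L.
have sK : `|s| <= K * `|f c - w| by rewrite distrC -Ls.
(* The step is cut so that the new point stays in the ball; the summand 1 keeps the denominator
   positive. *)
pose t := Num.min 1 ((r - `|c - x0|) / (1 + `|s|)).
have s1 : 0 < 1 + `|s| by rewrite ltr_wpDr.
have t0 : 0 < t by rewrite lt_min ltr01 /= divr_gt0// subr_gt0.
have t1 : t <= 1 by rewrite ge_min lexx.
have ts : t * `|s| <= r - `|c - x0|.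
  apply: (@le_trans _ _ (t * (1 + `|s|))).
    by rewrite ler_wpM2l ?(ltW t0)// lerDr.
  by rewrite -ler_pdivlMr// ge_min lexx orbT.
have Ax' : A (t *: s + c).
  rewrite /A /= -addrA; apply: le_trans (ler_normD _ _) _.
  by rewrite normrZ gtr0_norm// -lerBrDr.
have := cmin' _ Ax'; apply/negP; rewrite -ltNge.
(* The linear part of the step multiplies [f c - w] by [1 - t], and the remainder costs at most
   [t / 2] of it. *)
have E : f (t *: s + c) - w = (f (t *: s + c) - f c - L (t *: s + c - c)) + (1 - t) *: (f c - w).
  rewrite addrK linearZ /= Ls; apply/rowP => k; rewrite !mxE; ring.
rewrite E; apply: le_lt_trans (ler_normD _ _) _.
have H := fL _ _ Ax' Ac; rewrite [X in _ <= _ * `|X|]addrK normrZ (gtr0_norm t0) in H.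
have H2 : (2 * K)^-1 * (t * `|s|) <= t / 2 * `|f c - w|.
  apply: (@le_trans _ _ ((2 * K)^-1 * (t * (K * `|f c - w|)))).
    by rewrite !ler_wpM2l// ltW// invr_gt0.
  by rewrite le_eqVlt; apply/orP; left; apply/eqP; field; rewrite gt_eqF.
rewrite normrZ ger0_norm ?subr_ge0//.
have H3 : 0 < t * `|f c - w| by rewrite mulr_gt0.
apply: (@le_lt_trans _ _ (t / 2 * `|f c - w| + (1 - t) * `|f c - w|)).
  by rewrite lerD2r; exact: le_trans H H2.
by lra.
Unshelve. all: by end_near. Qed.

End InverseFunction.

Section InverseFunctionTheorem.
Variables (R : realType).

(** The differentiability of [f] is applied to the increment of [g], which the Lipschitz bound makes
    small. One factor [C] comes from inverting [A] and another from that bound, hence the tolerance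
    [e / (C * C)]. *)
Lemma inverse_differentiable n (f g : 'rV[R]_n -> 'rV[R]_n) (x w : 'rV[R]_n)
    (A A' : {linear 'rV[R]_n -> 'rV[R]_n}) (C : R) :
  0 < C -> cancel A A' -> cancel A' A -> (forall a, `|a| <= C * `|A a|) ->
  differentiable f x -> 'd f x = A :> ('rV[R]_n -> 'rV[R]_n) ->
  f x = w -> g w = x ->
  (\forall v \near w, f (g v) = v /\ `|g v - g w| <= C * `|v - w|) ->
  differentiable g w /\ 'd g w = A' :> ('rV[R]_n -> 'rV[R]_n).
Proof.
move=> C0 AA' A'A AC df dfA fx gw gP.
apply: near_le_diff; first exact: linear_continuous_row.
move=> e e0; pose e' := e / (C * C).
have e'0 : 0 < e' by rewrite divr_gt0// mulr_gt0.
have H := diff_near_le df e'0; rewrite dfA in H.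
have H2 : \forall h \near (0 : 'rV[R]_n), f (g (h + w)) = h + w /\ `|g (h + w) - x| <= C * `|h|.
  move: gP; rewrite (near_shift 0 w); apply: filterS => h /=.
  by rewrite subr0 gw addrK.
have [d /= d0 Hd] := (nbhs_ballP _ _).1 H.
have H3 : \forall h \near (0 : 'rV[R]_n), `|h| < d / C.
  by apply/nbhs_normP; exists (d / C) => /=; [exact: divr_gt0|move=> z /=; rewrite sub0r normrN].
near=> h.
have [fgh gh] : f (g (h + w)) = h + w /\ `|g (h + w) - x| <= C * `|h| by near: h.
pose k := g (h + w) - x.
have kd : ball (0 : 'rV[R]_n) d k.
  rewrite -ball_normE /= sub0r normrN; apply: le_lt_trans gh _.
  rewrite mulrC -ltr_pdivlMr//.
  by near: h.
have := Hd k kd; rewrite /k subrK fgh fx addrK -/k => Hk.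
rewrite gw -/k.
apply: le_trans (AC _) _.
rewrite linearB A'A distrC.
apply: (@le_trans _ _ (C * (e' * `|k|))); first by rewrite ler_wpM2l// ltW.
apply: (@le_trans _ _ (C * (e' * (C * `|h|)))).
  by rewrite !ler_wpM2l// ltW.
by rewrite /e' le_eqVlt; apply/orP; left; apply/eqP; field; rewrite gt_eqF.
Unshelve. all: by end_near. Qed.

Lemma inverse_function_diff n (f : 'rV[R]_n -> 'rV[R]_n) (U : set 'rV[R]_n)
    (x0 : 'rV[R]_n) :
  open U -> U x0 -> Ck 1 U f -> (forall a, 'd f x0 a = 0 -> a = 0) ->
  exists (N W : set 'rV[R]_n) (g : 'rV[R]_n -> 'rV[R]_n),
    [/\ open N, N x0, N `<=` U & open W] /\
    [/\ forall x, N x -> W (f x) /\ g (f x) = x,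
        forall w, W w -> N (g w) /\ f (g w) = w,
        forall x a, N x -> 'd f x a = 0 -> a = 0 &
        forall w, W w -> differentiable g w /\
          forall v, 'd f (g w) ('d g w v) = v].
Proof.
move=> oU Ux0 Cf L0; have [df _] := Cf.
have [L' [K [K0 LL' L'L LK]]] := linear_row_bijective L0.
have K2 : 0 < 2 * K by rewrite mulr_gt0.
have K2' : 0 < (2 * K)^-1 by rewrite invr_gt0.
have [d [d0 dU dL dS]] := strict_diff oU Ux0 Cf K2'.
pose r := d / 2.
have r0 : 0 < r by rewrite divr_gt0.
have ballr (x : 'rV[R]_n) : `|x - x0| <= r -> ball x0 d x.
  by move=> xr; rewrite -ball_normE /= distrC; apply: le_lt_trans xr _; rewrite /r; lra.
have fL (x y : 'rV[R]_n) : `|x - x0| <= r -> `|y - x0| <= r ->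
    `|f x - f y - 'd f x0 (x - y)| <= (2 * K)^-1 * `|x - y|.
  by move=> xr yr; apply: dS; exact: ballr.
pose B := [set x : 'rV[R]_n | `|x - x0| <= r].
have inj (x y : 'rV[R]_n) : B x -> B y -> `|x - y| <= 2 * K * `|f x - f y|.
  by move=> Bx By; exact: norm_le_perturb K0 (LK _) (fL _ _ Bx By).
pose W := ball (f x0) (r / (4 * K)).
(* Intersecting with the preimage of [W] makes [f] a bijection from [N] onto the ball [W]. *)
pose N := [set x | ball x0 r x /\ W (f x)].
have rK0 : 0 < r / (4 * K) by rewrite divr_gt0// mulr_gt0.
have Nr (x : 'rV[R]_n) : N x -> B x.
  by rewrite /N /B -ball_normE /= distrC => -[/ltW].
have NU (x : 'rV[R]_n) : N x -> U x by move=> /Nr /ballr /dU.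
have surj w : W w -> exists x, N x /\ f x = w.
  move=> Ww; have Ww' : `|w - f x0| < r / (4 * K).
    by move: Ww; rewrite /W -ball_normE /= distrC.
  have [x xr fx] := approx_linear_surj r0 K0 LK L'L fL Ww'.
  exists x; split=> //; split; first by rewrite -ball_normE /= distrC.
  by rewrite fx.
pose g w := xget x0 [set x | N x /\ f x = w].
have gP w : W w -> N (g w) /\ f (g w) = w.
  by move=> /surj [x Hx]; exact: (@xgetI _ x0 [set z | N z /\ f z = w] x Hx).
have fg x : N x -> W (f x) /\ g (f x) = x.
  move=> Nx; have Wfx : W (f x) by case: Nx.
  split=> //; have [Ng fgx] := gP _ Wfx.
  apply/eqP; rewrite -subr_eq0 -normr_le0.
  apply: le_trans (inj _ _ (Nr _ Ng) (Nr _ Nx)) _.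
  by rewrite fgx subrr normr0 mulr0.
have oW : open W by exact: ball_open.
have oN : open N.
  rewrite openE => x Nx.
  have [Bx Wx] := Nx.
  have cfx : {for x, continuous f} by apply: differentiable_continuous; exact/df/NU.
  have H1 : \forall y \near x, ball x0 r y by apply: open_nbhs_nbhs; split=> //; exact: ball_open.
  have H2 : \forall y \near x, W (f y) by apply: cfx; exact: open_nbhs_nbhs.
  by rewrite /interior; apply: filterS2 H1 H2 => y; split.
have Nx0 : N x0 by split; [exact: ballxx|rewrite /W; exact: ballxx].
have AK x : N x -> forall a, `|a| <= 2 * K * `|'d f x a|.
  by move=> Nx a; exact: norm_le_perturb K0 (LK a) (dL x a (ballr _ (Nr _ Nx))).
have A0 x a : N x -> 'd f x a = 0 -> a = 0.
  move=> Nx dfa; apply/eqP; rewrite -normr_le0.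
  by apply: le_trans (AK x Nx a) _; rewrite dfa normr0 mulr0.
exists N, W, g; split; first by split.
split; [exact: fg|exact: gP|exact: A0|].
move=> w Ww; have [Ng fgw] := gP w Ww.
have A0' a : 'd f (g w) a = 0 -> a = 0 by exact: A0.
have [A' [_ [_ AA' A'A _]]] := linear_row_bijective A0'.
have [] := @inverse_differentiable _ f g (g w) w _ A' (2 * K) K2 AA' A'A (AK _ Ng).
- exact/df/NU.
- by [].
- by [].
- by [].
- have : \forall v \near w, W v by exact: open_nbhs_nbhs.
  apply: filterS => v Wv; have [Ngv fgv] := gP v Wv; split=> //.
  by apply: le_trans (inj _ _ (Nr _ Ngv) (Nr _ Ng)) _; rewrite fgv fgw.
move=> dg dgE; split; first exact: dg.
move=> v.
have E : 'd g w v = A' v by exact: (congr1 (fun h => h v) dgE).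
exact: etrans (congr1 ('d f (g w)) E) (A'A v).
Qed.

End InverseFunctionTheorem.

Section SmoothInverse.
Variables (R : realType).

Definition det2 (a b : 'rV[R]_2) : R := a 0 0 * b 0 1 - a 0 1 * b 0 0.

Lemma linear2E (V : lmodType R) (A : {linear 'rV[R]_2 -> V}) a :
  A a = a 0 0 *: A (delta_mx 0 0) + a 0 1 *: A (delta_mx 0 1).
Proof. by rewrite linear_row_sum big_ord_recl big_ord1; congr (_ + _ 0 _ *: A (delta_mx 0 _)); apply: val_inj. Qed.

Lemma row2P (a b : 'rV[R]_2) : a 0 0 = b 0 0 -> a 0 1 = b 0 1 -> a = b.
Proof.
move=> h0 h1; apply/rowP => -[[|[|//]] i].
  by rewrite (_ : Ordinal i = 0) //; apply: val_inj.
by rewrite (_ : Ordinal i = 1) //; apply: val_inj.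
Qed.

Lemma row2_eq0 (a : 'rV[R]_2) : a 0 0 = 0 -> a 0 1 = 0 -> a = 0.
Proof. by move=> a0 a1; apply: row2P; rewrite mxE. Qed.

Lemma det2_injective (A : {linear 'rV[R]_2 -> 'rV[R]_2}) :
  (forall a, A a = 0 -> a = 0) <->
  det2 (A (delta_mx 0 0)) (A (delta_mx 0 1)) != 0.
Proof.
pose p := A (delta_mx 0 0); pose q := A (delta_mx 0 1).
have AE a : A a = a 0 0 *: p + a 0 1 *: q by exact: linear2E.
rewrite -/p -/q; move: p q AE => p q AE; split=> [A0|].
  apply/eqP => d0; rewrite /det2 in d0.
  pose v (s t : R) : 'rV[R]_2 := \row_k (if k == 0 then s else t).
  have v0 s t : s *: p + t *: q = 0 -> s = 0 /\ t = 0.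
    move=> H; have /rowP H1 : v s t = 0 by apply: A0; rewrite AE !mxE.
    by have := H1 0; have := H1 1; rewrite !mxE.
  have [q1 /eqP] : q 0 1 = 0 /\ - p 0 1 = 0.
    apply: v0; apply: row2_eq0; rewrite !mxE; last by ring.
    by rewrite -d0; ring.
  rewrite oppr_eq0 => /eqP p1.
  have [q0 /eqP] : q 0 0 = 0 /\ - p 0 0 = 0.
    apply: v0; apply: row2_eq0; rewrite !mxE; first by ring.
    by rewrite q1 p1; ring.
  rewrite oppr_eq0 => /eqP p0.
  have [/eqP] : (1 : R) = 0 /\ (0 : R) = 0.
    by apply: v0; apply: row2_eq0; rewrite !mxE ?p0 ?p1; ring.
  by rewrite oner_eq0.
move=> d0 a; rewrite AE => /rowP H.
have H0 := H 0; have H1 := H 1; rewrite !mxE in H0 H1.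
apply: row2_eq0.
  have : a 0 0 * det2 p q = (a 0 0 * p 0 0 + a 0 1 * q 0 0) * q 0 1 - (a 0 0 * p 0 1 + a 0 1 * q 0 1) * q 0 0.
    by rewrite /det2; ring.
  by rewrite H0 H1 !mul0r subr0 => /eqP; rewrite mulf_eq0 (negbTE d0) orbF => /eqP.
have : a 0 1 * det2 p q = (a 0 0 * p 0 1 + a 0 1 * q 0 1) * p 0 0 - (a 0 0 * p 0 0 + a 0 1 * q 0 0) * p 0 1.
  by rewrite /det2; ring.
by rewrite H0 H1 !mul0r subr0 => /eqP; rewrite mulf_eq0 (negbTE d0) orbF => /eqP.
Qed.

Lemma cramer2 (A : {linear 'rV[R]_2 -> 'rV[R]_2}) (p q v a : 'rV[R]_2) :
  A (delta_mx 0 0) = p -> A (delta_mx 0 1) = q -> A a = v -> det2 p q != 0 ->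
  a 0 0 = det2 v q / det2 p q /\ a 0 1 = det2 p v / det2 p q.
Proof.
move=> <- <- <-; rewrite (linear2E A a).
move: (A _) (A _) => {}p {}q d0; split; apply: (mulIf d0); rewrite divfK// /det2 !mxE; ring.
Qed.

Lemma Cks_det2 m k (W : set 'rV[R]_m) (p q : 'rV[R]_m -> 'rV[R]_2) : open W ->
  (forall j, Cks k W (fun w => p w 0 j)) -> (forall j, Cks k W (fun w => q w 0 j)) ->
  Cks k W (fun w => det2 (p w) (q w)).
Proof. by move=> oW Cp Cq; apply: CksB => //; apply: CksM. Qed.

(** Bootstrap: Cramer's rule writes the derivatives of [g] as quotients of expressions in the first
    derivatives of [f] at [g w]. If [g] is of class C^k, so are these, hence [g] is of class
    C^(k+1). *)
Lemma inverse_smooth (f g : 'rV[R]_2 -> 'rV[R]_2) (U W : set 'rV[R]_2) :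
  open U -> open W -> smooth U f -> (forall w, W w -> U (g w)) ->
  (forall w a, W w -> 'd f (g w) a = 0 -> a = 0) ->
  (forall w, W w -> differentiable g w /\ forall v, 'd f (g w) ('d g w v) = v) ->
  smooth W g.
Proof.
move=> oU oW Cf gU A0 gd; elim=> [|k IH].
  by move=> w Ww; apply: differentiable_continuous; have [] := gd w Ww.
split=> [w Ww|v]; first by have [] := gd w Ww.
have [df cf] := Cf k.+1.
have cD i j : Cks k W (fun w => 'D_(delta_mx 0 i) f (g w) 0 j).
  apply: (Cks_comp (g := fun x => 'D_(delta_mx 0 i) f x 0 j) oW gU IH).
  exact: ((CkP k _ oU).1 (cf (delta_mx 0 i)) j).
pose p w := 'D_(delta_mx 0 0) f (g w).
pose q w := 'D_(delta_mx 0 1) f (g w).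
pose D w : R := det2 (p w) (q w).
have D0 w : W w -> D w != 0.
  move=> Ww; have := (det2_injective ('d f (g w))).1 (A0 w ^~ Ww).
  by rewrite /D /p /q !deriveE //; exact/df/gU.
have CD : Cks k W D.
  by apply: Cks_det2; [exact: oW|exact: (cD 0)|exact: (cD 1)].
have E w : W w -> 'D_v g w 0 0 = det2 v (q w) / D w /\ 'D_v g w 0 1 = det2 (p w) v / D w.
  move=> Ww; have [dg dfg] := gd w Ww.
  rewrite (deriveE _ dg); apply: (cramer2 (A := 'd f (g w))) (dfg v) (D0 w Ww).
    by rewrite /p deriveE //; exact/df/gU.
  by rewrite /q deriveE //; exact/df/gU.
apply/CkP => // j.
have [->|->] := ord2P j.
- have H : Cks k W (fun w => det2 v (q w) * (D w)^-1).
    apply: CksM => //; last exact: CksV.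
    by apply: Cks_det2; [exact: oW|by move=> ?; exact: Cks_cst|exact: (cD 1)].
  by apply: Cks_eq H => // w Ww; rewrite (E w Ww).1.
- have H : Cks k W (fun w => det2 (p w) v * (D w)^-1).
    apply: CksM => //; last exact: CksV.
    by apply: Cks_det2; [exact: oW|exact: (cD 0)|by move=> ?; exact: Cks_cst].
  by apply: Cks_eq H => // w Ww; rewrite (E w Ww).2.
Qed.

Lemma inverse_function (f : 'rV[R]_2 -> 'rV[R]_2) (U : set 'rV[R]_2)
    (x0 : 'rV[R]_2) :
  open U -> U x0 -> smooth U f -> (forall a, 'd f x0 a = 0 -> a = 0) ->
  exists (N W : set 'rV[R]_2) (g : 'rV[R]_2 -> 'rV[R]_2),
    [/\ open N, N x0, N `<=` U & open W] /\
    [/\ smooth W g,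
        forall x, N x -> W (f x) /\ g (f x) = x,
        forall w, W w -> N (g w) /\ f (g w) = w,
        forall x a, N x -> 'd f x a = 0 -> a = 0 &
        forall w, W w -> differentiable g w /\
          forall v, 'd f (g w) ('d g w v) = v].
Proof.
move=> oU Ux0 Cf L0.
have [N [W [g [[oN Nx0 NU oW] [fg gf A0 dg]]]]] := inverse_function_diff oU Ux0 (Cf 1%N) L0.
exists N, W, g; split; first by split.
split; [|exact: fg|exact: gf|exact: A0|exact: dg].
apply: (inverse_smooth oU oW Cf) => [w Ww|w a Ww|w Ww].
- by apply: NU; have [] := gf w Ww.
- by apply: A0; have [] := gf w Ww.
- exact: dg.
Qed.

End SmoothInverse.

(** * The Gauss map and the connections of AdS_3 *)

Section Algebra.
Variables (R : realType).
Implicit Types (x u v w : 'rV[R]_4).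

Definition row2 (s t : R) : 'rV[R]_2 := \row_k (if k == 0 then s else t).

Lemma row2E0 s t : row2 s t 0 0 = s. Proof. by rewrite mxE. Qed.
Lemma row2E1 s t : row2 s t 0 1 = t. Proof. by rewrite mxE. Qed.

Lemma row4P (a b : 'rV[R]_4) : a 0 0 = b 0 0 -> a 0 1 = b 0 1 ->
  a 0 2 = b 0 2 -> a 0 3 = b 0 3 -> a = b.
Proof.
move=> h0 h1 h2 h3; apply/rowP => -[[|[|[|[|//]]]] i].
- by rewrite (_ : Ordinal i = 0) //; apply: val_inj.
- by rewrite (_ : Ordinal i = 1) //; apply: val_inj.
- by rewrite (_ : Ordinal i = 2) //; apply: val_inj.
- by rewrite (_ : Ordinal i = 3) //; apply: val_inj.
Qed.

(** Entries are indexed by [nat] so that the indices shifted by [bump] compute. *)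
Definition minor3 (a : nat -> nat -> R) (i j k : nat) : R :=
  a 0 i * (a 1 j * a 2 k - a 1 k * a 2 j) -
  a 0 j * (a 1 i * a 2 k - a 1 k * a 2 i) +
  a 0 k * (a 1 i * a 2 j - a 1 j * a 2 i).

Lemma det2_fun (a : nat -> nat -> R) :
  \det (\matrix_(i < 2, j < 2) a i j) = a 0 0 * a 1 1 - a 0 1 * a 1 0.
Proof.
rewrite (expand_det_row _ ord0) !big_ord_recl big_ord0 /cofactor !det_mx11 !mxE /=.
by rewrite /bump /=; ring.
Qed.

Lemma det3_fun (a : nat -> nat -> R) :
  \det (\matrix_(i < 3, j < 3) a i j) = minor3 a 0 1 2.
Proof.
rewrite (expand_det_row _ ord0) !big_ord_recl big_ord0 /cofactor.
have E (j : 'I_3) : \det (row' ord0 (col' j (\matrix_(i < 3, j < 3) a i j))) =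
    a 1 (bump j 0) * a 2 (bump j 1) - a 1 (bump j 1) * a 2 (bump j 0).
  rewrite -(det2_fun (fun k l => a k.+1 (bump j l))); congr (\det _).
  by apply/matrixP => k l; rewrite !mxE.
by rewrite !E !mxE /= /bump /= /minor3; ring.
Qed.

Lemma det4_fun (a : nat -> nat -> R) :
  \det (\matrix_(i < 4, j < 4) a i j) =
  a 3 3 * minor3 a 0 1 2 - a 3 2 * minor3 a 0 1 3 +
  a 3 1 * minor3 a 0 2 3 - a 3 0 * minor3 a 1 2 3.
Proof.
rewrite (expand_det_row _ ord_max) !big_ord_recl big_ord0 /cofactor.
have E (j : 'I_4) : \det (row' ord_max (col' j (\matrix_(i < 4, j < 4) a i j))) =
    minor3 a (bump j 0) (bump j 1) (bump j 2).
  rewrite -[RHS](det3_fun (fun k l => a k (bump j l))); congr (\det _).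
  apply/matrixP => k l; rewrite !mxE; congr (a _ _).
  by rewrite /= /bump leqNgt ltn_ord.
by rewrite !E !mxE /= /bump /= /minor3; ring.
Qed.

Lemma volE x u v w : vol x u v w =
  let m i j k := x 0 i * (u 0 j * v 0 k - u 0 k * v 0 j) -
    x 0 j * (u 0 i * v 0 k - u 0 k * v 0 i) +
    x 0 k * (u 0 i * v 0 j - u 0 j * v 0 i) in
  w 0 3 * m 0 1 2 - w 0 2 * m 0 1 3 + w 0 1 * m 0 2 3 - w 0 0 * m 1 2 3.
Proof.
pose r (i : nat) := nth 0 [:: x; u; v; w] i.
have -> : vol x u v w = \det (\matrix_(i < 4, j < 4) (r i) 0 (inord j)).
  congr (\det _); apply/matrixP => i j; rewrite !mxE inord_val.
  case: splitP => k kE; rewrite !mxE; case: splitP => l lE; rewrite (ord1 l) in lE *.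
  - by rewrite kE lE.
  - by rewrite kE lE.
  - by rewrite kE lE.
  - by rewrite kE lE.
rewrite (det4_fun (fun i j => r i 0 (inord j))) /minor3 /r /=.
have -> : inord 0 = 0 :> 'I_4 by apply: val_inj; rewrite /= inordK.
have -> : inord 1 = 1 :> 'I_4 by apply: val_inj; rewrite /= inordK.
have -> : inord 2 = 2 :> 'I_4 by apply: val_inj; rewrite /= inordK.
have -> : inord 3 = 3 :> 'I_4 by apply: val_inj; rewrite /= inordK.
by [].
Qed.

Lemma crossE x u v :
  let m i j k := x 0 i * (u 0 j * v 0 k - u 0 k * v 0 j) -
    x 0 j * (u 0 i * v 0 k - u 0 k * v 0 i) +
    x 0 k * (u 0 i * v 0 j - u 0 j * v 0 i) in
  [/\ cross x u v 0 0 = - m 1 2 3, cross x u v 0 1 = m 0 2 3,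
      cross x u v 0 2 = m 0 1 3 & cross x u v 0 3 = - m 0 1 2].
Proof. by split; rewrite mxE volE !mxE /=; ring. Qed.

(* For [v] tangent to AdS_3 at [x], the coordinates of the translate of [v] to the
   identity, on one side if [e = 1] and on the other if [e = -1]. *)
Definition ga (e : R) x v : R :=
  x 0 2 * v 0 0 + e * x 0 3 * v 0 1 - x 0 0 * v 0 2 - e * x 0 1 * v 0 3.
Definition gb (e : R) x v : R :=
  x 0 2 * v 0 1 - e * x 0 3 * v 0 0 - x 0 1 * v 0 2 + e * x 0 0 * v 0 3.
Definition gc (e : R) x v : R :=
  e * (x 0 2 * v 0 3 - x 0 3 * v 0 2) - (x 0 1 * v 0 0 - x 0 0 * v 0 1).

Lemma form22C x v : form22 x v = form22 v x.
Proof. by rewrite /form22; ring. Qed.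

(** For [v] and [w] tangent at a point of [AdS3] only the term in [form22 x x] survives: up to the
    sign [e], the cross product becomes [ga e v w] and [gb e v w], the terms that the product rule
    produces when the base point moves. *)
Lemma gauss_cross (e : R) x v w : e * e = 1 ->
  e * ga e x (cross x v w) = form22 x x * ga e v w - form22 x v * ga e x w + form22 x w * ga e x v /\
  e * gb e x (cross x v w) = form22 x x * gb e v w - form22 x v * gb e x w + form22 x w * gb e x v.
Proof.
move=> ee; have [c0 c1 c2 c3] := crossE x v w.
by split; rewrite /ga /gb c0 c1 c2 c3 /form22; ring: ee.
Qed.

(** Multiplicativity of the norm of split quaternions, [form22 x w] being up to sign the real part
    of the product. On vectors tangent to [AdS3] at [x], it says that translation is an isometry. *)
Lemma gauss_norm (e : R) x w : e * e = 1 ->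
  ga e x w ^+ 2 + gb e x w ^+ 2 - gc e x w ^+ 2 =
  form22 x w ^+ 2 - form22 x x * form22 w w.
Proof. by move=> ee; rewrite /ga /gb /gc /form22; ring: ee. Qed.

(** [form22 x w], [ga], [gb] and [gc] are the coordinates of [w] in an orthogonal basis attached to
    [x]; the four identities invert this change of basis. *)
Lemma gauss_inj (e : R) x w : e * e = 1 -> form22 x x = -1 -> form22 x w = 0 ->
  ga e x w = 0 -> gb e x w = 0 -> gc e x w = 0 -> w = 0.
Proof.
move=> ee xx xw a0 b0 c0.
have H2 : - form22 x x * w 0 2 = - x 0 2 * form22 x w - e * x 0 3 * gc e x w + x 0 0 * ga e x w + x 0 1 * gb e x w.
  by rewrite /ga /gb /gc /form22; ring: ee.
have H3 : - form22 x x * w 0 3 = e * x 0 2 * gc e x w - x 0 3 * form22 x w + e * x 0 1 * ga e x w - e * x 0 0 * gb e x w.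
  by rewrite /ga /gb /gc /form22; ring: ee.
have H0 : - form22 x x * w 0 0 = x 0 2 * ga e x w - e * x 0 3 * gb e x w - x 0 0 * form22 x w + x 0 1 * gc e x w.
  by rewrite /ga /gb /gc /form22; ring: ee.
have H1 : - form22 x x * w 0 1 = x 0 2 * gb e x w + e * x 0 3 * ga e x w - x 0 1 * form22 x w - x 0 0 * gc e x w.
  by rewrite /ga /gb /gc /form22; ring: ee.
rewrite xx xw a0 b0 c0 opprK !mul1r !mulr0 !(subr0, addr0) in H0 H1 H2 H3.
by apply: row4P; rewrite mxE ?H0 ?H1 ?H2 ?H3.
Qed.

Lemma form22_nondegenerate x : (forall w, form22 x w = 0) -> x = 0.
Proof.
move=> x0; apply: row4P; rewrite [RHS]mxE.
- by have := x0 (delta_mx 0 0); rewrite /form22 !mxE /= => <-; ring.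
- by have := x0 (delta_mx 0 1); rewrite /form22 !mxE /= => <-; ring.
- by have /eqP := x0 (- delta_mx 0 2); rewrite /form22 !mxE /= => /eqP <-; ring.
- by have /eqP := x0 (- delta_mx 0 3); rewrite /form22 !mxE /= => /eqP <-; ring.
Qed.

Lemma form22_cross x u v w : form22 (cross x u v) w = vol x u v w.
Proof. by have [c0 c1 c2 c3] := crossE x u v; rewrite volE /form22 c0 c1 c2 c3; ring. Qed.

Lemma form22B x y w : form22 (x - y) w = form22 x w - form22 y w.
Proof. by rewrite /form22 !mxE; ring. Qed.

Lemma vol_mulmx (g : 'M[R]_4) x u v w : \det g = 1 ->
  vol (x *m g) (u *m g) (v *m g) (w *m g) = vol x u v w.
Proof. by move=> g1; rewrite /vol -!mul_col_mx det_mulmx g1 mulr1. Qed.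

(** Pairing with [form22] turns the cross product into the volume form; both are invariant, and
    [form22] is nondegenerate. *)
Lemma cross_isom (g : 'M[R]_4) x u v :
  (forall y z, form22 (y *m g) (z *m g) = form22 y z) -> \det g = 1 ->
  cross (x *m g) (u *m g) (v *m g) = cross x u v *m g.
Proof.
move=> gi g1; have ug : g \in unitmx by rewrite unitmxE g1 unitr1.
apply/eqP; rewrite -subr_eq0; apply/eqP/form22_nondegenerate => w.
rewrite -(mulmxKV ug w) form22B gi !form22_cross vol_mulmx //.
by rewrite subrr.
Qed.

Definition rotmx (t : R) : 'M[R]_4 := \matrix_(i, j)
  (if (i == 0) && (j == 0) then cos t else if (i == 0) && (j == 1) then sin t
   else if (i == 1) && (j == 0) then - sin t else if (i == 1) && (j == 1) then cos t
   else (i == j)%:R).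

Lemma sum_ord4 (F : 'I_4 -> R) : \sum_i F i = F 0 + F 1 + F 2 + F 3.
Proof.
rewrite !big_ord_recl big_ord0 addr0 !addrA.
by congr (_ + F _ + F _ + F _); apply: val_inj.
Qed.

Lemma rotationE t x : rotation t x = x *m rotmx t.
Proof.
have [E0 E1 E2 E3] : [/\ (x *m rotmx t) 0 0 = cos t * x 0 0 - sin t * x 0 1,
    (x *m rotmx t) 0 1 = sin t * x 0 0 + cos t * x 0 1,
    (x *m rotmx t) 0 2 = x 0 2 & (x *m rotmx t) 0 3 = x 0 3].
  by split; rewrite mxE sum_ord4 !mxE /=; ring.
by apply: row4P; rewrite ?E0 ?E1 ?E2 ?E3 mxE.
Qed.

Lemma rotation_entries t x :
  [/\ rotation t x 0 0 = cos t * x 0 0 - sin t * x 0 1,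
      rotation t x 0 1 = sin t * x 0 0 + cos t * x 0 1,
      rotation t x 0 2 = x 0 2 & rotation t x 0 3 = x 0 3].
Proof. by split; rewrite mxE. Qed.

Lemma form22_rotation t x y : form22 (rotation t x) (rotation t y) = form22 x y.
Proof.
have [x0 x1 x2 x3] := rotation_entries t x.
have [y0 y1 y2 y3] := rotation_entries t y.
rewrite /form22 x0 x1 x2 x3 y0 y1 y2 y3.
have /eqP := cos2Dsin2 t; rewrite -subr_eq0 => /eqP H.
apply/eqP; rewrite -subr_eq0; apply/eqP.
transitivity ((cos t ^+ 2 + sin t ^+ 2 - 1) * (x 0 0 * y 0 0 + x 0 1 * y 0 1)); first by ring.
by rewrite H mul0r.
Qed.

Lemma rotationD s t x : rotation s (rotation t x) = rotation (s + t) x.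
Proof.
have [x0 x1 x2 x3] := rotation_entries t x.
have [y0 y1 y2 y3] := rotation_entries s (rotation t x).
have [z0 z1 z2 z3] := rotation_entries (s + t) x.
by apply: row4P; rewrite ?y0 ?y1 ?y2 ?y3 ?z0 ?z1 ?z2 ?z3 ?x0 ?x1 ?x2 ?x3 ?cosD ?sinD; ring.
Qed.

Lemma rotation0 x : rotation 0 x = x.
Proof.
have [x0 x1 x2 x3] := rotation_entries 0 x.
by apply: row4P; rewrite ?x0 ?x1 ?x2 ?x3 ?cos0 ?sin0; ring.
Qed.

Lemma rotationVK t x : rotation t (rotation (- t) x) = x.
Proof. by rewrite rotationD subrr rotation0. Qed.

Lemma det_rotmx t : \det (rotmx t) = 1.
Proof.
pose a (i j : nat) : R := if (i == 0)%N && (j == 0)%N then cos t else if (i == 0)%N && (j == 1)%N then sin t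
   else if (i == 1)%N && (j == 0)%N then - sin t else if (i == 1)%N && (j == 1)%N then cos t
   else (i == j)%:R.
have -> : rotmx t = \matrix_(i, j) a i j by apply/matrixP => i j; rewrite !mxE.
rewrite det4_fun /minor3 /a /=.
by rewrite -[RHS](cos2Dsin2 t); ring.
Qed.

Lemma time_field_rotation t x : time_field (rotation t x) = time_field x.
Proof.
have [x0 x1 x2 x3] := rotation_entries t x.
by apply: row4P; rewrite !mxE //= ?x2 ?x3.
Qed.

Lemma AdS_isom_rotmx t : AdS_isom (rotmx t).
Proof.
split=> [x y||x v xA [xv vv vt]]; first by rewrite -!rotationE form22_rotation.
  exact: det_rotmx.
rewrite -!rotationE; split; rewrite /tangent ?form22_rotation //.
rewrite time_field_rotation; have [v0 v1 v2 v3] := rotation_entries t v.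
suff -> : form22 (rotation t v) (time_field x) = form22 v (time_field x) by [].
by rewrite /form22 v0 v1 v2 v3 !mxE /=; ring.
Qed.

(** What transports [form22] and [cross], in a class where inverses are immediate. *)
Definition linear_isom (g : 'M[R]_4) : Prop :=
  (forall x y, form22 (x *m g) (y *m g) = form22 x y) /\ \det g = 1.

Lemma AdS_isom_linear (g : 'M[R]_4) : AdS_isom g -> linear_isom g.
Proof. by case. Qed.

Lemma linear_isom_unit (g : 'M[R]_4) : linear_isom g -> g \in unitmx.
Proof. by move=> [_ g1]; rewrite unitmxE g1 unitr1. Qed.

Lemma linear_isomV (g : 'M[R]_4) : linear_isom g -> linear_isom (invmx g).
Proof.
move=> gi; have ug := linear_isom_unit gi; have [gf g1] := gi.
split=> [x y|]; first by rewrite -gf !mulmxKV.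
by rewrite det_inv g1 invr1.
Qed.

Lemma AdS_isomM (g h : 'M[R]_4) : AdS_isom g -> AdS_isom h -> AdS_isom (g *m h).
Proof.
move=> [gi g1 gf] [hi h1 hf]; split=> [x y||x v xA xv].
- by rewrite !mulmxA hi gi.
- by rewrite det_mulmx g1 h1 mulr1.
- by rewrite !mulmxA; apply: hf; [rewrite /AdS3 /= gi|apply: gf].
Qed.

Definition rot2 (t : R) (q : 'rV[R]_2) : 'rV[R]_2 :=
  row2 (cos t * q 0 0 - sin t * q 0 1) (sin t * q 0 0 + cos t * q 0 1).

Definition gab (e : R) x v : 'rV[R]_2 := row2 (ga e x v) (gb e x v).

(** The origin of the cone angle: every term of [ga] and [gb] is the product of one coordinate
    turned by the rotation and one fixed by it, so the rotation passes through with the same angle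
    and the same sense for both values of [e]. *)
Lemma gab_rotation (e t : R) x v : e * e = 1 ->
  gab e (rotation t x) (rotation t v) = rot2 t (gab e x v).
Proof.
move=> ee.
have [x0 x1 x2 x3] := rotation_entries t x.
have [v0 v1 v2 v3] := rotation_entries t v.
apply: row2P; rewrite /rot2 /gab ?row2E0 ?row2E1 /ga /gb x0 x1 x2 x3 v0 v1 v2 v3; ring.
Qed.

End Algebra.

Section Derivatives.
Variables (R : realType) (V : normedModType R).
Implicit Types (f F : V -> 'rV[R]_4) (p q : V -> R) (u a : V).

Lemma is_derive_mul p q u a dp dq : is_derive u a p dp -> is_derive u a q dq ->
  is_derive u a (fun z => p z * q z) (dp * q u + p u * dq).
Proof.
move=> Hp Hq; have H := is_deriveM Hp Hq.
by apply: is_derive_eq H _; rewrite addrC; congr (_ + _); rewrite [LHS]mulrC.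
Qed.

Lemma is_derive_add p q u a dp dq : is_derive u a p dp -> is_derive u a q dq ->
  is_derive u a (fun z => p z + q z) (dp + dq).
Proof. by move=> Hp Hq; exact: is_deriveD. Qed.

Lemma is_derive_sub p q u a dp dq : is_derive u a p dp -> is_derive u a q dq ->
  is_derive u a (fun z => p z - q z) (dp - dq).
Proof. by move=> Hp Hq; exact: is_deriveB. Qed.

Lemma is_derive_scale (c : R) p u a dp : is_derive u a p dp ->
  is_derive u a (fun z => c * p z) (c * dp).
Proof.
move=> Hp; have := is_derive_mul (is_derive_cst c u a) Hp.
by rewrite mul0r add0r.
Qed.

Lemma is_derive_entry n (f : V -> 'rV[R]_n) u a j : differentiable f u ->
  is_derive u a (fun z => f z 0 j : R) ('d f u a 0 j).
Proof.
move=> df; rewrite -(deriveE _ df) (derive_entry _ _ df).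
exact/derivableP/diff_derivable/differentiable_entry.
Qed.

Lemma is_derive_form22 f F u a (x' v' : 'rV[R]_4) :
  (forall j, is_derive u a (fun z => f z 0 j : R) (x' 0 j)) ->
  (forall j, is_derive u a (fun z => F z 0 j : R) (v' 0 j)) ->
  is_derive u a (fun z => form22 (f z) (F z))
    (form22 x' (F u) + form22 (f u) v').
Proof.
move=> Hf HF.
have H i := is_derive_mul (Hf i) (HF i).
have := is_derive_sub (is_derive_sub (is_derive_add (H 0) (H 1)) (H 2)) (H 3).
move=> {}H; apply: is_derive_eq H _.
by rewrite /form22; ring.
Qed.

Lemma is_derive_ga (e : R) f F u a (x' v' : 'rV[R]_4) :
  (forall j, is_derive u a (fun z => f z 0 j : R) (x' 0 j)) ->
  (forall j, is_derive u a (fun z => F z 0 j : R) (v' 0 j)) ->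
  is_derive u a (fun z => ga e (f z) (F z)) (ga e x' (F u) + ga e (f u) v').
Proof.
move=> Hf HF.
have H i j := is_derive_mul (Hf i) (HF j).
have He i j := is_derive_mul (is_derive_scale e (Hf i)) (HF j).
have := is_derive_sub (is_derive_sub (is_derive_add (H 2 0) (He 3 1)) (H 0 2)) (He 1 3).
move=> {}H; apply: is_derive_eq H _.
by rewrite /ga; ring.
Qed.

Lemma is_derive_gb (e : R) f F u a (x' v' : 'rV[R]_4) :
  (forall j, is_derive u a (fun z => f z 0 j : R) (x' 0 j)) ->
  (forall j, is_derive u a (fun z => F z 0 j : R) (v' 0 j)) ->
  is_derive u a (fun z => gb e (f z) (F z)) (gb e x' (F u) + gb e (f u) v').
Proof.
move=> Hf HF.
have H i j := is_derive_mul (Hf i) (HF j).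
have He i j := is_derive_mul (is_derive_scale e (Hf i)) (HF j).
have := is_derive_add (is_derive_sub (is_derive_sub (H 2 1) (He 3 0)) (H 1 2)) (He 0 3).
move=> {}H; apply: is_derive_eq H _.
by rewrite /gb; ring.
Qed.

Lemma is_derive_near_cst p u a dp (c : R) :
  (\forall z \near u, p z = c) -> is_derive u a p dp -> dp = 0.
Proof.
move=> pc [_ <-]; rewrite (near_eq_derive (g := fun=> c) a pc).
exact: derive_cst.
Qed.

Lemma diff_mulmx n (f : V -> 'rV[R]_n) (g : 'M[R]_n) u : differentiable f u ->
  differentiable (fun z => f z *m g) u /\
  forall a, 'd (fun z => f z *m g) u a = 'd f u a *m g.
Proof.
move=> df; pose G : {linear 'rV[R]_n -> 'rV[R]_n} := mulmxr g.
have cG := linear_continuous_row G.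
have dG : differentiable G (f u) by exact: linear_differentiable.
split; first exact: (differentiable_comp df dG).
move=> a; have := diff_comp df dG; rewrite (diff_lin _ cG) => E.
exact: (congr1 (fun h => h a) E).
Qed.

End Derivatives.

(** * The left and right connections read through the Gauss map *)

Section Connection.
Variables (R : realType).
Implicit Types (f F : 'rV[R]_2 -> 'rV[R]_4) (u a : 'rV[R]_2) (e : R).

(** The connections on 1-jets: [x'] and [v'] stand for the derivatives of the point and of the
    field, so that the identities below are pure algebra. The sign [e] is 1 for [Dl] and -1 for
    [Dr]. *)
Definition De_vec e (x v x' v' : 'rV[R]_4) : 'rV[R]_4 :=
  v' + form22 v' x *: x + e *: cross x v x'.

Lemma De_vec_eq e x v x' v' y w y' w' : x = y -> v = w -> x' = y' -> v' = w' ->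
  De_vec e x v x' v' = De_vec e y w y' w'.
Proof. by move=> -> -> -> ->. Qed.

Definition De e f F u a : 'rV[R]_4 := De_vec e (f u) (F u) ('d f u a) ('d F u a).

Lemma Dl_De f F u a : Dl f F u a = De 1 f F u a.
Proof. by rewrite /De /De_vec scale1r. Qed.

Lemma Dr_De f F u a : Dr f F u a = De (-1) f F u a.
Proof. by rewrite /De /De_vec scaleN1r. Qed.

Lemma De_near_eq e f F f' F' u a : (\forall z \near u, f z = f' z) ->
  (\forall z \near u, F z = F' z) -> differentiable f u -> differentiable F u ->
  De e f F u a = De e f' F' u a.
Proof.
move=> ff FF df dF; have [_ E1] := near_eq_differentiable ff df.
have [_ E2] := near_eq_differentiable FF dF.
exact: (De_vec_eq e (nbhs_singleton ff) (nbhs_singleton FF)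
  (congr1 (fun h => h a) (esym E1)) (congr1 (fun h => h a) (esym E2))).
Qed.

Lemma De_vec_isom e (g : 'M[R]_4) (x v x' v' : 'rV[R]_4) : linear_isom g ->
  De_vec e (x *m g) (v *m g) (x' *m g) (v' *m g) = De_vec e x v x' v' *m g.
Proof. by move=> [gi g1]; rewrite /De_vec gi cross_isom // !mulmxDl !scalemxAl. Qed.

Lemma De_isom e f F u a (g : 'M[R]_4) : linear_isom g ->
  differentiable f u -> differentiable F u ->
  De e (fun z => f z *m g) (fun z => F z *m g) u a = De e f F u a *m g.
Proof.
move=> gi df dF; have [_ E1] := diff_mulmx g df; have [_ E2] := diff_mulmx g dF.
exact: etrans (De_vec_eq e erefl erefl (E1 a) (E2 a)) (De_vec_isom _ _ _ _ _ gi).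
Qed.

Lemma form22_crossl (x v w : 'rV[R]_4) : form22 x (cross x v w) = 0.
Proof. by rewrite form22C form22_cross volE /=; ring. Qed.

Lemma De_vec_tangent e (x v x' v' : 'rV[R]_4) : form22 x x = -1 -> form22 x (De_vec e x v x' v') = 0.
Proof.
move=> xx; have D (s t : R) y (z w : 'rV[R]_4) : form22 y (z + s *: x + t *: w) = form22 y z + s * form22 y x + t * form22 y w.
  by rewrite /form22 !mxE; ring.
by rewrite /De_vec D form22_crossl xx (form22C x v'); ring.
Qed.

(** The right-hand sides are the product rule for [ga e x v] and [gb e x v]: by [gauss_cross], the
    cross product term supplies exactly the contribution of the moving base point. This is the
    flatness of the connection. *)
Lemma De_vec_gauss e (x v x' v' : 'rV[R]_4) : e * e = 1 -> form22 x x = -1 ->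
  form22 x v = 0 -> form22 x x' = 0 ->
  ga e x (De_vec e x v x' v') = ga e x' v + ga e x v' /\
  gb e x (De_vec e x v x' v') = gb e x' v + gb e x v'.
Proof.
move=> ee xx xv xx'; have [ca cb] := gauss_cross x v x' ee.
rewrite xx xv xx' !mul0r subr0 addr0 in ca cb.
have Da (s t : R) (z w : 'rV[R]_4) : ga e x (z + s *: x + t *: w) = ga e x z + t * ga e x w.
  by rewrite /ga !mxE; ring.
have Db (s t : R) (z w : 'rV[R]_4) : gb e x (z + s *: x + t *: w) = gb e x z + t * gb e x w.
  by rewrite /gb !mxE; ring.
by split; rewrite /De_vec ?Da ?Db ?ca ?cb /ga /gb; ring.
Qed.

Lemma gauss_polar e (x v w : 'rV[R]_4) : e * e = 1 ->
  ga e x v * ga e x w + gb e x v * gb e x w - gc e x v * gc e x w =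
  form22 x v * form22 x w - form22 x x * form22 v w.
Proof. by move=> ee; rewrite /ga /gb /gc /form22; ring: ee. Qed.

Lemma De_vec_unit e (x v x' v' : 'rV[R]_4) : form22 x v = 0 -> form22 v v' = 0 ->
  form22 v (De_vec e x v x' v') = 0.
Proof.
move=> xv vv'; have D (s t : R) y (z w : 'rV[R]_4) : form22 y (z + s *: x + t *: w) = form22 y z + s * form22 y x + t * form22 y w.
  by rewrite /form22 !mxE; ring.
have vc : form22 v (cross x v x') = 0 by rewrite form22C form22_cross volE /=; ring.
by rewrite /De_vec D vv' vc (form22C v x) xv; ring.
Qed.

Definition dot2 (q a : 'rV[R]_2) : R := q 0 0 * a 0 0 + q 0 1 * a 0 1.

(* The hyperbolic metric read in the projection of the hyperboloid
   [c^2 = 1 + a^2 + b^2] to the plane of the coordinates [a], [b]. *)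
Definition hyperboloid_metric (q a : 'rV[R]_2) : R :=
  sqnorm a - dot2 q a ^+ 2 / (1 + sqnorm q).

Lemma sqnorm_ge0 (q : 'rV[R]_2) : 0 <= sqnorm q.
Proof. by rewrite /sqnorm addr_ge0// sqr_ge0. Qed.

(** The unit length of [v] gives the square of [gc e x v], and orthogonality of [w] to [v] gives the
    product of [gc e x v] and [gc e x w]; substituting in [gauss_norm] eliminates the third
    coordinate. Only its square occurs, so both sheets of the hyperboloid are covered at once. *)
Lemma De_vec_metric e (x v x' v' : 'rV[R]_4) : e * e = 1 -> form22 x x = -1 ->
  form22 x v = 0 -> form22 v v = -1 -> form22 x x' = 0 -> form22 v v' = 0 ->
  let w := De_vec e x v x' v' in
  (form22 w w = hyperboloid_metric (gab e x v) (gab e x w)) /\ (gab e x w = 0 -> w = 0).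
Proof.
move=> ee xx xv vv xx' vv' w.
have xw : form22 x w = 0 by exact: De_vec_tangent.
have vw : form22 v w = 0 by exact: De_vec_unit.
have N1 := gauss_norm x v ee; have N2 := gauss_norm x w ee; have N3 := gauss_polar x v w ee.
rewrite xx xv xw vv vw !expr0n /= !(mulr0, mul0r, subr0, sub0r, mulN1r, opprK, mulr1) in N1 N2 N3.
have c2 : gc e x v ^+ 2 = 1 + sqnorm (gab e x v).
  by rewrite /sqnorm row2E0 row2E1; move: N1; lra.
have dE : dot2 (gab e x v) (gab e x w) = gc e x v * gc e x w.
  by rewrite /dot2 !row2E0 !row2E1; move: N3; lra.
have p0 : 1 + sqnorm (gab e x v) != 0 by rewrite gt_eqF// ltr_wpDr// sqnorm_ge0.
have ME : gc e x w ^+ 2 = dot2 (gab e x v) (gab e x w) ^+ 2 / (1 + sqnorm (gab e x v)).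
  by apply: (mulIf p0); rewrite divfK// dE exprMn -c2 mulrC.
split; first by rewrite /hyperboloid_metric -ME /sqnorm !row2E0 !row2E1 -N2.
move=> w0; have /rowP g0 := w0.
have a0 := g0 0; have b0 := g0 1; rewrite row2E0 mxE in a0; rewrite row2E1 mxE in b0.
apply: (gauss_inj ee xx xw) => //.
apply/eqP; rewrite -sqrf_eq0 ME w0 /dot2 !mxE; apply/eqP; ring.
Qed.

Lemma smooth_gab (U : set 'rV[R]_2) e f F : open U -> smooth U f -> smooth U F ->
  smooth U (fun z => gab e (f z) (F z)).
Proof.
move=> oU Cf CF k; have cf := (CkP k _ oU).1 (Cf k); have cF := (CkP k _ oU).1 (CF k).
have H i j := CksM oU (cf i) (cF j).
have He i j := CksM oU (CksZ e oU (cf i)) (cF j).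
apply/CkP => // j; have [->|->] := ord2P j.
- apply: Cks_eq (CksB oU (CksB oU (CksD oU (H 2 0) (He 3 1)) (H 0 2)) (He 1 3)) => //.
  by move=> z _; rewrite row2E0.
- apply: Cks_eq (CksD oU (CksB oU (CksB oU (H 2 1) (He 3 0)) (H 1 2)) (He 0 3)) => //.
  by move=> z _; rewrite row2E1.
Qed.

(** Differentiating [form22 (f z) (f z) = -1] makes the velocity tangent, as [De_vec_gauss]
    requires. *)
Lemma gauss_diff e f F u : e * e = 1 ->
  differentiable f u -> differentiable F u ->
  differentiable (fun z => gab e (f z) (F z)) u ->
  (\forall z \near u, form22 (f z) (f z) = -1) ->
  (\forall z \near u, form22 (f z) (F z) = 0) ->
  forall a, form22 (f u) ('d f u a) = 0 /\
    'd (fun z => gab e (f z) (F z)) u a = gab e (f u) (De e f F u a).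
Proof.
move=> ee df dF dP ff fF a.
have Hf j := is_derive_entry a j df; have HF j := is_derive_entry a j dF.
have ff' : form22 (f u) ('d f u a) = 0.
  have := is_derive_near_cst ff (is_derive_form22 Hf Hf).
  by rewrite form22C => /eqP; rewrite -mulr2n mulrn_eq0 /= => /eqP.
have [Ea Eb] := De_vec_gauss ('d F u a) ee (nbhs_singleton ff) (nbhs_singleton fF) ff'.
have Da := is_derive_ga e Hf HF; have Db := is_derive_gb e Hf HF.
split; first exact: ff'.
apply: row2P; rewrite (diff_entry _ _ dP) -deriveE; try exact: differentiable_entry.
  rewrite row2E0 Ea (_ : (fun z => _) = (fun z => ga e (f z) (F z))).
    by case: Da.
  by rewrite funeqE => z; rewrite row2E0.
rewrite row2E1 Eb (_ : (fun z => _) = (fun z => gb e (f z) (F z))).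
  by case: Db.
by rewrite funeqE => z; rewrite row2E1.
Qed.

Lemma gauss_metric e f F u : e * e = 1 ->
  differentiable f u -> differentiable F u ->
  differentiable (fun z => gab e (f z) (F z)) u ->
  (\forall z \near u, form22 (f z) (f z) = -1) ->
  (\forall z \near u, form22 (f z) (F z) = 0) ->
  (\forall z \near u, form22 (F z) (F z) = -1) ->
  forall a, form22 (De e f F u a) (De e f F u a) =
      hyperboloid_metric (gab e (f u) (F u)) ('d (fun z => gab e (f z) (F z)) u a) /\
    ('d (fun z => gab e (f z) (F z)) u a = 0 -> De e f F u a = 0).
Proof.
move=> ee df dF dP ff fF FF a.
have [ff' E] := gauss_diff ee df dF dP ff fF a.
have HF j := is_derive_entry a j dF.
have FF' : form22 (F u) ('d F u a) = 0.
  have := is_derive_near_cst FF (is_derive_form22 HF HF).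
  by rewrite form22C => /eqP; rewrite -mulr2n mulrn_eq0 /= => /eqP.
have := De_vec_metric ee (nbhs_singleton ff) (nbhs_singleton fF) (nbhs_singleton FF) ff' FF'.
by rewrite E.
Qed.

Lemma De_linear e f F u a :
  De e f F u a = a 0 0 *: De e f F u (delta_mx 0 0) + a 0 1 *: De e f F u (delta_mx 0 1).
Proof.
have H x v x1 x2 v1 v2 (s t : R) : De_vec e x v (s *: x1 + t *: x2) (s *: v1 + t *: v2) =
    s *: De_vec e x v x1 v1 + t *: De_vec e x v x2 v2.
  have [c0 c1 c2 c3] := crossE x v (s *: x1 + t *: x2).
  have [d0 d1 d2 d3] := crossE x v x1; have [e0 e1 e2 e3] := crossE x v x2.
  have M (X Y Z : 'rV[R]_4) c d j : (X + c *: Y + d *: Z) 0 j = X 0 j + c * Y 0 j + d * Z 0 j.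
    by rewrite !mxE.
  have M2 (X Y : 'rV[R]_4) c d j : (c *: X + d *: Y) 0 j = c * X 0 j + d * Y 0 j.
    by rewrite !mxE.
  by apply: row4P; rewrite /De_vec !M2 !M ?c0 ?c1 ?c2 ?c3 ?d0 ?d1 ?d2 ?d3 ?e0 ?e1 ?e2 ?e3 /form22 !M2; ring.
exact: etrans (De_vec_eq e erefl erefl (linear2E ('d f u) a) (linear2E ('d F u) a)) (H _ _ _ _ _ _ _ _).
Qed.

(** [lin1_mx L] records only the values of [L] on the basis, so linearity has to be supplied to turn
    the rank into injectivity. *)
Lemma rank2_inj (L : 'rV[R]_2 -> 'rV[R]_4) :
  (forall a, L a = a 0 0 *: L (delta_mx 0 0) + a 0 1 *: L (delta_mx 0 1)) ->
  rank2 L -> forall a, L a = 0 -> a = 0.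
Proof.
move=> LE rL a La.
have rf : row_free (lin1_mx L) by rewrite /row_free rL.
have E b : b *m lin1_mx L = L b.
  rewrite LE mulmx_sum_row big_ord_recl big_ord1.
  have -> : lift ord0 ord0 = 1 :> 'I_2 by apply: val_inj.
  by congr (_ *: _ + _ *: _); apply/rowP => j; rewrite !mxE.
by apply: (row_free_inj rf); rewrite E La mul0mx.
Qed.

End Connection.

Lemma immersive_atP (R : realType) n (f : 'rV[R]_2 -> 'rV[R]_n) u :
  immersive_at f u <-> forall a, 'd f u a = 0 -> a = 0.
Proof.
have E b : b *m lin1_mx ('d f u) = 'd f u b by rewrite mul_rV_lin1.
split=> [r2 a da|H].
  have rf : row_free (lin1_mx ('d f u)) by rewrite /row_free; apply/eqP; exact: r2.
  by apply: (row_free_inj rf); rewrite mul0mx; exact: etrans (E a) da.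
have rf : row_free (lin1_mx ('d f u)).
  by apply: inj_row_free => v vE; apply: H; exact: etrans (esym (E v)) vE.
by move: rf => /eqP.
Qed.

(** * Surfaces in a spacetime *)

Section OpenQuotient.
Variables (X Y : topologicalType).
Implicit Types (A : set X) (f : X -> Y).

Lemma open_subspace_subP (T : topologicalType) (A W : set T) : W `<=` A ->
  open (W : set (subspace A)) <-> exists2 V, open V & W = A `&` V.
Proof.
move=> WA; split=> [/open_subspaceP[V oV VE]|[V oV ->]].
  exists V => //; rewrite setIC VE; apply/seteqP; split=> [z Wz|z []//].
  by split => //; exact: WA.
by apply/open_subspaceP; exists V => //; rewrite [A `&` V]setIC -setIA setIid.
Qed.

Lemma open_subspace_open (T : topologicalType) (A W : set T) : open A -> W `<=` A ->
  open (W : set (subspace A)) <-> open W.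
Proof.
move=> oA WA; split=> [/(open_subspace_subP WA)[V oV ->]|oW]; first exact: openI.
apply/(open_subspace_subP WA); exists W => //.
by apply/seteqP; split=> [z Wz|z []//]; split => //; exact: WA.
Qed.

(** The definition only tests subsets of the image, so [O] is first cut by the image of [A], itself
    open in [Y0] because its preimage is all of [A]. *)
Lemma open_quotient_preimage A (Y0 : set Y) f (O : set Y) : open_quotient A (Y0 : set Y) f -> open O ->
  exists2 V, open V & A `&` f @^-1` O = A `&` V.
Proof.
move=> [fA fq] oO; pose B := f @` A `&` O.
have BA : B `<=` f @` A by move=> z [].
have EA : A `&` f @^-1` (f @` A) = A.
  by apply/seteqP; split=> [z []//|z Az]; split => //; exists z.
have : open ((f @` A) : set (subspace Y0)).
  by apply/fq => //; rewrite EA; apply/(open_subspace_subP (fun z Az => Az)); exists setT; [exact: openT|rewrite setIT].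
move=> /(open_subspace_subP fA)[V oV VE].
have : open (B : set (subspace Y0)).
  apply/open_subspace_subP; first by move=> z /BA /fA.
  by exists (V `&` O); [exact: openI|rewrite /B VE setIA].
move=> /(fq B BA) /(open_subspace_subP (@subIsetl _ _ _))[V' oV' V'E].
exists V' => //; rewrite -V'E; apply/seteqP; split=> z [Az Oz]; split=> //.
by have [] : B (f z) by exact: Oz.
Qed.

Lemma open_quotient_within A (Y0 : set Y) f (O : set Y) x : open_quotient A (Y0 : set Y) f -> open O ->
  A x -> O (f x) -> \forall y \near x, A y -> O (f y).
Proof.
move=> fq oO Ax Ofx; have [V oV VE] := open_quotient_preimage fq oO.
have [_ Vx] : (A `&` V) x by rewrite -VE; split.
have := open_nbhs_nbhs (conj oV Vx); apply: filterS => y Vy Ay.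
by have [] : (A `&` f @^-1` O) y by rewrite VE; split.
Qed.

Lemma open_quotient_open A (Y0 : set Y) f (O : set Y) : open_quotient A (Y0 : set Y) f -> open A -> open O ->
  open (A `&` f @^-1` O).
Proof. by move=> fq oA oO; have [V oV ->] := open_quotient_preimage fq oO; exact: openI. Qed.

Lemma open_quotient_cont A (Y0 : set Y) f x : open_quotient A (Y0 : set Y) f -> open A -> A x ->
  {for x, continuous f}.
Proof.
move=> fq oA Ax W; rewrite nbhsE; case=> O [oO Ofx] OW.
have := open_quotient_within fq oO Ax Ofx.
have := open_nbhs_nbhs (conj oA Ax); apply: filterS2 => y Ay H.
by apply: OW; exact: H.
Qed.

(** Saturation makes [N] the full preimage of its image, which is the set that the quotient topology
    tests. *)
Lemma open_quotient_image A (Y0 : set Y) f (N : set X) : open_quotient A (Y0 : set Y) f ->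
  N `<=` A -> (forall x y, A x -> N y -> f x = f y -> N x) ->
  (exists2 V, open V & N = A `&` V) ->
  exists2 O, open O & f @` N = Y0 `&` O.
Proof.
move=> [fA fq] NA Nsat [V oV VE].
have NB : f @` N `<=` f @` A by move=> z [x Nx <-]; exists x => //; exact: NA.
have E : A `&` f @^-1` (f @` N) = N.
  apply/seteqP; split=> [z [Az [x Nx xz]]|z Nz]; first exact: (Nsat z x).
  by split; [exact: NA|exists z].
apply/open_subspace_subP; first by move=> z /NB /fA.
by apply/fq => //; rewrite E; apply/(open_subspace_subP NA); exists V.
Qed.

End OpenQuotient.

Section SurfaceParam.
Variables (R : realType) (M : spacetime R) (S : set M).
Implicit Types (s : 'rV[R]_2 -> M) (U P Q : set 'rV[R]_2).

Lemma surface_param_sub U s : surface_param S U s -> forall u, U u -> S (s u).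
Proof. by move=> [_ _ [_ [sS _]] _] u Uu; apply: sS; exists u. Qed.

Lemma surface_param_dom_open U s i : surface_param S U s -> open (U `&` s @^-1` cdom i).
Proof.
move=> [oU _ [_ sq] _]; apply: open_quotient_open sq oU _; exact: dom_open.
Qed.

(** Every clause depends only on the values on the open set [P]; for the differentials this is
    equality of germs. *)
Lemma surface_param_eq P s c : (forall v, P v -> s v = c v) ->
  surface_param S P s -> surface_param S P c.
Proof.
move=> sc sP; have [oP sreg [sinj [sS sq]] sch] := sP.
have imE (A : set 'rV[R]_2) : A `<=` P -> c @` A = s @` A.
  by move=> AP; apply/seteqP; split=> _ [v Av <-]; exists v => //; rewrite sc//; exact: AP.
have preE (B : set M) : P `&` c @^-1` B = P `&` s @^-1` B.
  by apply/seteqP; split=> v [Pv Bv]; split=> //; rewrite /preimage /= ?sc// -?sc.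
split=> //; first by rewrite imE.
  split; first by move=> x y Px Py; rewrite -!sc//; exact: sinj.
  by split=> [|B]; rewrite imE // preE; exact: sq.
move=> i; have [smi imi] := sch i; have oD := surface_param_dom_open (i := i) sP.
have E v : (P `&` s @^-1` cdom i) v -> (chart i \o s) v = (chart i \o c) v.
  by move=> [Pv _]; rewrite /= sc.
split; first by rewrite preE => k; exact: Ck_eq E (smi k).
move=> u Pu cu; have su : cdom i (s u) by rewrite sc.
have Du : (P `&` s @^-1` cdom i) u by [].
have H : \forall z \near u, (chart i \o s) z = (chart i \o c) z.
  by have := open_nbhs_nbhs (conj oD Du); apply: filterS.
have [_ dE] := near_eq_differentiable H ((smi 1%N).1 u Du).
apply/immersive_atP => a ca; apply: ((immersive_atP _ _).1 (imi u Pu su)).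
exact: etrans (congr1 (fun h => h a) (esym dE)) ca.
Qed.

Lemma smooth_continuous m n (U : set 'rV[R]_m) (f : 'rV[R]_m -> 'rV[R]_n) :
  smooth U f -> forall x, U x -> {for x, continuous f}.
Proof. by move=> Cf; exact: (Cf 0%N). Qed.

Lemma smooth_differentiable m n (U : set 'rV[R]_m) (f : 'rV[R]_m -> 'rV[R]_n) :
  smooth U f -> forall x, U x -> differentiable f x.
Proof. by move=> Cf; exact: (Cf 1%N).1. Qed.

Lemma open_smooth_preimage m n (U : set 'rV[R]_m) (f : 'rV[R]_m -> 'rV[R]_n) (W : set 'rV[R]_n) :
  open U -> open W -> smooth U f -> open (U `&` f @^-1` W).
Proof.
move=> oU oW Cf; rewrite openE => x [Ux Wfx].
have H1 : \forall y \near x, U y by exact: open_nbhs_nbhs.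
have H2 : \forall y \near x, W (f y).
  by apply: (smooth_continuous Cf Ux); exact: open_nbhs_nbhs.
by rewrite /interior; apply: filterS2 H1 H2 => y; split.
Qed.

Lemma diff_comp_inj m n p (f : 'rV[R]_m -> 'rV[R]_n) (g : 'rV[R]_n -> 'rV[R]_p) x :
  differentiable f x -> differentiable g (f x) ->
  forall a, 'd (g \o f) x a = 'd g (f x) ('d f x a).
Proof. by move=> df dg a; exact: (congr1 (fun h => h a) (diff_comp df dg)). Qed.

(** The local inverse of [sg] carries open sets in the other direction, so that the composite
    remains an embedding on a smaller set [P]. *)
Lemma surface_param_comp U s Q (sg : 'rV[R]_2 -> 'rV[R]_2) v0 :
  surface_param S U s -> open Q -> Q v0 -> smooth Q sg ->
  (forall v, Q v -> U (sg v)) -> (forall a, 'd sg v0 a = 0 -> a = 0) ->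
  exists P, [/\ open P, P v0, P `<=` Q & surface_param S P (s \o sg)].
Proof.
move=> sP oQ Qv0 Csg sgU sg0; have [oU sreg [sinj sq] sch] := sP.
have [P [W [ta [[oP Pv0 PQ oW] [Cta PW WP dP _]]]]] := inverse_function oQ Qv0 Csg sg0.
have CP : smooth P sg by move=> k; exact: Ck_sub PQ (Csg k).
have PU v : P v -> U (sg v) by move=> /PQ /sgU.
have WU w : W w -> U w by move=> /WP [Pw <-]; exact: PU.
exists P; split=> //; split=> //.
- by move=> _ [v Pv <-]; apply: sreg; exists (sg v) => //; exact: PU.
- split; first move=> x y Px Py /= /(sinj _ _ (PU _ Px) (PU _ Py)) E.
    by rewrite -(PW x Px).2 E (PW y Py).2.
  split; first by move=> _ [v Pv <-]; apply: (surface_param_sub sP); exact: PU.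
  move=> B BP; have BU : B `<=` s @` U.
    by move=> z /BP [v Pv <-]; exists (sg v) => //; exact: PU.
  have E1 : P `&` (s \o sg) @^-1` B = P `&` sg @^-1` (U `&` s @^-1` B).
    by apply/seteqP; split=> v [Pv Bv]; split=> //; [split=> //; exact: PU|case: Bv].
  have E2 : U `&` s @^-1` B = W `&` ta @^-1` (P `&` (s \o sg) @^-1` B).
    apply/seteqP; split=> w [Uw Bw].
      have [v Pv vw] := BP _ Bw.
      have E : sg v = w by apply: sinj => //; exact: PU.
      by rewrite -E; have [Wv tv] := PW v Pv; split=> //; rewrite /preimage /= tv; split=> //; rewrite /preimage /= E.
    have [Pt tw] := WP w Uw; case: Bw => _; rewrite /preimage /= tw => Bw.
    by split=> //; exact: WU.
  rewrite (sq.2 B BU); split.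
    move=> /(open_subspace_open oU (@subIsetl _ _ _)) oB.
    apply/(open_subspace_open oP (@subIsetl _ _ _)).
    by rewrite E1; exact: open_smooth_preimage.
  move=> /(open_subspace_open oP (@subIsetl _ _ _)) oB.
  apply/(open_subspace_open oU (@subIsetl _ _ _)).
  by rewrite E2; exact: open_smooth_preimage.
- move=> i; have [smi imi] := sch i; have oD := surface_param_dom_open (i := i) sP.
  have oPD : open (P `&` (s \o sg) @^-1` cdom i).
    have -> : P `&` (s \o sg) @^-1` cdom i = P `&` sg @^-1` (U `&` s @^-1` cdom i).
      by apply/seteqP; split=> v [Pv Bv]; split=> //; [split=> //; exact: PU|case: Bv].
    exact: open_smooth_preimage.
  split.
    move=> k; apply: (Ck_comp oPD oD) (smi k) => [v [Pv sv]|].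
      by split=> //; exact: PU.
    by apply: Ck_sub (CP k) => v [].
  move=> v Pv cv; apply/immersive_atP => a Ha.
  apply: (dP v a Pv); apply: ((immersive_atP _ _).1 (imi (sg v) (PU v Pv) cv)).
  apply: etrans (esym (diff_comp_inj _ _ a)) Ha.
    exact: smooth_differentiable CP _ Pv.
  by apply: (smooth_differentiable smi); split => //; exact: PU.
Qed.

End SurfaceParam.

(** * The Gauss map in a chart and the metrics it pulls back *)

Section GaussMap.
Variables (R : realType) (M : spacetime R) (S : set M) (V : cindex M -> M -> 'rV[R]_4).
Hypothesis trV : transverse S V.
Variable e : R.
Hypothesis e1 : e = 1 \/ e = -1.

Lemma sign_sqr : e * e = 1.
Proof. by case: e1 => ->; ring. Qed.

Definition signed_metric : surface_metric M :=
  fun i s u a => let w := De e (chart i \o s) (V i \o s) u a in form22 w w.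

(** [h] is a correction by an isometry: near a particle, where a chart reads the particle chart as
    [g], taking [invmx g] brings the Gauss map back to the frame in which the particle is the
    axis. *)
Definition gauss_map (h : 'M[R]_4) i (s : 'rV[R]_2 -> M) (z : 'rV[R]_2) : 'rV[R]_2 :=
  gab e (chart i (s z) *m h) (V i (s z) *m h).

Lemma smooth_mulmx (U : set 'rV[R]_2) (f : 'rV[R]_2 -> 'rV[R]_4) (h : 'M[R]_4) :
  open U -> smooth U f -> smooth U (fun z => f z *m h).
Proof.
move=> oU Cf k; apply/CkP => // j; have cf := (CkP k _ oU).1 (Cf k).
apply: Cks_eq (Cks_sum (F := fun l z => f z 0 l * h l j) oU _) => //.
  by move=> z _; rewrite mxE.
by move=> l; apply: CksM => //; exact: Cks_cst.
Qed.

Lemma chart_AdS (i : cindex M) (x : M) : cdom i x -> form22 (chart i x) (chart i x) = -1.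
Proof. by move=> ix; have [_ [sub _]] := @chart_embedding _ M i; apply: sub; exists x. Qed.

Section Chart.
Variables (h : 'M[R]_4) (i : cindex M) (U : set 'rV[R]_2) (s : 'rV[R]_2 -> M).
Hypotheses (hi : linear_isom h) (sP : surface_param S U s).
Let D := U `&` s @^-1` cdom i.

Let oD : open D. Proof. exact: surface_param_dom_open sP. Qed.

Let Cf : smooth D (chart i \o s).
Proof. by have [_ _ _ sch] := sP; have [] := sch i. Qed.

Let CF : smooth D (V i \o s).
Proof. exact: transverse_smooth trV _ _ _ sP. Qed.

Lemma gauss_map_smooth : smooth D (gauss_map h i s).
Proof. by apply: smooth_gab => //; exact: smooth_mulmx. Qed.

(** [De] commutes with [h], which preserves [form22], so the metric is the same pull-back for every
    [h]; injectivity is the rank condition on the transverse field. *)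
Lemma gauss_map_diff z a : D z ->
  signed_metric i s z a =
    hyperboloid_metric (gauss_map h i s z) ('d (gauss_map h i s) z a) /\
  ('d (gauss_map h i s) z a = 0 -> a = 0).
Proof.
move=> Dz; have nD : \forall y \near z, D y by exact: open_nbhs_nbhs.
have [hf h1] := hi.
have df := smooth_differentiable Cf Dz; have dF := smooth_differentiable CF Dz.
have [df' _] := diff_mulmx h df; have [dF' _] := diff_mulmx h dF.
have dP := smooth_differentiable gauss_map_smooth Dz.
have ff : \forall y \near z, form22 (chart i (s y) *m h) (chart i (s y) *m h) = -1.
  by apply: filterS nD => y [_ iy]; rewrite hf chart_AdS.
have sS y : D y -> S (s y) by move=> [Uy _]; exact: (surface_param_sub sP).
have fF : \forall y \near z, form22 (chart i (s y) *m h) (V i (s y) *m h) = 0.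
  by apply: filterS nD => y Dy; rewrite hf; have [] := transverse_unit trV (sS y Dy) Dy.2.
have FF : \forall y \near z, form22 (V i (s y) *m h) (V i (s y) *m h) = -1.
  by apply: filterS nD => y Dy; rewrite hf; have [] := transverse_unit trV (sS y Dy) Dy.2.
have [E1 E2] := gauss_metric sign_sqr df' dF' dP ff fF FF a.
have EDe := De_isom e a hi df dF.
have E3 : De e (chart i \o s) (V i \o s) z a *m h =
   De e (fun y => chart i (s y) *m h) (fun y => V i (s y) *m h) z a by rewrite -EDe.
split.
  rewrite /signed_metric -(hf (De _ _ _ _ _)) E3; exact: E1.
move=> /E2 De0; have De0' : De e (chart i \o s) (V i \o s) z a = 0.
  by rewrite -(mulmxK (linear_isom_unit hi) (De _ _ _ _ _)) E3 De0 mul0mx.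
have [Uz iz] := Dz; have [rl rr] := transverse_rank trV sP Uz iz.
apply: rank2_inj De0'; first exact: De_linear.
case: e1 => ->.
  by rewrite (_ : De 1 _ _ _ = Dl (chart i \o s) (V i \o s) z)// funeqE => b; rewrite Dl_De.
by rewrite (_ : De (-1) _ _ _ = Dr (chart i \o s) (V i \o s) z)// funeqE => b; rewrite Dr_De.
Qed.

End Chart.

(** Near [s u] the change of charts is a single isometry; it acts on the points and on [V] alike,
    and [De] commutes with it. *)
Lemma signed_metric_chart i i' U s u a : surface_param S U s -> U u ->
  cdom i (s u) -> cdom i' (s u) -> signed_metric i' s u a = signed_metric i s u a.
Proof.
move=> sP Uu iu iu'; have [oU _ [_ sq] sch] := sP.
have [g gi gE] := chart_change iu iu'.
have gl := AdS_isom_linear gi.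
have cs : {for u, continuous s} by exact: open_quotient_cont sq oU Uu.
have H : \forall v \near u, [/\ U v, cdom i (s v), cdom i' (s v) &
    \forall y \near s v, chart i' y = chart i y *m g].
  have H1 : \forall v \near u, U v by exact: open_nbhs_nbhs.
  have H2 : \forall v \near u, cdom i (s v).
    by apply: cs; apply: open_nbhs_nbhs; split=> //; exact: dom_open.
  have H3 : \forall v \near u, cdom i' (s v).
    by apply: cs; apply: open_nbhs_nbhs; split=> //; exact: dom_open.
  have H4 : \forall v \near u, \forall y \near s v, chart i' y = chart i y *m g.
    exact: (cs _ (nbhs_interior gE)).
  near=> v; split; near: v; [exact: H1|exact: H2|exact: H3|exact: H4].
have Ef : \forall v \near u, (fun z => (chart i \o s) z *m g) v = (chart i' \o s) v.
  by apply: filterS H => v [_ _ _ Hv]; rewrite /= (nbhs_singleton Hv).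
have EF : \forall v \near u, (fun z => (V i \o s) z *m g) v = (V i' \o s) v.
  apply: filterS H => v [Uv iv iv' Hv]; apply/esym.
  exact: (transverse_change trV (surface_param_sub sP Uv) iv iv' gi Hv).
have Du : (U `&` s @^-1` cdom i) u by [].
have df := smooth_differentiable (sch i).1 Du.
have dF := smooth_differentiable (transverse_smooth trV i sP) Du.
have [df' _] := diff_mulmx g df; have [dF' _] := diff_mulmx g dF.
rewrite /signed_metric -(De_near_eq e a Ef EF df' dF') (De_isom e a gl df dF).
by rewrite gl.1.
Unshelve. all: by end_near. Qed.

(** Any local coordinates [q] of the hyperbolic plane lift to the surface: [sg] is [q] followed by a
    local inverse of the Gauss map, so the Gauss map read through [s \o sg] is [q] itself. It serves
    both for the Poincare disk and for polar coordinates; the uniqueness clause identifies other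
    parametrizations with this one. *)
Lemma local_param h i U s u (Q : set 'rV[R]_2) (q : 'rV[R]_2 -> 'rV[R]_2) v0 :
  linear_isom h -> surface_param S U s -> U u -> cdom i (s u) ->
  open Q -> Q v0 -> smooth Q q -> (forall a, 'd q v0 a = 0 -> a = 0) ->
  q v0 = gauss_map h i s u ->
  exists (N P : set 'rV[R]_2) (sg : 'rV[R]_2 -> 'rV[R]_2),
  [/\ [/\ open N, N u & N `<=` U `&` s @^-1` cdom i],
      [/\ open P, P v0, P `<=` Q & surface_param S P (s \o sg)],
      sg v0 = u,
      forall z v, N z -> P v -> gauss_map h i s z = q v -> z = sg v &
      forall i' v a, P v -> cdom i' (s (sg v)) ->
        signed_metric i' (s \o sg) v a = hyperboloid_metric (q v) ('d q v a)].
Proof.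
move=> hi sP Uu iu oQ Qv0 Cq dq0 qE.
pose D := U `&` s @^-1` cdom i.
have oD : open D by exact: surface_param_dom_open sP.
have Du : D u by [].
have Cg := gauss_map_smooth h i sP.
have dg0 a : 'd (gauss_map h i s) u a = 0 -> a = 0.
  exact: (gauss_map_diff hi sP a Du).2.
have [N [W [g [[oN Nu ND oW] [Cgi NW WN _ dgi]]]]] := inverse_function oD Du Cg dg0.
pose Q' := Q `&` q @^-1` W.
have oQ' : open Q' by exact: open_smooth_preimage.
have Q'v0 : Q' v0 by split=> //; rewrite /preimage /= qE; have [] := NW u Nu.
have Csg : smooth Q' (g \o q).
  move=> k; apply: Ck_comp (Cgi k) => //; first by move=> v [].
  by apply: Ck_sub (Cq k) => v [].
have gq v : Q' v -> N (g (q v)) /\ gauss_map h i s (g (q v)) = q v by move=> [_ /WN].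
have dsg0 a : 'd (g \o q) v0 a = 0 -> a = 0.
  move=> H; apply: dq0.
  have dqv := smooth_differentiable Cq Qv0.
  have [dgv gv] := dgi (q v0) Q'v0.2.
  have E := diff_comp_inj dqv dgv a.
  rewrite -[LHS](gv ('d q v0 a)).
  by rewrite (etrans (congr1 ('d (gauss_map h i s) (g (q v0))) (etrans (esym E) H)) (linear0 _)).
have [P [oP Pv0 PQ' sgP]] := surface_param_comp sP oQ' Q'v0 Csg (fun v Q'v => (ND _ (gq v Q'v).1).1) dsg0.
exists N, P, (g \o q); split=> //.
- by split=> //; move=> v /PQ' [].
- by rewrite /= qE; have [] := NW u Nu.
- by move=> z v Nz Pv E; rewrite /= -E; have [_ ->] := NW z Nz.
move=> i' v a Pv i'v; have [Nv Ev] := gq v (PQ' v Pv).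
have iv : cdom i (s (g (q v))) by have [] := ND _ Nv.
rewrite (signed_metric_chart a sgP Pv iv i'v).
have [-> _] := gauss_map_diff hi sgP a (conj Pv iv).
have E : \forall z \near v, gauss_map h i (s \o (g \o q)) z = q z.
  have := open_nbhs_nbhs (conj oP Pv); apply: filterS => z Pz.
  by have [_ <-] := gq z (PQ' z Pz).
have dgv := smooth_differentiable (gauss_map_smooth h i sgP) (conj Pv iv).
have [_ dE] := near_eq_differentiable E dgv.
have Ea : 'd (gauss_map h i (s \o (g \o q))) v a = 'd q v a by exact: (congr1 (fun f => f a) (esym dE)).
exact: f_equal2 (nbhs_singleton E) Ea.
Qed.

End GaussMap.

(** * Coordinates of the hyperbolic plane *)

Section Coordinates.
Variable R : realType.
Implicit Types (u v a : 'rV[R]_2).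

Lemma is_derive_inv (p : 'rV[R]_2 -> R) u a dp : is_derive u a p dp -> p u != 0 ->
  is_derive u a (fun z => (p z)^-1) (- dp / p u ^+ 2).
Proof.
move=> [dp1 dp2] p0; split; first exact: derivableV.
by rewrite (deriveV p0 dp1) dp2 mulNr mulrC scaleNr.
Qed.

Lemma is_derive_comp1 (W : normedModType R) (h : R -> R) (p : W -> R) (u a : W) dp dh :
  differentiable p u -> is_derive u a p dp -> is_derive (p u) (1 : R) h dh ->
  is_derive u a (fun z => h (p z)) (dh * dp).
Proof.
move=> dfp [_ dp2] [dh1 dh2].
have dfh : differentiable h (p u) by apply/derivable1_diffP.
have dhp : differentiable (h \o p) u by exact: differentiable_comp.
split; first exact: diff_derivable dhp.
rewrite [LHS](deriveE a dhp) (diff_comp dfp dfh) /=.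
by rewrite -(deriveE a dfp) dp2 deriv1E // derive1E dh2 mulrC.
Qed.

Lemma diff_row2 (q : 'rV[R]_2 -> 'rV[R]_2) (p0 p1 : 'rV[R]_2 -> R) d0 d1 u a :
  differentiable q u -> (forall z, q z = row2 (p0 z) (p1 z)) ->
  is_derive u a p0 d0 -> is_derive u a p1 d1 -> 'd q u a = row2 d0 d1.
Proof.
move=> dq qE D0 D1; apply: row2P; rewrite (diff_entry _ _ dq) -deriveE; try exact: differentiable_entry.
  rewrite row2E0 (_ : (fun z => _) = p0); first by case: D0.
  by rewrite funeqE => z; rewrite qE row2E0.
rewrite row2E1 (_ : (fun z => _) = p1); first by case: D1.
by rewrite funeqE => z; rewrite qE row2E1.
Qed.

Lemma smooth_row2 (U : set 'rV[R]_2) (p0 p1 : 'rV[R]_2 -> R) : open U ->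
  (forall k, Cks k U p0) -> (forall k, Cks k U p1) ->
  smooth U (fun z => row2 (p0 z) (p1 z)).
Proof.
move=> oU C0 C1 k; apply/CkP => // j; have [->|->] := ord2P j.
- by apply: Cks_eq (C0 k) => // z _; rewrite row2E0.
- by apply: Cks_eq (C1 k) => // z _; rewrite row2E1.
Qed.

Lemma is_derive_coord u a j : is_derive u a (fun z => z 0 j : R) (a 0 j).
Proof.
have did : differentiable (id : 'rV[R]_2 -> 'rV[R]_2) u by [].
have := is_derive_entry a j did.
have -> : 'd id u a = a; last by [].
by rewrite -deriveE ?derive_id.
Qed.

Definition disk : set 'rV[R]_2 := [set v | sqnorm v < 1].

Lemma Cks_sqnorm k (U : set 'rV[R]_2) : open U -> Cks k U (@sqnorm R).
Proof.
move=> oU; have H j := CksM oU (Cks_entry k j oU) (Cks_entry k j oU).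
by apply: Cks_eq (CksD oU (H 0) (H 1)) => // z _; rewrite /sqnorm !expr2.
Qed.

Lemma continuous_sqnorm : continuous (@sqnorm R).
Proof. by move=> x; exact: (Cks_sqnorm 0 openT x I). Qed.

Lemma open_disk : open disk.
Proof.
have -> : disk = @sqnorm R @^-1` [set t | t < 1] by [].
by apply: open_comp; [move=> x _; exact: continuous_sqnorm|exact: open_lt].
Qed.

(** Stereographic projection of the disk to the hyperboloid from the point (0, 0, -1), the third
    coordinate being then forgotten. *)
Definition poincare v : 'rV[R]_2 :=
  row2 (2 * v 0 0 * (1 - sqnorm v)^-1) (2 * v 0 1 * (1 - sqnorm v)^-1).

Lemma smooth_poincare : smooth disk poincare.
Proof.
have oD := open_disk.
have H k : Cks k disk (fun v => (1 - sqnorm v)^-1).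
  apply: CksV => // [v vD|]; first by rewrite subr_eq0 eq_sym lt_eqF.
  by apply: CksB => //; [exact: Cks_cst|exact: Cks_sqnorm].
by apply: smooth_row2 => // k; apply: CksM => //; apply: CksZ => //; exact: Cks_entry.
Qed.

Lemma diff_poincare v a : disk v -> 'd poincare v a =
  row2 (2 * a 0 0 / (1 - sqnorm v) + 4 * dot2 v a * v 0 0 / (1 - sqnorm v) ^+ 2)
       (2 * a 0 1 / (1 - sqnorm v) + 4 * dot2 v a * v 0 1 / (1 - sqnorm v) ^+ 2).
Proof.
move=> vD; have dq := smooth_differentiable smooth_poincare vD.
have D0 : is_derive v a (fun z => 1 - sqnorm z) (- (2 * dot2 v a)).
  have H j := is_derive_mul (is_derive_coord v a j) (is_derive_coord v a j).
  have := is_derive_sub (is_derive_cst (1 : R) v a) (is_derive_add (H 0) (H 1)).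
  rewrite (_ : (fun z => _) = (fun z => 1 - sqnorm z)).
    by move=> D; apply: is_derive_eq D _; rewrite /dot2; ring.
  by rewrite funeqE => z; rewrite /sqnorm !expr2.
have n0 : 1 - sqnorm v != 0 by rewrite subr_eq0 eq_sym lt_eqF.
have D1 := is_derive_inv D0 n0.
have D2 j := is_derive_mul (is_derive_scale 2 (is_derive_coord v a j)) D1.
rewrite (diff_row2 dq (fun z => erefl) (D2 0) (D2 1)).
by congr row2; field.
Qed.

Lemma hyperboloid_metric_poincare v a : disk v ->
  hyperboloid_metric (poincare v) ('d poincare v a) = 4 * sqnorm a / (1 - sqnorm v) ^+ 2.
Proof.
move=> vD; rewrite diff_poincare // /hyperboloid_metric /poincare /dot2 /sqnorm !row2E0 !row2E1.
have n0 : 1 - (v 0 0 ^+ 2 + v 0 1 ^+ 2) != 0 by rewrite subr_eq0 eq_sym lt_eqF.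
have n1 : (1 + (v 0 0 ^+ 2 + v 0 1 ^+ 2)) != 0 by rewrite gt_eqF// ltr_wpDr// addr_ge0// sqr_ge0.
move: (v 0 0) (v 0 1) (a 0 0) (a 0 1) n0 n1 => x y s t n0 n1.
have -> : 1 + ((2 * x * (1 - (x ^+ 2 + y ^+ 2))^-1) ^+ 2 + (2 * y * (1 - (x ^+ 2 + y ^+ 2))^-1) ^+ 2) =
    (1 + (x ^+ 2 + y ^+ 2)) ^+ 2 / (1 - (x ^+ 2 + y ^+ 2)) ^+ 2 by field.
by field; rewrite n0 n1.
Qed.

Lemma poincare_surj p : exists2 v, disk v & poincare v = p.
Proof.
pose c := Num.sqrt (1 + sqnorm p).
have p1 : 0 <= 1 + sqnorm p by rewrite addr_ge0// sqnorm_ge0.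
have c2 : c ^+ 2 = 1 + sqnorm p by rewrite sqr_sqrtr.
have c1 : 1 <= c by rewrite -[leLHS]sqrtr1 ler_wsqrtr// lerDl sqnorm_ge0.
have c0 : 0 < 1 + c by rewrite addr_gt0// (lt_le_trans _ c1).
(* [c] is the third coordinate of the point of the hyperboloid over [p]; the line from (0, 0, -1) to
   this point meets the plane of the disk at [v]. *)
pose v := (1 + c)^-1 *: p.
have nv : sqnorm v = (c - 1) / (1 + c).
  have -> : sqnorm v = sqnorm p / (1 + c) ^+ 2 by rewrite /sqnorm !mxE; field; rewrite gt_eqF.
  have -> : sqnorm p = c ^+ 2 - 1 by rewrite c2; ring.
  by field; rewrite gt_eqF.
have kE : 1 - sqnorm v = 2 / (1 + c) by rewrite nv; field; rewrite gt_eqF.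
exists v; first by rewrite /disk /= nv ltr_pdivrMr// mul1r; lra.
by apply: row2P; rewrite ?row2E0 ?row2E1 kE !mxE; field; rewrite gt_eqF.
Qed.

(** The metric that it pulls back is positive definite. *)
Lemma diff_poincare_inj v a : disk v -> 'd poincare v a = 0 -> a = 0.
Proof.
move=> vD dp; have := hyperboloid_metric_poincare a vD; rewrite dp.
have -> : hyperboloid_metric (poincare v) 0 = 0.
  by rewrite /hyperboloid_metric /sqnorm /dot2 !mxE; ring.
move=> /eqP; rewrite eq_sym mulf_eq0 invr_eq0 sqrf_eq0 (gt_eqF (x := 1 - sqnorm v)) ?subr_gt0// orbF.
rewrite mulf_eq0 pnatr_eq0 /= paddr_eq0 ?sqr_ge0// !sqrf_eq0 => /andP[/eqP a0 /eqP a1].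
exact: row2_eq0.
Qed.

Definition cosh (r : R) : R := (expR r + expR (- r)) / 2.

Lemma cosh2 r : cosh r ^+ 2 = 1 + sinh r ^+ 2.
Proof.
have E : expR r * expR (- r) = 1 by rewrite -expRD subrr expR0.
rewrite /cosh /sinh; move: (expR r) (expR (- r)) E => x y E.
have -> : ((x + y) / 2) ^+ 2 = ((x - y) / 2) ^+ 2 + x * y by field.
by rewrite E addrC.
Qed.

Lemma cosh_gt0 r : 0 < cosh r.
Proof. by rewrite divr_gt0// addr_gt0// expR_gt0. Qed.

Lemma is_derive_expRN (t : R) : is_derive t (1 : R) (fun s => expR (- s)) (- expR (- t)).
Proof.
have dN : differentiable (-%R : R -> R) t by apply/derivable1_diffP.
have := is_derive_comp1 dN (is_deriveNid t 1) (is_derive_expR (- t)).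
by rewrite mulrN1.
Qed.

Lemma is_derive_sinh (t : R) : is_derive t (1 : R) (@sinh R) (cosh t).
Proof.
have := is_derive_mul (is_derive_sub (is_derive_expR t) (is_derive_expRN t)) (is_derive_cst (2^-1 : R) t 1).
by move=> D; apply: is_derive_eq D _; rewrite /cosh /cst; ring.
Qed.

Lemma is_derive_cosh (t : R) : is_derive t (1 : R) cosh (sinh t).
Proof.
have := is_derive_mul (is_derive_add (is_derive_expR t) (is_derive_expRN t)) (is_derive_cst (2^-1 : R) t 1).
by move=> D; apply: is_derive_eq D _; rewrite /sinh /cst; ring.
Qed.

Lemma sinh_gt0 (r : R) : 0 < r -> 0 < sinh r.
Proof.
move=> r0; rewrite divr_gt0// subr_gt0 ltr_expR; lra.
Qed.

Lemma sinh0 : sinh (0 : R) = 0.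
Proof. by rewrite /sinh oppr0 subrr mul0r. Qed.

Lemma sinh_lt (x y : R) : x < y -> sinh x < sinh y.
Proof.
by move=> xy; rewrite ltr_pM2r// ltrB// ltr_expR// ltrN2.
Qed.

Lemma sinh_inj : injective (@sinh R).
Proof.
move=> x y xy; apply/eqP; rewrite eq_le !leNgt; apply/andP; split; apply/negP => /sinh_lt;
  by rewrite xy ltxx.
Qed.

Lemma Cks_sinh m k (U : set 'rV[R]_m) f : open U -> Cks k U f -> Cks k U (fun x => sinh (f x)).
Proof.
move=> oU Cf; pose h (n : nat) (t : R) := if odd n then cosh t else sinh t.
have dh n t : is_derive t (1 : R) (h n) (h n.+1 t).
  rewrite /h /=; case: (odd n) => /=; [exact: is_derive_cosh|exact: is_derive_sinh].
exact: (Cks_tower oU dh Cf 0).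
Qed.

Lemma Cks_sin_cos m k (U : set 'rV[R]_m) f : open U -> Cks k U f ->
  Cks k U (fun x => sin (f x)) /\ Cks k U (fun x => cos (f x)).
Proof.
(* Shifts by quarter turns put all the derivatives of [sin] in one tower, in which [cos] is the
   first step. *)
move=> oU Cf; pose h (n : nat) (t : R) := sin (t + n%:R * (pi / 2)).
have hS n t : cos (t + n%:R * (pi / 2)) = h n.+1 t.
  by rewrite /h -sinDpihalf; congr sin; rewrite -natr1; ring.
have dh n t : is_derive t (1 : R) (h n) (h n.+1 t).
  have D : is_derive t (1 : R) (fun s => s + n%:R * (pi / 2) : R) 1.
    have := is_derive_add (is_derive_id t (1 : R)) (is_derive_cst (n%:R * (pi / 2)) t (1 : R)).
    by rewrite addr0.
  have df : differentiable (fun s : R => s + n%:R * (pi / 2) : R) t.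
    by apply/derivable1_diffP; case: D.
  have := is_derive_comp1 df D (is_derive_sin _).
  by rewrite mulr1 hS.
have H := Cks_tower oU dh Cf; split.
  by apply: Cks_eq (H 0) => // x _; rewrite /h mul0r addr0.
by apply: Cks_eq (H 1) => // x _; rewrite -hS mul0r addr0.
Qed.

(* [s] is 1 or -1, according to the orientation. *)
Definition polar (s c : R) u : 'rV[R]_2 :=
  row2 (sinh (u 0 0) * cos (s * u 0 1 + c)) (sinh (u 0 0) * sin (s * u 0 1 + c)).

Lemma smooth_polar s c (U : set 'rV[R]_2) : open U -> smooth U (polar s c).
Proof.
move=> oU; have Ca k : Cks k U (fun u => s * u 0 1 + c).
  by apply: CksD => //; [apply: CksZ => //; exact: Cks_entry|exact: Cks_cst].
have Cr k : Cks k U (fun u => sinh (u 0 0)) by apply: Cks_sinh => //; exact: Cks_entry.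
by apply: smooth_row2 => // k; apply: CksM => //; have [] := Cks_sin_cos oU (Ca k).
Qed.

Lemma diff_polar s c u a : 'd (polar s c) u a =
  let b := s * u 0 1 + c in
  row2 (cosh (u 0 0) * a 0 0 * cos b - sinh (u 0 0) * s * a 0 1 * sin b)
       (cosh (u 0 0) * a 0 0 * sin b + sinh (u 0 0) * s * a 0 1 * cos b).
Proof.
have dq := smooth_differentiable (smooth_polar s c openT) (I : setT u).
have df0 : differentiable (fun u : 'rV[R]_2 => u 0 0 : R) u by exact: differentiable_coord.
have Dr := is_derive_comp1 df0 (is_derive_coord u a 0) (is_derive_sinh (u 0 0)).
have Db : is_derive u a (fun u => s * u 0 1 + c) (s * a 0 1).
  have := is_derive_add (is_derive_scale s (is_derive_coord u a 1)) (is_derive_cst c u a).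
  by rewrite addr0.
have dfb : differentiable (fun u : 'rV[R]_2 => s * u 0 1 + c : R) u.
  have C : Cks 1 setT (fun u : 'rV[R]_2 => s * u 0 1 + c).
    by apply: CksD; [exact: openT|apply: CksZ; [exact: openT|exact: Cks_entry openT]|exact: Cks_cst openT].
  exact: C.1.
have Dc := is_derive_comp1 dfb Db (is_derive_cos (s * u 0 1 + c)).
have Ds := is_derive_comp1 dfb Db (is_derive_sin (s * u 0 1 + c)).
rewrite (diff_row2 dq (fun z => erefl) (is_derive_mul Dr Dc) (is_derive_mul Dr Ds)) /=.
by congr row2; ring.
Qed.

Lemma hyperboloid_metric_polar s c u a : s * s = 1 ->
  hyperboloid_metric (polar s c u) ('d (polar s c) u a) =
  a 0 0 ^+ 2 + sinh (u 0 0) ^+ 2 * a 0 1 ^+ 2.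
Proof.
move=> ss; rewrite diff_polar /hyperboloid_metric /polar /dot2 /sqnorm /= !row2E0 !row2E1.
have := cos2Dsin2 (s * u 0 1 + c); have := cosh2 (u 0 0); have := cosh_gt0 (u 0 0).
move: (cos _) (sin _) (cosh _) (sinh _) (a 0 0) (a 0 1) => C Z ch sh x y ch0 ch2 CZ.
have -> : (sh * C * (ch * x * C - sh * s * y * Z) + sh * Z * (ch * x * Z + sh * s * y * C)) = sh * ch * x * (C ^+ 2 + Z ^+ 2) by ring.
have -> : 1 + ((sh * C) ^+ 2 + (sh * Z) ^+ 2) = ch ^+ 2.
  by rewrite ch2 -[in RHS](mulr1 (sh ^+ 2)) -CZ; ring.
have -> : (ch * x * C - sh * s * y * Z) ^+ 2 + (ch * x * Z + sh * s * y * C) ^+ 2 =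
   (ch ^+ 2 * x ^+ 2 + sh ^+ 2 * (s * s) * y ^+ 2) * (C ^+ 2 + Z ^+ 2) by ring.
rewrite CZ ss !mulr1.
have -> : (sh * ch * x) ^+ 2 / ch ^+ 2 = sh ^+ 2 * x ^+ 2 by field; rewrite gt_eqF.
by rewrite ch2; ring.
Qed.

Lemma diff_polar_inj s c u a : s * s = 1 -> 0 < u 0 0 ->
  'd (polar s c) u a = 0 -> a = 0.
Proof.
move=> ss u0 dp; have := hyperboloid_metric_polar c u a ss; rewrite dp.
have -> : hyperboloid_metric (polar s c u) 0 = 0.
  by rewrite /hyperboloid_metric /sqnorm /dot2 !mxE; ring.
have sh0 := sinh_gt0 u0.
move=> /eqP; rewrite eq_sym paddr_eq0; [|exact: sqr_ge0|by apply: mulr_ge0; exact: sqr_ge0].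
rewrite sqrf_eq0 mulf_eq0 !sqrf_eq0 (gt_eqF sh0) /=.
by move=> /andP[/eqP a0 /eqP a1]; exact: row2_eq0.
Qed.

End Coordinates.

(** * Hyperbolicity on the regular part *)

Section LocallyHyperbolic.
Variables (R : realType) (M : spacetime R) (S : set M) (V : cindex M -> M -> 'rV[R]_4).
Variable e : R.

Lemma linear_isom1 : linear_isom (1%:M : 'M[R]_4).
Proof. by split=> [x y|]; rewrite ?mulmx1 ?det1. Qed.

Lemma signed_metric_locally_hyperbolic : (e = 1 \/ e = -1) ->
  closed_spacelike_orthogonal_surface S -> transverse S V ->
  locally_hyperbolic S (signed_metric V e).
Proof.
move=> e1 [_ Sreg _] trV x Sx xreg.
have [U [s [u [sP Uu sx _]]]] := Sreg x Sx xreg.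
have [i _ ix] := xreg.
have iu : cdom i (s u) by rewrite sx.
have [v0 v0D v0E] := poincare_surj (gauss_map V e 1%:M i s u).
have [N [P [sg [_ [oP Pv0 PD sgP] sgv0 _ met]]]] :=
  local_param trV e1 linear_isom1 sP Uu iu (@open_disk R) v0D (@smooth_poincare R)
   (fun a => @diff_poincare_inj R v0 a v0D) v0E.
exists P, (s \o sg), v0; split=> //.
- by split=> //=; rewrite sgv0.
- move=> i' v a Pv iv; rewrite (met i' v a Pv iv) hyperboloid_metric_poincare //.
  exact: PD.
Qed.

End LocallyHyperbolic.

(** * Sectors of the plane *)

Section PlaneSector.
Variable R : realType.
Implicit Types (x y p : 'rV[R]_2) (b c m r s t : R).

Definition ee b : 'rV[R]_2 := row2 (cos b) (sin b).
Definition enorm x : R := Num.sqrt (sqnorm x).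

Lemma enorm_ge0 x : 0 <= enorm x.
Proof. exact: sqrtr_ge0. Qed.

Lemma enorm2 x : enorm x ^+ 2 = sqnorm x.
Proof. by rewrite sqr_sqrtr// sqnorm_ge0. Qed.

Lemma sqnorm_eq0 x : sqnorm x = 0 -> x = 0.
Proof.
move=> /eqP; rewrite paddr_eq0 ?sqr_ge0// !sqrf_eq0 => /andP[/eqP x0 /eqP x1].
exact: row2_eq0.
Qed.

Lemma enorm0 : enorm 0 = 0.
Proof. by rewrite /enorm /sqnorm !mxE expr0n /= addr0 sqrtr0. Qed.

Lemma enorm_eq0 x : enorm x = 0 -> x = 0.
Proof. by move=> x0; apply: sqnorm_eq0; rewrite -enorm2 x0 expr0n. Qed.

Lemma enorm_gt0 x : x != 0 -> 0 < enorm x.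
Proof.
move=> /eqP x0; rewrite lt_neqAle enorm_ge0 andbT; apply/eqP => H; apply: x0.
by apply: enorm_eq0; rewrite -H.
Qed.

Lemma sqnormZ r x : sqnorm (r *: x) = r ^+ 2 * sqnorm x.
Proof. by rewrite /sqnorm !mxE; ring. Qed.

Lemma sqnorm_ee b : sqnorm (ee b) = 1.
Proof. by rewrite /sqnorm row2E0 row2E1 cos2Dsin2. Qed.

Lemma enorm_Zee r b : 0 <= r -> enorm (r *: ee b) = r.
Proof. by move=> r0; rewrite /enorm sqnormZ sqnorm_ee mulr1 sqrtr_sqr ger0_norm. Qed.

Lemma ee_period b : ee (b + 2 * pi) = ee b.
Proof. by rewrite /ee mulr_natl cosD2pi sinD2pi. Qed.

Lemma ee_pi b : ee (b + pi) = - ee b.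
Proof. by apply: row2P; rewrite !mxE /= ?sinDpi ?cosDpi. Qed.

Lemma rot2_ee t r b : rot2 t (r *: ee b) = r *: ee (b + t).
Proof. by apply: row2P; rewrite !mxE /= ?cosD ?sinD; ring. Qed.

Lemma sqnorm_rot2 t x : sqnorm (rot2 t x) = sqnorm x.
Proof.
rewrite /sqnorm !row2E0 !row2E1.
transitivity ((cos t ^+ 2 + sin t ^+ 2) * (x 0 0 ^+ 2 + x 0 1 ^+ 2)); first by ring.
by rewrite cos2Dsin2 mul1r.
Qed.

Lemma cos_lt1 t : 0 < t < 2 * pi -> cos t < 1.
Proof.
move=> /andP[t0 t2]; have s0 : 0 < sin (t / 2).
  by apply: sin_gt0_pi; rewrite divr_gt0//= ltr_pdivrMr// mulrC.
have -> : t = t / 2 + t / 2 by field.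
rewrite cosD -!expr2.
by have := exprn_gt0 2 s0; have := cos2Dsin2 (t / 2); lra.
Qed.

Lemma ee_inj b c : ee b = ee c -> - (2 * pi) < b - c < 2 * pi -> b = c.
Proof.
move=> /rowP E; have E0 := E 0; have E1 := E 1; rewrite !mxE /= in E0 E1.
have C : cos (b - c) = 1 by rewrite cosB E0 E1 -!expr2 cos2Dsin2.
move=> /andP[h1 h2]; case: (ltgtP b c) => // bc; exfalso.
  have : cos (c - b) < 1 by apply: cos_lt1; apply/andP; split; lra.
  by rewrite -cosN opprB C ltxx.
have : cos (b - c) < 1 by apply: cos_lt1; apply/andP; split; lra.
by rewrite C ltxx.
Qed.

(** The angle is taken in the window of one turn centred at [m]: [t] is plus or minus the [acos] of
    the normalized component of [x] along [ee m], with the sign of the component across. *)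
Lemma polar_decomposition m x :
  exists2 t, - pi <= t <= pi & x = enorm x *: ee (m + t).
Proof.
have [->|x0] := eqVneq x 0.
  exists 0; first by rewrite oppr_le0 pi_ge0.
  by rewrite enorm0 scale0r.
have r0 := enorm_gt0 x0; set r := enorm x in r0 *.
pose al := dot2 x (ee m); pose be := x 0 1 * cos m - x 0 0 * sin m.
have CS := cos2Dsin2 m.
have x0E : x 0 0 = al * cos m - be * sin m.
  rewrite /al /be /dot2 row2E0 row2E1 -[LHS]mulr1 -CS; ring.
have x1E : x 0 1 = al * sin m + be * cos m.
  rewrite /al /be /dot2 row2E0 row2E1 -[LHS]mulr1 -CS; ring.
have ab : al ^+ 2 + be ^+ 2 = r ^+ 2.
  rewrite enorm2 /sqnorm x0E x1E.
  transitivity ((al ^+ 2 + be ^+ 2) * (cos m ^+ 2 + sin m ^+ 2)); first by rewrite CS mulr1.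
  by ring.
have rn0 : r != 0 by rewrite gt_eqF.
have E1 : (al / r) ^+ 2 + (be / r) ^+ 2 = 1.
  by rewrite !exprMn -mulrDl ab -exprMn divff// expr1n.
have ar : -1 <= al / r <= 1.
  rewrite -ler_norml -[leRHS]sqrtr1 -sqrtr_sqr ler_wsqrtr// -E1 lerDl sqr_ge0//.
pose t0 := acos (al / r).
have t0r : 0 <= t0 <= pi by rewrite acos_ge0//= acos_lepi.
have ct : cos t0 = al / r by rewrite acosK.
have st : sin t0 = `|be| / r.
  have -> : `|be| / r = Num.sqrt ((be / r) ^+ 2) by rewrite sqrtr_sqr normf_div (gtr0_norm r0).
  rewrite sin_acos//; congr Num.sqrt.
  by rewrite -E1; ring.
have fin t : cos t = al / r -> sin t = be / r -> x = r *: ee (m + t).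
  move=> Ec Es; apply: row2P; rewrite !mxE /= ?cosD ?sinD Ec Es ?x0E ?x1E; field.
    by [].
  by [].
have [b0|b0] := leP 0 be.
  exists t0; last by apply: fin => //; rewrite st ger0_norm.
  by case/andP: t0r => h1 ->; rewrite (le_trans _ h1)// oppr_le0 pi_ge0.
exists (- t0); last by apply: fin; rewrite ?cosN// sinN st ltr0_norm// mulNr opprK.
by case/andP: t0r => h1 h2; rewrite lerN2 h2 /= (le_trans _ (pi_ge0 R))// oppr_le0.
Qed.

Lemma polar_atan p : 0 < p 0 0 -> p = enorm p *: ee (atan (p 0 1 / p 0 0)).
Proof.
move=> p0; set q := p 0 1 / p 0 0.
have E : sqnorm p = (p 0 0) ^+ 2 * (1 + q ^+ 2).
  by rewrite /sqnorm /q; field; rewrite gt_eqF.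
have q1 : 0 < 1 + q ^+ 2 by rewrite ltr_wpDr// sqr_ge0.
have nE : enorm p = p 0 0 * Num.sqrt (1 + q ^+ 2).
  by rewrite /enorm E sqrtrM ?sqr_ge0// sqrtr_sqr gtr0_norm.
have s0 : Num.sqrt (1 + q ^+ 2) != 0 by rewrite gt_eqF// sqrtr_gt0.
have cE : cos (atan q) = (Num.sqrt (1 + q ^+ 2))^-1 by exact: cos_atan.
have sE : sin (atan q) = q * cos (atan q).
  rewrite -{2}(atanK q) /tan divfK// cE invr_eq0//.
apply: row2P; rewrite !mxE /= ?sE cE nE; first by field.
by rewrite /q; field; rewrite s0 gt_eqF.
Qed.

(* Nonnegative exactly on the [r *: ee b] with [0 <= r] and [0 <= b <= th]. *)
Definition sector th x : R := dot2 x (ee (th / 2)) - cos (th / 2) * enorm x.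

Lemma dot2_ee b c : dot2 (ee b) (ee c) = cos (b - c).
Proof. by rewrite /dot2 !row2E0 !row2E1 cosB. Qed.

Lemma sectorZ th r x : 0 <= r -> sector th (r *: x) = r * sector th x.
Proof.
move=> r0; rewrite /sector /enorm sqnormZ sqrtrM ?sqr_ge0// sqrtr_sqr ger0_norm//.
by rewrite /dot2 !mxE; ring.
Qed.

Lemma sector_ee th r b : 0 <= r -> sector th (r *: ee b) = r * (cos (b - th / 2) - cos (th / 2)).
Proof.
move=> r0; rewrite sectorZ// /sector dot2_ee (_ : enorm _ = 1) ?mulr1//.
by rewrite /enorm sqnorm_ee sqrtr1.
Qed.

Lemma sector_ee_ge0 th r b : 0 < th < 2 * pi -> 0 <= r -> 0 <= b <= th ->
  0 <= sector th (r *: ee b).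
Proof.
move=> /andP[t0 t1] r0 br; rewrite sector_ee// mulr_ge0// subr_ge0 -(cos_norm (b - th / 2)).
have n : `|b - th / 2| <= th / 2 by rewrite ler_norml; apply/andP; split; lra.
by rewrite leNgt ltr_cos ?in_itv /= ?normr_ge0 -?leNgt//=; lra.
Qed.

Lemma sector_ee0 th r : 0 <= r -> sector th (r *: ee 0) = 0.
Proof. by move=> r0; rewrite sector_ee// sub0r cosN subrr mulr0. Qed.

Lemma sector_eeth th r : 0 <= r -> sector th (r *: ee th) = 0.
Proof.
move=> r0; rewrite sector_ee//.
by rewrite (_ : th - th / 2 = th / 2) ?subrr ?mulr0//; field.
Qed.

Lemma sector0 th : sector th 0 = 0.
Proof. by rewrite -(scale0r (ee 0)) sector_ee0. Qed.

Lemma continuous_entry2 j : continuous (fun x : 'rV[R]_2 => x 0 j : R).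
Proof. exact: coord_continuous. Qed.

Lemma continuous_sector th : continuous (sector th).
Proof.
move=> x; apply: (@continuousB _ _ _ (fun x => dot2 x (ee (th / 2))) (fun x => cos (th / 2) * enorm x)).
  apply: (@continuousD _ _ _ (fun x => x 0 0 * ee (th / 2) 0 0) (fun x => x 0 1 * ee (th / 2) 0 1)).
    by apply: continuousM; [exact: continuous_entry2|exact: cst_continuous].
  by apply: continuousM; [exact: continuous_entry2|exact: cst_continuous].
apply: continuousM; first exact: cst_continuous.
apply: (@continuous_comp _ _ _ (@sqnorm R) Num.sqrt); first exact: continuous_sqnorm.
exact: sqrt_continuous.
Qed.

Section Angle.
Variable th : R.
Hypothesis th2 : 0 < th < 2 * pi.

Let h0 : 0 < th / 2 < pi.
Proof. by case/andP: th2 => t0 t1; apply/andP; split; lra. Qed.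

(** The window is centred at the bisector: for [t = b - th / 2] the sign of [sector] compares
    [cos t] with [cos (th / 2)], and [cos] is even and decreasing on [0, pi]. *)
Lemma sector_polar x : exists2 b, - (pi - th / 2) <= b <= pi + th / 2 &
  x = enorm x *: ee b /\
  (0 < enorm x -> [/\ (0 <= sector th x <-> 0 <= b <= th) &
    (sector th x = 0 <-> b = 0 \/ b = th)]).
Proof.
have [t tr xE] := polar_decomposition (th / 2) x.
exists (th / 2 + t); first by case/andP: tr => t1 t2; apply/andP; split; lra.
split=> // x0; have E : sector th x = enorm x * (cos t - cos (th / 2)).
  rewrite {1}xE sector_ee ?enorm_ge0//; congr (_ * (cos _ - _)); lra.
have tn : `|t| \in `[0, pi] by rewrite in_itv /= normr_ge0 ler_norml.
have hn : th / 2 \in `[0, pi] by case/andP: h0 => a1 a2; rewrite in_itv /= !ltW.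
case/andP: h0 => a1 a2; split.
  rewrite E pmulr_rge0// subr_ge0 -(cos_norm t).
  rewrite leNgt ltr_cos// -leNgt ler_norml.
  by split=> /andP[u1 u2]; apply/andP; split; lra.
rewrite E; split=> [/eqP|].
  rewrite mulf_eq0 gt_eqF//= subr_eq0 -(cos_norm t) => /eqP /(cos_inj tn hn) tE.
  have [t0|t0] := leP 0 t; [right|left]; first by move: tE; rewrite ger0_norm//; lra.
  by move: tE; rewrite ltr0_norm//; lra.
move=> H; have -> : cos t = cos (th / 2); last by rewrite subrr mulr0.
by case: H => H; [rewrite -(cosN t)|]; congr cos; lra.
Qed.

End Angle.

End PlaneSector.

(** * Polar coordinates adapted to a sector *)

Section SectorChart.
Variable R : realType.

Lemma IVT_sign (g : R -> R) (x y m : R) : continuous g -> x < m < y ->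
  (forall b, x < b < y -> g b != 0) -> 0 < g m -> forall b, x < b < y -> 0 < g b.
Proof.
move=> cg /andP[xm my] g0 gm b /andP[xb by_]; rewrite ltNge; apply/negP => gb.
have cw (s t : R) : {within `[s, t], continuous g} by apply: continuous_subspaceT.
have [mb|bm] := leP m b.
  have [|c] := IVT (v := 0) mb (cw m b).
    by rewrite ge_min gb orbT le_max (ltW gm).
  rewrite in_itv /= => /andP[mc cb] gc.
  have := g0 c; rewrite gc eqxx => /(_ _)/negP; apply=> //.
  by rewrite (lt_le_trans xm mc) (le_lt_trans cb by_).
have [|c] := IVT (v := 0) (ltW bm) (cw b m).
  by rewrite ge_min gb /= le_max (ltW gm) orbT.
rewrite in_itv /= => /andP[bc cm] gc.
have := g0 c; rewrite gc eqxx => /(_ _)/negP; apply=> //.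
by rewrite (lt_le_trans xb bc) (le_lt_trans cm my).
Qed.

(** The bounds on [a] place the test angles [th / 2] and [th / 2 + pi] in the two open arcs that
    [gm] and [gm + th] cut on the circle, whatever [gm] between [- a] and [a]. On each arc [g] keeps
    the sign it has at the test angle. *)
Lemma arc_signs (g : R -> R) (th a gm : R) : 0 < th < 2 * pi ->
  a < th / 2 -> a < pi - th / 2 -> - a < gm < a -> continuous g ->
  (forall b, g b = 0 -> ee b = ee gm \/ ee b = ee (gm + th)) ->
  0 < g (th / 2) -> g (th / 2 + pi) < 0 ->
  (forall b, gm < b < gm + th -> 0 < g b) /\
  (forall b, gm + th < b < gm + 2 * pi -> g b < 0).
Proof.
move=> /andP[t0 t1] a1 a2 /andP[ga1 ga2] gc zchar gp gn; split.
  apply: (@IVT_sign g gm (gm + th) (th / 2)) => //; first by apply/andP; split; lra.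
  move=> b /andP[b1 b2]; apply/eqP => /zchar [] /ee_inj E.
    by have := E (ltac:(apply/andP; split; lra)); lra.
  by have := E (ltac:(apply/andP; split; lra)); lra.
move=> b bb; rewrite -oppr_gt0; move: b bb.
apply: (@IVT_sign (fun b => - g b) (gm + th) (gm + 2 * pi) (th / 2 + pi)).
+ by move=> b; apply: continuousN; exact: gc.
+ by apply/andP; split; lra.
+ move=> b /andP[b1 b2]; rewrite oppr_eq0; apply/eqP => /zchar [] /ee_inj E.
    by have := E (ltac:(apply/andP; split; lra)); lra.
  by have := E (ltac:(apply/andP; split; lra)); lra.
+ by rewrite oppr_gt0.
Qed.

Lemma polarE s c (u : 'rV[R]_2) : polar s c u = sinh (u 0 0) *: ee (s * u 0 1 + c).
Proof. by apply: row2P; rewrite !mxE. Qed.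

Lemma norm_Zee (r b : R) : `|r *: ee b| <= `|r|.
Proof.
rewrite normrZ ler_piMr//; apply: norm_row_le => // j.
have [->|->] := ord2P j.
  by rewrite row2E0 ler_norml cos_geN1 cos_le1.
by rewrite row2E1 ler_norml sin_geN1 sin_le1.
Qed.

Lemma enorm_le_norm (x : 'rV[R]_2) : enorm x <= 2 * `|x|.
Proof.
have n0 := normr_ge0 x.
rewrite -[leRHS]ger0_norm ?mulr_ge0// -sqrtr_sqr ler_wsqrtr//.
have H j : x 0 j ^+ 2 <= `|x| ^+ 2.
  by rewrite -real_normK ?num_real// lerXn2r ?nnegrE// norm_entry_le.
have := H 0; have := H 1; rewrite /sqnorm exprMn; have := sqr_ge0 `|x|; lra.
Qed.

Lemma continuous_sinh : continuous (@sinh R).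
Proof.
move=> t; apply: differentiable_continuous; apply/derivable1_diffP.
by case: (is_derive_sinh t).
Qed.

Lemma continuous_polar s c : continuous (polar s c : 'rV[R]_2 -> 'rV[R]_2).
Proof. by move=> u; exact: (smooth_continuous (smooth_polar s c openT) I). Qed.

(** The first entry grows at least three times as fast as the second can vary. Factoring both
    differences of squares, the first is at least nine times a bound for the second. *)
Lemma sqr_norm_lt (l r t A0 A1 B0 B1 : R) : 0 < l -> 0 <= t -> t < r ->
  3 * l * (r - t) <= A0 - B0 -> `|A1 - B1| <= l * (r - t) ->
  3 * l * t <= B0 -> 3 * l * r <= A0 -> `|A1| <= l * r -> `|B1| <= l * t ->
  B0 ^+ 2 + B1 ^+ 2 < A0 ^+ 2 + A1 ^+ 2.
Proof.
move=> l0 t0 tr h0 h1 b0 a0 a1 b1.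
have d0 : 0 < r - t by rewrite subr_gt0.
have s0 : 0 < r + t by rewrite ltr_wpDr// (le_lt_trans t0).
have p0 : 0 < l * (r - t) by rewrite mulr_gt0.
have q0 : 0 < l * (r + t) by rewrite mulr_gt0.
have E1 : 3 * (l * (r - t)) * (3 * (l * (r + t))) <= (A0 - B0) * (A0 + B0).
  apply: ler_pM; [by rewrite mulr_ge0// ltW|by rewrite mulr_ge0// ltW| |].
    by rewrite mulrA.
  by have := lerD a0 b0; lra.
have E2 : `|(A1 - B1) * (A1 + B1)| <= (l * (r - t)) * (l * (r + t)).
  rewrite normrM; apply: ler_pM => //.
  by apply: le_trans (ler_normD _ _) _; have := lerD a1 b1; lra.
have E3 : - ((l * (r - t)) * (l * (r + t))) <= (A1 - B1) * (A1 + B1).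
  by move: E2; rewrite ler_norml => /andP[].
have pq : 0 < (l * (r - t)) * (l * (r + t)) by rewrite mulr_gt0.
rewrite -subr_gt0; have -> : A0 ^+ 2 + A1 ^+ 2 - (B0 ^+ 2 + B1 ^+ 2) =
  (A0 - B0) * (A0 + B0) + (A1 - B1) * (A1 + B1) by ring.
by move: E1 E3 pq; set P := l * (r - t); set Q := l * (r + t); set X := (A0 - B0) * _; set Y := (A1 - B1) * _; rewrite (_ : 3 * P * (3 * Q) = 9 * (P * Q)); [lra|ring].
Qed.

(* [v] is an inverse of [Phi] in polar coordinates.  The curve [v (row2 r _)] meets
   the first side of the sector at the angle [g], the second one at [g + th], and is
   in the sector exactly between these two angles. *)
Definition sector_chart (th : R) (B : set 'rV[R]_2) (Phi : 'rV[R]_2 -> 'rV[R]_2)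
    (dl s c eta a : R) (v : 'rV[R]_2 -> 'rV[R]_2) (N : set 'rV[R]_2) : Prop :=
  [/\ [/\ 0 < eta, 0 < a, a < th / 2 & a < pi - th / 2],
      [/\ open N, N 0 & N `<=` B],
      (forall u : 'rV[R]_2, 0 <= u 0 0 < eta ->
        [/\ {for u, continuous v}, Phi (v u) = polar s c u & N (v u)]) /\
      (forall D : set 'rV[R]_2, nbhs (0 : 'rV[R]_2) D -> exists2 eps : R, 0 < eps &
        forall u : 'rV[R]_2, 0 <= u 0 0 < eps -> D (v u)),
      forall x u : 'rV[R]_2, N x -> 0 <= u 0 0 < eta -> Phi x = polar s c u -> x = v u &
      forall r : R, 0 < r < eta -> exists g rho : R,
        [/\ [/\ - a < g < a, 0 < rho < dl, v (row2 r g) = rho *: ee 0 &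
                v (row2 r (g + th)) = rho *: ee th],
            forall b : R, g < b < g + th -> 0 < sector th (v (row2 r b)) &
            forall b : R, g + th < b < g + 2 * pi -> sector th (v (row2 r b)) < 0]].

Section Normalized.
Variables (th : R) (Phi : 'rV[R]_2 -> 'rV[R]_2) (B : set 'rV[R]_2) (lam mu nu dl : R).
Hypotheses (th2 : 0 < th < 2 * pi) (oB : open B) (B0 : B 0) (CPhi : smooth B Phi).
Hypotheses (Phi0 : Phi 0 = 0) (lam0 : 0 < lam) (nu0 : 0 < nu) (dl0 : 0 < dl).
Hypothesis dPhi0 : 'd Phi 0 (delta_mx 0 0) = row2 lam 0.
Hypothesis dPhi1 : 'd Phi 0 (delta_mx 0 1) = row2 mu nu.
(* For [th != pi], [Phi_rot] forces the differential of [Phi] to be conformal. *)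
Hypothesis conf : th = pi \/ mu = 0 /\ nu = lam.
Hypothesis Phi_rot : forall rho : R, 0 <= rho < dl ->
  Phi (rho *: ee th) = rot2 th (Phi (rho *: ee 0)).

(** Half of the smaller of the two angular margins, so that both inequalities of [arc_signs] are
    strict; moreover [a < pi / 2], which makes [tan a] positive. *)
Let a : R := Num.min (th / 2) (pi - th / 2) / 2.

Let a_bounds : [/\ 0 < a, a < th / 2, a < pi - th / 2 & a < pi / 2].
Proof.
case/andP: th2 => t0 t1; rewrite /a; case: (leP (th / 2) (pi - th / 2)) => h; split; lra.
Qed.

(** Relative error allowed along the first side: [1 / 4] makes the norm of [Phi] increase there, by
    [sqr_norm_lt] with [lam / 4], and [tan a / 4] keeps the argument of [Phi] within [a]. *)
Let kap : R := Num.min 1 (tan a) / 4.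

Let tana : 0 < tan a.
Proof.
have [a0 _ _ a2] := a_bounds.
rewrite divr_gt0// ?sin_gt0_pihalf ?cos_gt0_pihalf ?a0//.
by rewrite a2 andbT (lt_trans _ a0)// oppr_lt0 divr_gt0 ?pi_gt0.
Qed.

Let kap_bounds : [/\ 0 < kap, kap <= 1 / 4 & kap <= tan a / 4].
Proof.
rewrite /kap; split.
- by rewrite divr_gt0// lt_min ltr01 tana.
- by rewrite ler_pM2r// ge_min lexx.
- by rewrite ler_pM2r// ge_min lexx orbT.
Qed.

Let det2_row2 : det2 (row2 lam 0) (row2 mu nu) = lam * nu.
Proof. by rewrite /det2 !row2E0 !row2E1 mul0r subr0. Qed.

Let dPhi_inj b : 'd Phi 0 b = 0 -> b = 0.
Proof.
move: b; apply/(det2_injective ('d Phi 0)).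
by rewrite dPhi0 dPhi1 det2_row2 mulf_neq0// gt_eqF.
Qed.

(** [p] is the direction sent to the bisector by the differential. In the conformal case it is a
    positive multiple of the bisector; if [th = pi], [sector] is the second entry, whose value at
    [p] is [nu^-1]. *)
Lemma sector_direction_sign (p : 'rV[R]_2) : 'd Phi 0 p = ee (th / 2) ->
  0 < sector th p /\ sector th (- p) < 0.
Proof.
move=> pE; have D0 : det2 (row2 lam 0) (row2 mu nu) != 0.
  by rewrite det2_row2 mulf_neq0// gt_eqF.
have [p0 p1] := cramer2 dPhi0 dPhi1 pE D0.
have ln0 : lam != 0 by rewrite gt_eqF.
have nn0 : nu != 0 by rewrite gt_eqF.
rewrite det2_row2 /det2 !row2E0 !row2E1 in p0 p1.
have [thE|[mu0 nuE]] := conf.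
  have eE : ee (th / 2) = row2 0 1 by rewrite thE /ee cos_pihalf sin_pihalf.
  have p1E : p 0 1 = nu^-1 by rewrite p1 thE sin_pihalf; field; rewrite ln0 nn0.
  rewrite /sector eE thE cos_pihalf !mul0r !subr0 /dot2 !row2E0 !row2E1 !mxE !mulr0 !add0r !mulr1 p1E.
  by rewrite oppr_lt0 invr_gt0.
have pE' : p = lam^-1 *: ee (th / 2).
  by apply: row2P; rewrite ?p0 ?p1 !mxE /= ?mu0 ?nuE; field.
have l0 : 0 < lam^-1 by rewrite invr_gt0.
have h2 : 0 < th / 2 < 2 * pi by case/andP: th2 => t0 t1; apply/andP; split; lra.
have h3 : 0 < pi - th / 2 < 2 * pi.
  by case/andP: th2 => t0 t1; have := pi_gt0 R => pp; apply/andP; split; lra.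
have c1 := cos_lt1 h2; have c2 := cos_lt1 h3.
have c3 : cos (th / 2) = - cos (pi - th / 2).
  by rewrite cosB cospi sinpi; ring.
split.
  by rewrite pE' sector_ee ?(ltW l0)// subrr cos0 mulr_gt0// subr_gt0.
have -> : - p = lam^-1 *: ee (th / 2 + pi) by rewrite ee_pi pE' scalerN.
rewrite sector_ee ?(ltW l0)// (_ : th / 2 + pi - th / 2 = pi); last by ring.
by rewrite pmulr_rlt0// cospi; lra.
Qed.

(** To first order [Psi] moves along [p] on this ray; since [sector] is positively homogeneous, one
    can divide by [h] and pass to the limit. The opposite ray corresponds to negative [h]. *)
Lemma sector_near_ray (Psi : 'rV[R]_2 -> 'rV[R]_2) : differentiable Psi 0 -> Psi 0 = 0 ->
  'd Phi 0 ('d Psi 0 (ee (th / 2))) = ee (th / 2) ->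
  exists2 h1 : R, 0 < h1 & forall h, 0 < h < h1 ->
    0 < sector th (Psi (h *: ee (th / 2))) /\
    sector th (Psi (h *: ee (th / 2 + pi))) < 0.
Proof.
move=> dPsi Psi0 pE; have [sp sn] := sector_direction_sign pE.
set p := 'd Psi 0 (ee (th / 2)) in sp sn.
have DE : 'D_(ee (th / 2)) Psi 0 = p by rewrite deriveE.
have H : (fun h : R => h^-1 *: (Psi (h *: ee (th / 2) + 0) - Psi 0)) @ 0^' --> p.
  by rewrite -DE; exact: (diff_derivable (v := ee (th / 2)) dPsi).
have H1 : \forall h \near (0 : R)^', 0 < sector th (h^-1 *: Psi (h *: ee (th / 2))).
  have := cvg_comp _ _ H (@continuous_sector R th p) => /(_ [set t | 0 < t]) [|e e0 eP].
    by apply: open_nbhs_nbhs; split => //; exact: open_gt.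
  by exists e => // h he hn; have := eP h he hn; rewrite /= addr0 Psi0 subr0.
have H2 : \forall h \near (0 : R)^', sector th (- (h^-1 *: Psi (h *: ee (th / 2)))) < 0.
  have HN : (- (fun h : R => h^-1 *: (Psi (h *: ee (th / 2) + 0) - Psi 0))) @ 0^' --> - p.
    exact: cvgN.
  have := cvg_comp _ _ HN (@continuous_sector R th (- p)) => /(_ [set t | t < 0]) [|e e0 eP].
    by apply: open_nbhs_nbhs; split => //; exact: open_lt.
  exists e => // h he hn.
    have : sector th (- (h^-1 *: (Psi (h *: ee (th / 2) + 0) - Psi 0))) < 0 by exact: eP h he hn.
    by rewrite addr0 Psi0 subr0.
case: H1 => e1 /= e10 H1; case: H2 => e2 /= e20 H2.
exists (Num.min e1 e2); first by rewrite lt_min e10.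
move=> h /andP[h0]; rewrite lt_min => /andP[he1 he2].
split.
  have := H1 h; rewrite /ball_ /= sub0r normrN gtr0_norm// gt_eqF// => /(_ he1 isT).
  rewrite sectorZ ?invr_ge0 ?ltW//; by rewrite pmulr_rgt0 ?invr_gt0.
have := H2 (- h); rewrite /ball_ /= opprK add0r gtr0_norm// oppr_eq0 gt_eqF// => /(_ he2 isT).
rewrite invrN scaleNr opprK sectorZ ?invr_ge0 ?ltW// pmulr_rlt0 ?invr_gt0//.
by rewrite scaleNr -scalerN -ee_pi.
Qed.

Lemma ray_estimate : exists d : R, [/\ 0 < d, ball (0 : 'rV[R]_2) d `<=` B &
  forall r t : R, 0 <= t -> t <= r -> r < d ->
    `|Phi (r *: ee 0) 0 0 - Phi (t *: ee 0) 0 0 - lam * (r - t)| <= lam * kap * (r - t) /\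
    `|Phi (r *: ee 0) 0 1 - Phi (t *: ee 0) 0 1| <= lam * kap * (r - t)].
Proof.
have [k0 _ _] := kap_bounds.
have lk0 : 0 < lam * kap by rewrite mulr_gt0.
have [d [d0 dB _ dS]] := strict_diff oB B0 (CPhi 1%N) lk0.
exists d; split=> // r t t0 tr rd.
have inb (x : R) : 0 <= x -> x < d -> ball (0 : 'rV[R]_2) d (x *: ee 0).
  move=> x0 xd; rewrite -ball_normE /= sub0r normrN.
  by apply: le_lt_trans (norm_Zee _ _) _; rewrite ger0_norm.
have rt0 : 0 <= r - t by rewrite subr_ge0.
have := dS _ _ (inb r (le_trans t0 tr) rd) (inb t t0 (le_lt_trans tr rd)).
have e0E : ee (0 : R) = delta_mx 0 0.
  by apply: row2P; rewrite !mxE /= ?cos0 ?sin0.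
have -> : 'd Phi 0 (r *: ee 0 - t *: ee 0) = (r - t) *: row2 lam 0.
  by rewrite -scalerBl e0E linearZ /= dPhi0.
set X := Phi _ - Phi _ - _ => H.
have nrt : lam * kap * `|r *: ee 0 - t *: ee 0| <= lam * kap * (r - t).
  rewrite ler_wpM2l ?(ltW lk0)// -scalerBl; apply: le_trans (norm_Zee _ _) _.
  by rewrite ger0_norm.
have H0 := le_trans (norm_entry_le X 0) (le_trans H nrt).
have H1 := le_trans (norm_entry_le X 1) (le_trans H nrt).
rewrite /X !mxE /= in H0 H1; split.
  by apply: le_trans H0; rewrite (mulrC lam).
by apply: le_trans H1; rewrite mulr0 subr0.
Qed.

(** Strict increase of the norm means that a small circle meets the image of the first side at most
    once; the bound on the argument locates the meeting point for [arc_signs]. *)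
Lemma ray_monotone : exists d : R, [/\ 0 < d, ball (0 : 'rV[R]_2) d `<=` B,
  forall r t : R, 0 <= t -> t < r -> r < d ->
    sqnorm (Phi (t *: ee 0)) < sqnorm (Phi (r *: ee 0)) &
  forall r : R, 0 < r < d ->
    0 < Phi (r *: ee 0) 0 0 /\ - a < atan (Phi (r *: ee 0) 0 1 / Phi (r *: ee 0) 0 0) < a].
Proof.
have [d [d0 dB H]] := ray_estimate; have [k0 k1 k2] := kap_bounds.
have lk0 : 0 < lam * kap by rewrite mulr_gt0.
have lk1 : lam * kap <= lam / 4 by rewrite ler_pM2l// -div1r.
have l4 : 0 < lam / 4 by rewrite divr_gt0.
have Q (r : R) : 0 <= r -> r < d -> [/\ lam * r - lam * kap * r <= Phi (r *: ee 0) 0 0 &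
    `|Phi (r *: ee 0) 0 1| <= lam * kap * r].
  move=> r0 rd; have := H r 0 (lexx 0) r0 rd.
  rewrite scale0r Phi0 !mxE !subr0 => -[H0 H1]; split=> //.
  by move: H0; rewrite ler_norml => /andP[H0 _]; move: H0; lra.
have K4 (x : R) : 0 <= x -> lam * kap * x <= lam / 4 * x by move=> x0; rewrite ler_wpM2r.
exists d; split=> //.
  move=> r t t0 tr rd; have r0 := le_lt_trans t0 tr.
  have [q0 q1] := Q r (ltW r0) rd; have [p0 p1] := Q t t0 (lt_trans tr rd).
  have [h0 h1] := H r t t0 (ltW tr) rd.
  have rt0 : 0 <= r - t by rewrite subr_ge0 ltW.
  have Kr := K4 r (ltW r0); have Kt := K4 t t0; have Krt := K4 _ rt0.
  have E (x : R) : lam * x = 4 * (lam / 4) * x by field.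
  rewrite E in q0; rewrite E in p0; rewrite E in h0.
  apply: (sqr_norm_lt l4 t0 tr); [|exact: le_trans h1 Krt| | |exact: le_trans q1 Kr|exact: le_trans p1 Kt].
  - by move: h0; rewrite ler_norml => /andP[h0 _]; move: h0 Krt; lra.
  - by move: p0 Kt; lra.
  - by move: q0 Kr; lra.
move=> r /andP[r0 rd]; have [q0 q1] := Q r (ltW r0) rd; have Kr := K4 r (ltW r0).
have lr0 : 0 < lam * r by rewrite mulr_gt0.
have P0 : 0 < Phi (r *: ee 0) 0 0 by move: q0 Kr; lra.
split=> //.
have [a0 _ _ a2] := a_bounds.
have tQ : `|Phi (r *: ee 0) 0 1| < tan a * Phi (r *: ee 0) 0 0.
  apply: le_lt_trans q1 _; apply: (@lt_le_trans _ _ (tan a * (lam * r / 2))).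
    have -> : lam * kap * r = kap * (lam * r) by ring.
    have -> : tan a * (lam * r / 2) = (tan a / 2) * (lam * r) by ring.
    by rewrite ltr_pM2r//; have := tana; lra.
  by rewrite ler_pM2l; [move: q0 Kr; lra|exact: tana].
have ain : a \in `](- (pi / 2)), (pi / 2)[.
  by rewrite in_itv /= a2 andbT (lt_trans _ a0)// oppr_lt0 divr_gt0// pi_gt0.
move: tQ; rewrite ltr_norml => /andP[t1 t2].
have aE := tanK ain; apply/andP; split.
  rewrite -[X in - X < _]aE -atanN; apply: lt_atan.
  by rewrite ltr_pdivlMr// mulNr.
by rewrite -[ltRHS]aE; apply: lt_atan; rewrite ltr_pdivrMr.
Qed.

(** [v] is polar coordinates followed by the local inverse of [Phi]. On the circle of radius [r], a
    zero of [sector] is on one of the sides; [Phi_rot] transfers both cases to the first side, and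
    [ray_monotone] makes the distance [rho] to the centre unique. So the zeros are [gm] and
    [gm + th] up to full turns, and [arc_signs] applies. *)
Lemma normalized_sector_chart :
  exists (eta a' : R) v N, sector_chart th B Phi dl 1 0 eta a' v N.
Proof.
have [d [d0 dB mono ang]] := ray_monotone.
have [a0 a1 a2 _] := a_bounds.
pose d1 := Num.min d dl.
have d10 : 0 < d1 by rewrite lt_min d0.
pose B1 := ball (0 : 'rV[R]_2) d1.
have B1B : B1 `<=` B.
  by move=> x Bx; apply: dB; apply: le_ball Bx; rewrite ge_min lexx.
have CB1 : smooth B1 Phi by move=> k; exact: Ck_sub B1B (CPhi k).
have [N [W [Psi [[oN N0 NB1 oW] [CPsi NW WN _ dPsi]]]]] :=
  inverse_function (ball_open 0 d1) (ballxx 0 d10) CB1 dPhi_inj.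
have W0 : W 0 by have [] := NW 0 N0; rewrite Phi0.
have Psi0 : Psi 0 = 0 by have [_] := NW 0 N0; rewrite Phi0.
have [n /= n0 nN] := (nbhs_ballP _ _).1 (open_nbhs_nbhs (conj oN N0)).
(* The factor 1/2 compensates the one of [enorm_le_norm]: the points of both sides at the same
   Euclidean distance as [Psi w] are still in [N]. *)
have [e1 /= e10 e1W] : exists2 e1 : R, 0 < e1 & forall w : 'rV[R]_2, ball 0 e1 w -> W w /\ `|Psi w| < n / 2.
  have H1 : \forall w \near (0 : 'rV[R]_2), W w by exact: open_nbhs_nbhs.
  have H2 : \forall w \near (0 : 'rV[R]_2), ball (Psi 0) (n / 2) (Psi w).
    by apply: (smooth_continuous CPsi W0); apply: nbhsx_ballx; rewrite divr_gt0.
  have [e1 e10 e1W] := (nbhs_ballP _ _).1 (filterI H1 H2).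
  exists e1 => // w /e1W [Ww]; rewrite Psi0 -ball_normE /= sub0r normrN.
  by split.
have [dPsi0 pE] := dPsi 0 W0.
have pE' : 'd Phi 0 ('d Psi 0 (ee (th / 2))) = ee (th / 2).
  exact: (eq_ind _ (fun z : 'rV[R]_2 => 'd Phi z ('d Psi 0 (ee (th / 2))) = ee (th / 2)) (pE _) _ Psi0).
have [h1 h10 h1P] := sector_near_ray dPsi0 Psi0 pE'.
have [eta /= eta0 etaP] : exists2 eta : R, 0 < eta & forall r : R, 0 <= r < eta -> sinh r < e1 /\ sinh r < h1.
  have H1 : \forall r \near (0 : R), sinh r < Num.min e1 h1.
    have : nbhs (sinh (0 : R)) [set t | t < Num.min e1 h1].
      apply: open_nbhs_nbhs; split; first exact: open_lt.
      by rewrite /= sinh0 lt_min e10.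
    exact: (@continuous_sinh 0).
  have [eta eta0 etaP] := (nbhs_ballP _ _).1 H1.
  exists eta => // r /andP[r0 re]; have := etaP r; rewrite -ball_normE /= sub0r normrN ger0_norm//.
  by move=> /(_ re); rewrite lt_min => /andP[].
have sinh_ge0 (r : R) : 0 <= r -> 0 <= sinh r.
  by rewrite le_eqVlt => /predU1P[<-|/sinh_gt0/ltW//]; rewrite sinh0.
pose v (u : 'rV[R]_2) := Psi (polar 1 0 u).
have uP (u : 'rV[R]_2) : 0 <= u 0 0 < eta -> ball 0 e1 (polar 1 0 u).
  move=> ur; have [se _] := etaP _ ur; have [u0 _] := andP ur.
  rewrite -ball_normE /= sub0r normrN polarE; apply: le_lt_trans (norm_Zee _ _) _.
  by rewrite ger0_norm// sinh_ge0.
have uW (u : 'rV[R]_2) : 0 <= u 0 0 < eta -> W (polar 1 0 u) by move=> /uP/e1W[].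
have uc (u : 'rV[R]_2) : 0 <= u 0 0 < eta -> {for u, continuous v}.
  move=> ur; apply: (@continuous_comp _ _ _ (polar 1 0) Psi); first exact: continuous_polar.
  by apply: (smooth_continuous CPsi); exact: uW.
exists eta, a, v, N; split=> //.
- by split=> // x /NB1 /B1B.
- split=> [u ur|D D0].
    by have [Nv Ev] := WN _ (uW u ur); split; [exact: uc|exact: Ev|exact: Nv].
  have D1 : nbhs (Psi 0) D by rewrite Psi0.
  have [e2 /= e20 e2D] := (nbhs_ballP _ _).1 (smooth_continuous CPsi W0 D1).
  have : nbhs (sinh (0 : R)) [set t | t < e2].
    by apply: open_nbhs_nbhs; split; [exact: open_lt|rewrite /= sinh0].
  move=> /(@continuous_sinh 0) /nbhs_ballP[eps /= eps0 epsP].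
  exists eps => // u /andP[u0 ue]; apply: e2D; rewrite -ball_normE /= sub0r normrN polarE.
  apply: le_lt_trans (norm_Zee _ _) _; rewrite ger0_norm ?sinh_ge0//.
  by apply: epsP; rewrite -ball_normE /= sub0r normrN ger0_norm.
- by move=> x u Nx ur E; rewrite /v -E; have [_ ->] := NW x Nx.
move=> r /andP[r0 re]; have rr (b : R) : 0 <= (row2 r b) 0 0 < eta by rewrite row2E0 (ltW r0).
set s := sinh r; have s0 : 0 < s by exact: sinh_gt0.
have [se sh] : s < e1 /\ s < h1 by apply: etaP; rewrite (ltW r0).
have pE2 (b : R) : polar 1 0 (row2 r b) = s *: ee b.
  by rewrite polarE row2E0 row2E1 mul1r addr0.
have PhiV (b : R) : N (v (row2 r b)) /\ Phi (v (row2 r b)) = s *: ee b.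
  by have [Nv Ev] := WN _ (uW _ (rr b)); split=> //; rewrite /v Ev pE2.
have vn (b : R) : `|v (row2 r b)| < n / 2 by have [_] := e1W _ (uP _ (rr b)).
have vuniq (x : 'rV[R]_2) (b : R) : N x -> Phi x = s *: ee b -> v (row2 r b) = x.
  by move=> Nx E; rewrite /v pE2 -E; have [_ ->] := NW x Nx.
pose g (b : R) := sector th (v (row2 r b)).
have gc : continuous g.
  move=> b; apply: (@continuous_comp _ _ _ (fun b => v (row2 r b)) (sector th)); last exact: continuous_sector.
  apply: (@continuous_comp _ _ _ (fun b => row2 r b) v); last exact: uc.
  apply: continuous_row => j; have [->|->] := ord2P j.
    by rewrite (_ : (fun y => _) = cst r); [exact: cst_continuous|rewrite funeqE => y; rewrite row2E0].
  by rewrite (_ : (fun y => _) = id); [exact: id|rewrite funeqE => y; rewrite row2E1].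
have [gp gn] : 0 < g (th / 2) /\ g (th / 2 + pi) < 0.
  by rewrite /g /v !pE2; apply: h1P; rewrite s0.
have zero (b : R) : g b = 0 -> exists2 rho : R,
   [/\ 0 < rho, rho < d1, N (rho *: ee 0), N (rho *: ee th) & sqnorm (Phi (rho *: ee 0)) = s ^+ 2] &
   v (row2 r b) = rho *: ee 0 \/ v (row2 r b) = rho *: ee th.
  move=> gb; have [Nv Ev] := PhiV b; set x := v (row2 r b) in Nv Ev *.
  have xn0 : x != 0.
    apply/eqP => x0; move: Ev; rewrite x0 Phi0 => /(congr1 (@enorm R)).
    rewrite enorm_Zee ?(ltW s0)// => E.
    have := @enorm0 R.
    by rewrite E => /eqP; rewrite gt_eqF.
  have rho0 := enorm_gt0 xn0; set rho := enorm x in rho0 *.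
  have rn : rho < n.
    by apply: le_lt_trans (enorm_le_norm x) _; have := vn b; rewrite -/x; lra.
  have NZ (t : R) : N (rho *: ee t).
    apply: nN; rewrite -ball_normE /= sub0r normrN.
    by apply: le_lt_trans (norm_Zee _ _) _; rewrite gtr0_norm.
  have rd1 : rho < d1.
    have := NB1 _ (NZ 0); rewrite /B1 -ball_normE /= sub0r normrN; apply: le_lt_trans.
    have := norm_entry_le (rho *: ee 0) 0; rewrite !mxE /= cos0 mulr1; apply: le_trans.
    by rewrite ler_norm.
  have [t _ [xE /(_ rho0) [_ st]]] := sector_polar th2 x.
  have rdl : 0 <= rho < dl by rewrite ltW //=; move: rd1; rewrite lt_min => /andP[].
  have sE : sqnorm (s *: ee b) = s ^+ 2 by rewrite sqnormZ sqnorm_ee mulr1.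
  exists rho; last by move: xE; case: (st.1 gb) => ->; [left|right].
  split=> //; move: xE; rewrite -/rho; case: (st.1 gb) => -> xE.
    by rewrite -xE Ev.
  by rewrite -(sqnorm_rot2 th) -Phi_rot// -xE Ev.
(* [g] takes opposite signs at [th / 2] and half a turn before. *)
have [b0 gb0] : exists b, g b = 0.
  have gn' : g (th / 2 - pi) < 0.
    move: gn; rewrite /g /v !pE2 -(ee_period (th / 2 - pi)).
    by rewrite (_ : th / 2 - pi + 2 * pi = th / 2 + pi)//; ring.
  have [|||c _ gc0] := @IVT _ g (th / 2 - pi) (th / 2) 0.
  - by rewrite gerBl pi_ge0.
  - exact: continuous_subspaceT.
  - by rewrite ge_min (ltW gn') /= le_max (ltW gp) orbT.
  - by exists c.
have [rho [rho0 rd1 N0rho Nthrho rE] _] := zero b0 gb0.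
have [rd rdl] : rho < d /\ rho < dl by move: rd1; rewrite lt_min => /andP[].
have [P0 gam] := ang rho (introT andP (conj rho0 rd)).
set gm := atan _ in gam.
have PE : Phi (rho *: ee 0) = s *: ee gm.
  by rewrite {1}(polar_atan P0) /enorm rE sqrtr_sqr gtr0_norm.
have PE2 : Phi (rho *: ee th) = s *: ee (gm + th).
  by rewrite Phi_rot ?(ltW rho0)// PE rot2_ee.
have zchar (b : R) : g b = 0 -> ee b = ee gm \/ ee b = ee (gm + th).
  move=> gb; have [rho' [rho'0 rd1' _ _ rE'] H] := zero b gb.
  have rd' : rho' < d by move: rd1'; rewrite lt_min => /andP[].
  have rr' : rho' = rho.
    apply/eqP; rewrite eq_le !leNgt; apply/andP; split; apply/negP => h.
      by have := mono _ _ (ltW rho0) h rd'; rewrite rE rE' ltxx.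
    by have := mono _ _ (ltW rho'0) h rd; rewrite rE rE' ltxx.
  have sinj (x y : 'rV[R]_2) : s *: x = s *: y -> x = y by apply: scalerI; rewrite gt_eqF.
  have [_ Ev] := PhiV b.
  by case: H => H; [left|right]; apply: sinj; rewrite -Ev H rr'.
have [pos neg] := arc_signs th2 a1 a2 gam gc zchar gp gn.
exists gm, rho; split=> //.
by split; [exact: gam|rewrite rho0|exact: vuniq|exact: vuniq].
Qed.

End Normalized.

End SectorChart.

(** * Reduction to a normalized differential *)

Section GeneralSectorChart.
Variable R : realType.

Lemma norm_rot2_le th (x : 'rV[R]_2) : `|rot2 th x| <= 2 * `|x|.
Proof.
have cs (y : R) : `|cos th * y| <= `|y| /\ `|sin th * y| <= `|y|.
  by split; rewrite normrM ler_piMl// ler_norml ?cos_geN1 ?cos_le1 ?sin_geN1 ?sin_le1.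
have x0 := norm_entry_le x 0; have x1 := norm_entry_le x 1.
apply: norm_row_le => [|j]; first by rewrite mulr_ge0.
have [->|->] := ord2P j.
  rewrite row2E0; apply: le_trans (ler_normB _ _) _.
  by have [h _] := cs (x 0 0); have [_ h'] := cs (x 0 1); lra.
rewrite row2E1; apply: le_trans (ler_normD _ _) _.
by have [_ h] := cs (x 0 0); have [h' _] := cs (x 0 1); lra.
Qed.

(** The relation between the two sides passes to the limit after division by the radius. The error
    is counted once on the second side and, as [rot2] at most doubles the sup norm, twice on the
    first; hence [e / 3]. *)
Lemma diff_ray_rot (Phi : 'rV[R]_2 -> 'rV[R]_2) th (dl : R) :
  differentiable Phi 0 -> Phi 0 = 0 -> 0 < dl ->
  (forall rho : R, 0 <= rho < dl -> Phi (rho *: ee th) = rot2 th (Phi (rho *: ee 0))) ->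
  'd Phi 0 (ee th) = rot2 th ('d Phi 0 (ee 0)).
Proof.
move=> dPhi Phi0 dl0 rot.
apply/eqP; rewrite -subr_eq0 -normr_eq0; apply/eqP.
apply/eqP; rewrite eq_le normr_ge0 andbT; apply/ler_addgt0Pr => e e0; rewrite add0r.
have e30 : 0 < e / 3 by rewrite divr_gt0.
have [d /= d0 dP] := (nbhs_ballP _ _).1 (diff_near_le dPhi e30).
pose h := Num.min d dl / 2.
have m0 : 0 < Num.min d dl by rewrite lt_min d0.
have h0 : 0 < h by rewrite divr_gt0.
have [hd hdl] : h < d /\ h < dl.
  have : h < Num.min d dl by rewrite /h; lra.
  by rewrite lt_min => /andP[].
have est (b : R) : `|Phi (h *: ee b) - h *: 'd Phi 0 (ee b)| <= e / 3 * h.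
  have hb : `|h *: ee b| <= h by apply: le_trans (norm_Zee _ _) _; rewrite gtr0_norm.
  have := dP (h *: ee b); rewrite -ball_normE /= sub0r normrN => /(_ (le_lt_trans hb hd)).
  rewrite addr0 Phi0 subr0 linearZ /= => H; apply: le_trans H _.
  by rewrite ler_wpM2l// ltW.
have E1 := est th; have E2 := est 0.
rewrite rot ?(ltW h0)// in E1.
move: ('d Phi 0 (ee th)) ('d Phi 0 (ee 0)) E1 E2 => X Y E1 E2.
rewrite -(ler_pM2l h0) -{1}(gtr0_norm h0) -normrZ.
have -> : h *: (X - rot2 th Y) = rot2 th (Phi (h *: ee 0) - h *: Y) - (rot2 th (Phi (h *: ee 0)) - h *: X).
  by apply: row2P; rewrite !mxE /=; ring.
apply: le_trans (ler_normB _ _) _.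
apply: (@le_trans _ _ (2 * (e / 3 * h) + e / 3 * h)); last by rewrite le_eqVlt; apply/orP; left; apply/eqP; field.
by apply: lerD => //; apply: le_trans (norm_rot2_le _ _) _; rewrite ler_pM2l.
Qed.

Lemma sin_neq0_pi (th : R) : 0 < th < 2 * pi -> sin th = 0 -> th = pi.
Proof.
move=> /andP[t0 t1] s0; case: (ltgtP th pi) => // h.
  by have := @sin_gt0_pi R th; rewrite t0 h s0 ltxx => /(_ isT).
have := @sin_gt0_pi R (th - pi); rewrite sinB cospi sinpi s0 mul0r mulr0 subr0 ltxx.
by move=> H; exfalso; apply: (notF (H _)); apply/andP; split; lra.
Qed.

(** A rotation by [- t], followed by a reflection when the orientation is reversed, normalizes the
    differential. By [diff_ray_rot], [cos th *: P + sin th *: Q] is [P] turned by [th]; if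
    [sin th != 0], this forces [Q] to be [P] turned by a right angle. *)
Lemma sector_chart_exists (th dl : R) (Phi : 'rV[R]_2 -> 'rV[R]_2) (B : set 'rV[R]_2) :
  0 < th < 2 * pi -> open B -> B 0 -> smooth B Phi -> Phi 0 = 0 ->
  (forall b, 'd Phi 0 b = 0 -> b = 0) -> 0 < dl ->
  (forall rho : R, 0 <= rho < dl -> Phi (rho *: ee th) = rot2 th (Phi (rho *: ee 0))) ->
  exists (s c eta a : R) v N, [/\ s * s = 1,
    forall r b : R, rot2 th (polar s c (row2 r b)) = polar s c (row2 r (b + th)) &
    sector_chart th B Phi dl s c eta a v N].
Proof.
move=> th2 oB B0 CPhi Phi0 dinj dl0 rot.
have dPhi := smooth_differentiable CPhi B0.
have e0E : ee (0 : R) = delta_mx 0 0 by apply: row2P; rewrite !mxE /= ?cos0 ?sin0.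
have rA := diff_ray_rot dPhi Phi0 dl0 rot.
have D0 := (det2_injective ('d Phi 0)).1 dinj.
have [P PE] : exists P, P = 'd Phi 0 (delta_mx 0 0) by exists ('d Phi 0 (delta_mx 0 0)).
have [Q QE] : exists Q, Q = 'd Phi 0 (delta_mx 0 1) by exists ('d Phi 0 (delta_mx 0 1)).
rewrite -PE -QE in D0.
have rA' : cos th *: P + sin th *: Q = rot2 th P.
  move: rA; rewrite (linear2E ('d Phi 0) (ee th)) e0E row2E0 row2E1 -PE -QE.
  by [].
have Pn0 : P != 0 by apply/eqP => P0; move: D0; rewrite P0 /det2 !mxE !mul0r subrr eqxx.
have [t _] := polar_decomposition 0 P; rewrite add0r; have lam0 := enorm_gt0 Pn0.
set lam := enorm P in lam0 * => Pee.
(* The orientation can be reversed only if [th = pi]: the rotations of angle [th]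
   and [- th] are then the same. *)
pose s : R := if 0 < det2 P Q then 1 else -1.
have ss : s * s = 1 by rewrite /s; case: ifP => _; ring.
have sd : 0 < s * det2 P Q.
  rewrite /s; case: ifPn => h; first by rewrite mul1r.
  by rewrite mulN1r oppr_gt0 lt_neqAle D0 leNgt.
have [P0 P1] : P 0 0 = lam * cos t /\ P 0 1 = lam * sin t.
  by split; rewrite {1}Pee mxE ?row2E0 ?row2E1.
have cs1 := cos2Dsin2 t.
have conf : th = pi \/ [/\ s = 1, Q 0 0 = - P 0 1 & Q 0 1 = P 0 0].
  have [s0|s0] := eqVneq (sin th) 0; first by left; exact: sin_neq0_pi.
  right; have /rowP H := rA'; have H0 := H 0; have H1 := H 1.
  rewrite row2E0 !mxE in H0; rewrite row2E1 !mxE in H1.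
  have Q0 : Q 0 0 = - P 0 1 by apply: (mulfI s0); rewrite mulrN; lra.
  have Q1 : Q 0 1 = P 0 0 by apply: (mulfI s0); lra.
  split=> //; rewrite /s ifT// /det2 Q0 Q1.
  have -> : P 0 0 * P 0 0 - P 0 1 * - P 0 1 = lam ^+ 2.
    by rewrite P0 P1 -[RHS]mulr1 -cs1; ring.
  by rewrite exprn_gt0.
pose T (x : 'rV[R]_2) := row2 (x 0 0 * cos t + x 0 1 * sin t) (s * (x 0 1 * cos t - x 0 0 * sin t)).
pose T' (x : 'rV[R]_2) := row2 (cos t * x 0 0 - s * sin t * x 0 1) (sin t * x 0 0 + s * cos t * x 0 1).
have T'T x : T' (T x) = x.
  apply: row2P; rewrite /T /T' !row2E0 !row2E1.
    transitivity (x 0 0 * (cos t ^+ 2 + s * s * sin t ^+ 2) + x 0 1 * cos t * sin t * (1 - s * s)); first by ring.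
    by rewrite ss mul1r cs1; ring.
  transitivity (x 0 1 * (sin t ^+ 2 + s * s * cos t ^+ 2) + x 0 0 * cos t * sin t * (1 - s * s)); first by ring.
  by rewrite ss mul1r (addrC (sin t ^+ 2)) cs1 subrr; ring.
have ses (b : R) : cos (s * b) = cos b /\ s * sin (s * b) = sin b.
  rewrite /s; case: ifP => _; first by rewrite !mul1r.
  by rewrite !mulN1r cosN sinN opprK.
have TT' (u : 'rV[R]_2) : T (polar s t u) = polar 1 0 u.
  have [h1 h2] := ses (u 0 1).
  apply: row2P; rewrite /T /polar !row2E0 !row2E1 mul1r addr0 cosD sinD.
    transitivity (sinh (u 0 0) * cos (s * u 0 1) * (cos t ^+ 2 + sin t ^+ 2)); first by ring.
    by rewrite cs1 mulr1 h1.
  transitivity (sinh (u 0 0) * (s * sin (s * u 0 1)) * (cos t ^+ 2 + sin t ^+ 2)); first by ring.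
  by rewrite cs1 mulr1 h2.
have Tinj x y : T x = T y -> x = y by move=> E; rewrite -(T'T x) E T'T.
have rotpi (x : 'rV[R]_2) : rot2 pi x = - x.
  by apply: row2P; rewrite !mxE /= cospi sinpi; ring.
have Trot x : T (rot2 th x) = rot2 th (T x).
  case: conf => [->|[s1 _ _]].
    by rewrite !rotpi; apply: row2P; rewrite /T !mxE /=; ring.
  by apply: row2P; rewrite /T /rot2 !mxE /= ?s1; ring.
have prot (r b : R) : rot2 th (polar s t (row2 r b)) = polar s t (row2 r (b + th)).
  rewrite !polarE !row2E0 !row2E1 rot2_ee; congr (_ *: _).
  case: conf => [->|[-> _ _]]; last by congr ee; ring.
  rewrite /s; case: ifP => _; first by congr ee; ring.
  by rewrite -(ee_period (-1 * (b + pi) + t)); congr ee; ring.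
pose PhT x := T (Phi x).
have CPhT : smooth B PhT.
  have cP k j := (CkP k _ oB).1 (CPhi k) j.
  apply: smooth_row2 => // k.
    by apply: CksD; [exact: oB| |]; (apply: CksM; [exact: oB|exact: cP|exact: Cks_cst]).
  apply: CksZ => //; apply: CksB; [exact: oB| |]; (apply: CksM; [exact: oB|exact: cP|exact: Cks_cst]).
have PhT0 : PhT 0 = 0.
  by rewrite /PhT Phi0; apply: row2P; rewrite /T ?row2E0 ?row2E1 !mxE; ring.
have dT b p : 'd Phi 0 b = p -> 'd PhT 0 b = T p.
  move=> <-; have De j := is_derive_entry b j dPhi.
  have Dm j (k : R) : is_derive 0 b (fun z => Phi z 0 j * k) ('d Phi 0 b 0 j * k).
    by have := is_derive_mul (De j) (is_derive_cst k 0 b); rewrite mulr0 addr0.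
  exact: (diff_row2 (smooth_differentiable CPhT B0) (fun z => erefl)
    (is_derive_add (Dm 0 _) (Dm 1 _)) (is_derive_scale s (is_derive_sub (Dm 1 _) (Dm 0 _)))).
have TP : T P = row2 lam 0.
  apply: row2P; rewrite /T ?row2E0 ?row2E1 P0 P1.
    by rewrite -[RHS]mulr1 -cs1; ring.
  by ring.
have nuE : s * (Q 0 1 * cos t - Q 0 0 * sin t) = s * det2 P Q / lam.
  by rewrite /det2 P0 P1; field; rewrite gt_eqF.
have nu0 : 0 < s * (Q 0 1 * cos t - Q 0 0 * sin t) by rewrite nuE divr_gt0.
have [eta [a [v [N [h1 h2 h3 h4 h5]]]]] : exists (eta a : R) v N, sector_chart th B PhT dl 1 0 eta a v N.
  apply: (@normalized_sector_chart _ th PhT B lam _ _ dl th2 oB B0 CPhT PhT0 lam0 nu0 dl0).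
  - by rewrite (dT _ _ (esym PE)).
  - by rewrite (dT _ _ (esym QE)).
  - case: conf => [->|[s1 Q0 Q1]]; [by left|right].
    rewrite s1 Q0 Q1 P0 P1; split; first by ring.
    by rewrite mul1r -[RHS]mulr1 -cs1; ring.
  - by move=> rho rr; rewrite /PhT rot.
exists s, t, eta, a, v, N; split=> //; split=> //.
- split=> [u ur|]; last exact: h3.2.
  have [c1 c2 c3] := h3.1 u ur; split=> //.
  by apply: Tinj; rewrite TT'; exact: c2.
- by move=> x u Nx ur E; apply: h4 => //; rewrite /PhT E TT'.
Qed.

End GeneralSectorChart.

(** * The surface near a particle *)

Section LiftedGraph.
Variable R : realType.

Definition proj2 (z : 'rV[R]_4) : 'rV[R]_2 := row2 (z 0 0) (z 0 1).

Lemma continuous_proj2 : continuous proj2.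
Proof.
move=> z; apply: continuous_row => j.
have [->|->] := ord2P j.
  rewrite (_ : (fun y => _) = (fun y : 'rV[R]_4 => y 0 0)); first exact: coord_continuous.
  by rewrite funeqE => y; rewrite row2E0.
rewrite (_ : (fun y => _) = (fun y : 'rV[R]_4 => y 0 1)); first exact: coord_continuous.
by rewrite funeqE => y; rewrite row2E1.
Qed.

Lemma AdS_rotation t (x : 'rV[R]_4) : AdS3 x -> AdS3 (rotation t x).
Proof. by rewrite /AdS3 /= form22_rotation. Qed.

(** A rotation about the axis turns the projection by the same angle, and the first face projects to
    a half-line; turning [z] back by the polar angle of its projection puts it in that face. *)
Lemma wedge_sector th (z : 'rV[R]_4) : 0 < th < 2 * pi -> AdS3 z ->
  (wedge th z <-> 0 <= sector th (proj2 z)).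
Proof.
move=> th2 zA; split.
  move=> [b [f [b0 bt [fA f0 f1] zE]]].
  have [z0 z1 _ _] := rotation_entries b f.
  have -> : proj2 z = f 0 0 *: ee b.
    by apply: row2P; rewrite /proj2 /ee !mxE /= zE ?z0 ?z1 f1; ring.
  by apply: sector_ee_ge0; rewrite ?b0.
move=> s0; have [b br [pE H]] := sector_polar th2 (proj2 z).
have [b' [b0 bt pE']] : exists b', [/\ 0 <= b', b' <= th & proj2 z = enorm (proj2 z) *: ee b'].
  have [e0|e0] := eqVneq (enorm (proj2 z)) 0.
    by exists 0; split=> //; [case/andP: th2 => t0 _; exact: ltW|rewrite e0 scale0r; exact: enorm_eq0].
  have e1 : 0 < enorm (proj2 z) by rewrite lt_neqAle eq_sym e0 enorm_ge0.
  have [h _] := H e1; have /andP[b0 bt] := h.1 s0.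
  by exists b.
exists b', (rotation (- b') z); split=> //; last by rewrite rotationVK.
have [z0 z1 _ _] := rotation_entries (- b') z.
have /rowP P := pE'; have P0 := P 0; have P1 := P 1.
rewrite row2E0 !mxE /= in P0; rewrite row2E1 !mxE /= in P1.
have cs := cos2Dsin2 b'.
split; first exact: AdS_rotation.
  rewrite z0 cosN sinN P0 P1.
  have -> : cos b' * (enorm (proj2 z) * cos b') - - sin b' * (enorm (proj2 z) * sin b') =
    enorm (proj2 z) * (cos b' ^+ 2 + sin b' ^+ 2) by ring.
  by rewrite cs mulr1 enorm_ge0.
by rewrite z1 cosN sinN P0 P1; ring.
Qed.

Variables (M : spacetime R) (S : set M) (j : pindex M) (y : 'rV[R]_4).
Hypotheses (ly : lifted_surface S j y) (ay : axis y).
Let th : R := pangle j.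
Let th2 : 0 < th < 2 * pi := pangle_bounds j.

(** The use of orthogonality to the particle: a tangent vector killed by the projection lies in the
    plane of the last two coordinates, where it is orthogonal to both [y] and [time_field y], which
    span this plane. *)
Lemma proj2_diff_inj U tau : extends_at S j y U tau ->
  (forall a, form22 ('d tau 0 a) (time_field y) = 0) ->
  smooth U (proj2 \o tau) /\ forall a, 'd (proj2 \o tau) 0 a = 0 -> a = 0.
Proof.
move=> [[oU U0 tau0] tauA [Ctau imm] _ _] orth.
have ct k j' := (CkP k _ oU).1 (Ctau k) j'.
have Cp : smooth U (proj2 \o tau).
  by apply: smooth_row2; [exact: oU|move=> k; exact: (ct k 0)|move=> k; exact: (ct k 1)].
split=> // a pa.
have dt := smooth_differentiable Ctau U0.
have dp := smooth_differentiable Cp U0.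
have De j' := is_derive_entry a j' dt.
have E : 'd (proj2 \o tau) 0 a = row2 ('d tau 0 a 0 0) ('d tau 0 a 0 1).
  exact: (diff_row2 dp (fun z => erefl) (De 0) (De 1)).
have ff : \forall z \near (0 : 'rV[R]_2), form22 (tau z) (tau z) = -1.
  have := open_nbhs_nbhs (conj oU U0); apply: filterS => z Uz.
  by apply: tauA; exists z.
have F := is_derive_near_cst ff (is_derive_form22 De De).
apply: ((immersive_atP _ _).1 (imm 0 U0)).
have O := orth a.
have [yA y0 y1] := ay.
rewrite tau0 in F.
have {pa}E := etrans (esym E) pa.
move: ('d tau 0 a) E F O => w /rowP E F O.
have w0 := E 0; have w1 := E 1; rewrite row2E0 mxE in w0; rewrite row2E1 mxE in w1.
rewrite /AdS3 /= /form22 y0 y1 in yA.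
rewrite /form22 !mxE /= w0 w1 in O; rewrite /form22 w0 w1 y0 y1 in F.
have F' : y 0 2 * w 0 2 + y 0 3 * w 0 3 = 0 by move: F; lra.
have O' : y 0 3 * w 0 2 - y 0 2 * w 0 3 = 0 by move: O; lra.
have yA' : y 0 2 * y 0 2 + y 0 3 * y 0 3 = 1 by move: yA; lra.
apply: row4P; rewrite [RHS]mxE //.
  transitivity (y 0 2 * (y 0 2 * w 0 2 + y 0 3 * w 0 3) + y 0 3 * (y 0 3 * w 0 2 - y 0 2 * w 0 3)).
    transitivity ((y 0 2 * y 0 2 + y 0 3 * y 0 3) * w 0 2); first by rewrite yA' mul1r.
    by ring.
  by rewrite F' O' !mulr0 addr0.
transitivity (y 0 3 * (y 0 2 * w 0 2 + y 0 3 * w 0 3) - y 0 2 * (y 0 3 * w 0 2 - y 0 2 * w 0 3)).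
  transitivity ((y 0 2 * y 0 2 + y 0 3 * y 0 3) * w 0 3); first by rewrite yA' mul1r.
  by ring.
by rewrite F' O' !mulr0 subr0.
Qed.

Lemma pdom_wedge : exists2 W : set 'rV[R]_4, open W & pdom j = wedge th `&` W.
Proof. by have := @pdom_open _ M j => /(open_subspace_subP (@pdom_sub _ M j)). Qed.

(** The inverse function theorem makes the extended surface a graph over the plane near [y]. As
    [wedge_sector] reads the wedge on the projection, the lifted surface is the part of the graph
    over the sector. *)
Lemma lifted_graph U tau : extends_at S j y U tau ->
  (forall a, form22 ('d tau 0 a) (time_field y) = 0) ->
  exists (k : 'rV[R]_2 -> 'rV[R]_2) (B : set 'rV[R]_2) (Om : set 'rV[R]_4),
  [/\ [/\ open B, B 0, smooth B k & forall x, B x -> U (k x)],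
      k 0 = 0 /\ (forall a, 'd k 0 a = 0 -> a = 0),
      forall x, B x -> proj2 (tau (k x)) = x,
      forall x, B x -> 0 <= sector th x -> lifted_surface S j (tau (k x)) &
      [/\ open Om, Om y & forall z, Om z -> lifted_surface S j z ->
        exists x, [/\ B x, z = tau (k x) & 0 <= sector th x]]].
Proof.
move=> ext orth; have [Cp dp0] := proj2_diff_inj ext orth.
have [[oU U0 tau0] tauA [Ctau imm] [tinj tq] near_y] := ext.
have [N [W [k [[oN N0 NU oW] [Ck_ NW WN _ dk]]]]] := inverse_function oU U0 Cp dp0.
have p0 : (proj2 \o tau) 0 = 0.
  by have [_ y0 y1] := ay; rewrite /= tau0; apply: row2P; rewrite ?row2E0 ?row2E1 mxE.
have W0 : W 0 by have [] := NW 0 N0; rewrite p0.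
have k0 : k 0 = 0 by have [_] := NW 0 N0; rewrite p0.
have [Wd oWd WdE] := pdom_wedge.
have [D [oD Dy Dlift]] : exists D : set 'rV[R]_4, [/\ open D, D y &
    forall z, D z -> pdom j z -> ((tau @` U) z <-> lifted_surface S j z)].
  move: near_y; rewrite /prop_near1 nbhsE; case=> D [oD Dy] DP.
  by exists D; split.
have ctk : forall x, W x -> {for x, continuous (tau \o k)}.
  move=> x Wx; apply: continuous_comp; first exact: (smooth_continuous Ck_ Wx).
  by apply: (smooth_continuous Ctau); apply: NU; have [] := WN x Wx.
have Wdy : Wd y by have := ly.1; rewrite WdE => -[].
(* Over [B] the graph stays where the extension agrees with the lifted surface and where [pdom j] is
   the whole wedge. *)
pose B := W `&` (tau \o k) @^-1` (D `&` Wd).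
have oB : open B.
  rewrite openE => x [Wx Dx]; have H1 : \forall z \near x, W z by exact: open_nbhs_nbhs.
  have H2 : \forall z \near x, (D `&` Wd) ((tau \o k) z).
    by apply: (ctk x Wx); apply: open_nbhs_nbhs; split=> //; exact: openI.
  by rewrite /interior; apply: filterS2 H1 H2 => z; split.
have B0 : B 0 by split => //; rewrite /preimage /= k0 tau0.
have projk x : B x -> proj2 (tau (k x)) = x by move=> [Wx _]; have [_] := WN x Wx.
have Uk x : B x -> U (k x) by move=> [Wx _]; apply: NU; have [] := WN x Wx.
have [G oG GE] : exists2 G, open G & tau @` N = (tau @` U) `&` G.
  apply: (open_quotient_image tq NU).
    by move=> x z Ux Nz E; rewrite (tinj x z Ux (NU _ Nz) E).
  exists N => //; apply/seteqP; split=> [x Nx|x []//]; split=> //; exact: NU.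
have Gy : G y.
  have [_ //] : ((tau @` U) `&` G) y by rewrite -GE; exists 0.
have oBp : open (proj2 @^-1` B) by apply: open_comp => // z _; exact: continuous_proj2.
have py : proj2 y = 0 by rewrite -tau0.
have CkB : smooth B k by move=> i; apply: Ck_sub (Ck_ i) => x [].
have dk0 a : 'd k 0 a = 0 -> a = 0.
  move=> ka; have [_ dkv] := dk 0 W0.
  rewrite -[LHS](dkv a).
  exact: etrans (congr1 ('d (proj2 \o tau) (k 0)) ka) (linear0 _).
have liftk x : B x -> 0 <= sector th x -> lifted_surface S j (tau (k x)).
  move=> Bx sx; have [Wx [Dx Wdx]] := Bx.
  have Ax : AdS3 (tau (k x)) by apply: tauA; exists (k x) => //; exact: Uk.
  apply/(Dlift _ Dx); last by exists (k x) => //; exact: Uk.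
  by rewrite WdE; split=> //; apply/(wedge_sector th2 Ax); rewrite projk.
have invk z : (D `&` G `&` proj2 @^-1` B) z -> lifted_surface S j z ->
    exists x, [/\ B x, z = tau (k x) & 0 <= sector th x].
  move=> [[Dz Gz] Bz] lz.
  have tz : (tau @` U) z by apply/(Dlift z Dz) => //; exact: lz.1.
  have : (tau @` N) z by rewrite GE.
  move=> [u Nu uz]; have [Wu ku] := NW u Nu.
  have xE : proj2 z = (proj2 \o tau) u by rewrite /= uz.
  exists (proj2 z); split=> //; first by rewrite xE ku uz.
  have Az : AdS3 z by apply: tauA.
  by apply/(wedge_sector th2 Az); exact: (pdom_sub lz.1).
have oOm : open (D `&` G `&` proj2 @^-1` B) by apply: openI => //; exact: openI.
exists k, B, (D `&` G `&` proj2 @^-1` B); split.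
- by split; [exact: oB|exact: B0|exact: CkB|exact: Uk].
- by split; [exact: k0|exact: dk0].
- exact: projk.
- exact: liftk.
- split; [exact: oOm| |exact: invk].
  by split; [split|rewrite /preimage /= py].
Qed.

End LiftedGraph.

(** * The Gauss map of the lifted surface at a particle *)

Section ConeData.
Variables (R : realType) (M : spacetime R) (S : set M) (V : cindex M -> M -> 'rV[R]_4).

(* [cd_T] parametrizes by its projection to the plane a surface that extends the
   lifted one, the latter being the part over the sector; [cd_X] extends the field. *)
Record cone_data (e : R) (j : pindex M) (y : 'rV[R]_4) := ConeData {
  cd_T : 'rV[R]_2 -> 'rV[R]_4;
  cd_X : 'rV[R]_4 -> 'rV[R]_4;
  cd_B : set 'rV[R]_2;
  cd_Om : set 'rV[R]_4;
  cd_dl : R;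
  cd_s : R;
  cd_c : R;
  cd_eta : R;
  cd_a : R;
  cd_v : 'rV[R]_2 -> 'rV[R]_2;
  cd_N : set 'rV[R]_2;
  cd_gab : 'rV[R]_2 -> 'rV[R]_2 := fun x => gab e (cd_T x) (cd_X (cd_T x));
  cd_open : open cd_B /\ open cd_Om;
  cd_T0 : [/\ cd_T 0 = y, cd_B 0 & cd_Om y];
  cd_Tc : forall x, cd_B x -> {for x, continuous cd_T};
  cd_gabc : forall x, cd_B x -> {for x, continuous cd_gab};
  cd_proj : forall x, cd_B x -> proj2 (cd_T x) = x;
  cd_lift : forall x, cd_B x -> 0 <= sector (pangle j) x -> lifted_surface S j (cd_T x);
  cd_liftP : forall z, cd_Om z -> lifted_surface S j z ->
    exists x, [/\ cd_B x, z = cd_T x & 0 <= sector (pangle j) x];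
  cd_field : forall x i g, cd_B x -> 0 <= sector (pangle j) x ->
    cdom i (pchart j (cd_T x)) -> AdS_isom g ->
    (\forall w \near cd_T x, pdom j w -> chart i (pchart j w) = w *m g) ->
    cd_X (cd_T x) *m g = V i (pchart j (cd_T x));
  cd_ray : forall rho : R, 0 <= rho < cd_dl ->
    [/\ cd_B (rho *: ee 0), cd_B (rho *: ee (pangle j)), face (cd_T (rho *: ee 0)) &
        cd_T (rho *: ee (pangle j)) = rotation (pangle j) (cd_T (rho *: ee 0))];
  cd_s2 : cd_s * cd_s = 1;
  cd_polar : forall r b : R, rot2 (pangle j) (polar cd_s cd_c (row2 r b)) =
    polar cd_s cd_c (row2 r (b + pangle j));
  cd_chart : sector_chart (pangle j) cd_B cd_gab cd_dl cd_s cd_c cd_eta cd_a cd_v cd_N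
}.

(** A two-sided derivative is already determined by the values on one side. *)
Lemma is_derive_ray0 (p : 'rV[R]_2 -> R) w d (ep : R) : 0 < ep ->
  is_derive (0 : 'rV[R]_2) w p d -> (forall h, 0 < h < ep -> p (h *: w) = p 0) -> d = 0.
Proof.
move=> ep0 [dp <-] pw; set d' := 'D_w p 0.
have H : (fun h : R => h^-1 *: (p (h *: w + 0) - p 0)) @ 0^' --> d' by exact: dp.
apply/eqP; apply/negPn/negP => dn0.
have d0 : 0 < `|d'| by rewrite normr_gt0.
have [f /= f0 fP] : \forall h \near (0 : R)^', `|d' - h^-1 *: (p (h *: w + 0) - p 0)| < `|d'|.
  by move/cvgrPdist_lt : H; apply.
pose h := Num.min ep f / 2.
have m0 : 0 < Num.min ep f by rewrite lt_min ep0.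
have h0 : 0 < h by rewrite divr_gt0.
have : h < Num.min ep f by rewrite /h; lra.
rewrite lt_min => /andP[hep hf].
have := fP h; rewrite /ball_ /= sub0r normrN gtr0_norm// gt_eqF// => /(_ hf isT).
by rewrite addr0 pw ?h0// subrr scaler0 subr0 ltxx.
Qed.

Lemma pchart_rotation (j : pindex M) z : face z -> pdom j z ->
  pdom j (rotation (pangle j) z) /\ pchart j (rotation (pangle j) z) = pchart j z.
Proof.
move=> fz dz; have dr := (pdom_saturated j fz).1 dz; split=> //; apply/esym.
by apply/(pchart_glued dz dr); apply: Or32.
Qed.

Hypothesis trV : transverse S V.

Lemma lifted_rotation (j : pindex M) z : face z -> lifted_surface S j z ->
  lifted_surface S j (rotation (pangle j) z).
Proof.
move=> fz [dz Sz]; have [dr E] := pchart_rotation fz dz.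
by split=> //; rewrite E.
Qed.

Lemma lifted_chart (j : pindex M) z : lifted_surface S j z -> ~ axis z ->
  exists i g, [/\ cdom i (pchart j z), AdS_isom g,
    \forall w \near z, pdom j w -> chart i (pchart j w) = w *m g &
    face z -> \forall w \near rotation (pangle j) z, pdom j w ->
      chart i (pchart j w) = rotation (- pangle j) w *m g].
Proof.
move=> [dz Sz] az; have [i _ iz] := (pchart_regular dz).2 az.
by have [g gi [h1 h2]] := pchart_isom dz iz; exists i, g; split.
Qed.

Lemma axis_rotation t (y : 'rV[R]_4) : axis y -> rotation t y = y.
Proof.
move=> [_ y0 y1]; have [z0 z1 z2 z3] := rotation_entries t y.
by apply: row4P; rewrite ?z0 ?z1 ?z2 ?z3 ?y0 ?y1; ring.
Qed.

(** So the particle is sent to the fixed point of [rot2], whatever the sign of [c]. *)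
Lemma gab_axis e c (y : 'rV[R]_4) : axis y -> gab e y (c *: time_field y) = 0.
Proof.
move=> [_ y0 y1]; apply: row2P; rewrite /gab ?row2E0 ?row2E1 /ga /gb !mxE /= y0 y1; ring.
Qed.

Lemma cone_data_exists (e : R) (j : pindex M) (y : 'rV[R]_4) :
  (e = 1 \/ e = -1) -> closed_spacelike_orthogonal_surface S ->
  lifted_surface S j y -> axis y -> exists _ : cone_data e j y, True.
Proof.
move=> e1 [_ _ Spart] ly ay; have ee1 := sign_sqr e1.
set th := pangle j; have th2 : 0 < th < 2 * pi := pangle_bounds j.
have [U [tau [ext orth]]] := Spart j y ly ay.
have [k [B1 [Om1 [[oB1 B10 CkB1 kU] [k0 dk0] projk liftk [oOm Omy invk]]]]] :=
  lifted_graph ly ay ext orth.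
have [D [X [[oD Dy CX Xtan] Xcompat [[c0 Xy] Xyu] Xrank]]] := transverse_particle trV ly ay.
have [[oU U0 tau0] tauA [Ctau imm] _ _] := ext.
pose T x := tau (k x).
have CT1 : smooth B1 T.
  by move=> n; apply: (Ck_comp (f := k) (g := tau) oB1 oU kU) (Ctau n); exact: CkB1.
pose B := B1 `&` T @^-1` D.
have oB : open B by exact: open_smooth_preimage.
have T0 : T 0 = y by rewrite /T k0.
have B0 : B 0 by split=> //; rewrite /preimage /= T0.
have CT : smooth B T by move=> n; apply: Ck_sub (CT1 n) => x [].
have CF : smooth B (X \o T).
  by move=> n; apply: (Ck_comp oB oD) (CX n) => [x [] //|]; exact: CT.
have TA x : B x -> AdS3 (T x) by move=> [B1x _]; apply: tauA; exists (k x) => //; exact: kU.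
pose Ph x := gab e (T x) (X (T x)).
have CPh : smooth B Ph by exact: (smooth_gab e oB CT CF).
have dT := smooth_differentiable CT B0; have dF := smooth_differentiable CF B0.
have dPh := smooth_differentiable CPh B0.
have nB : \forall x \near (0 : 'rV[R]_2), B x by exact: open_nbhs_nbhs.
have TT : \forall x \near (0 : 'rV[R]_2), form22 (T x) (T x) = -1.
  by apply: filterS nB => x /TA.
have TF : \forall x \near (0 : 'rV[R]_2), form22 (T x) ((X \o T) x) = 0.
  by apply: filterS nB => x Bx; apply: Xtan; [have [] := Bx|exact: TA].
have lift x : B x -> 0 <= sector th x -> lifted_surface S j (T x) by move=> [B1x _]; exact: liftk.
have axisT x : B x -> axis (T x) -> x = 0.
  move=> [B1x _] [_ x0 x1]; rewrite -(projk x B1x); apply: row2_eq0; rewrite /proj2 ?row2E0 ?row2E1//.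
(* Off the axis a chart transfers the unit length from [V] to [X]; on the axis the only point is the
   centre, where the length is given by the condition at the particle. *)
have unit x : B x -> 0 <= sector th x -> form22 (X (T x)) (X (T x)) = -1.
  move=> Bx sx; have lx := lift x Bx sx.
  have [ax|ax] := pselect (axis (T x)); first by rewrite (axisT x Bx ax) T0.
  have [i [g [iz gi gE _]]] := lifted_chart lx ax.
  have [gf _ _] := gi.
  rewrite -gf (Xcompat i (T x) g Bx.2 lx iz gi gE).
  by have [_] := transverse_unit trV lx.2 iz.
(* [X] is only known to be a unit field over the sector, so the derivative of its
   norm is computed along two rays of the sector. *)
have FF a : form22 ((X \o T) 0) ('d (X \o T) 0 a) = 0.
  pose l (j' : 'I_2) := form22 ((X \o T) 0) ('d (X \o T) 0 (delta_mx 0 j')).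
  have lE b : form22 ((X \o T) 0) ('d (X \o T) 0 b) = b 0 0 * l 0 + b 0 1 * l 1.
    have fl (w u u' : 'rV[R]_4) (m n : R) : form22 w (m *: u + n *: u') = m * form22 w u + n * form22 w u'.
      by rewrite /form22 !mxE; ring.
    exact: etrans (congr1 (form22 ((X \o T) 0)) (linear2E ('d (X \o T) 0) b)) (fl _ _ _ _ _).
  have ray b : 0 <= b <= th -> form22 ((X \o T) 0) ('d (X \o T) 0 (ee b)) = 0.
    move=> /andP[b0 bt].
    have Fj j' := is_derive_entry (ee b) j' dF.
    have [ep /= ep0 epB] := (nbhs_ballP _ _).1 nB.
    have : form22 ('d (X \o T) 0 (ee b)) ((X \o T) 0) + form22 ((X \o T) 0) ('d (X \o T) 0 (ee b)) = 0.
      apply: (is_derive_ray0 ep0 (is_derive_form22 Fj Fj)) => h /andP[h0 hep].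
      have Bh : B (h *: ee b).
        apply: epB; rewrite -ball_normE /= sub0r normrN.
        by apply: le_lt_trans (norm_Zee _ _) _; rewrite gtr0_norm.
      have sh : 0 <= sector th (h *: ee b).
        by apply: sector_ee_ge0; rewrite ?(ltW h0) ?b0.
      by rewrite /= (unit _ Bh sh) T0 Xyu.
    by rewrite form22C => /eqP; rewrite -mulr2n mulrn_eq0 /= => /eqP.
  case/andP: th2 => t0 t1.
  have r0 := ray 0; have r1 := ray (th / 2).
  rewrite lE row2E0 row2E1 cos0 sin0 mul1r mul0r addr0 lexx (ltW t0) in r0.
  rewrite lE row2E0 row2E1 (r0 isT) mulr0 add0r in r1.
  have s0 : 0 < sin (th / 2) by apply: sin_gt0_pi; apply/andP; split; lra.
  have : sin (th / 2) * l 1 = 0 by apply: r1; apply/andP; split; lra.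
  move=> /eqP; rewrite mulf_eq0 gt_eqF//= => /eqP l1.
  by rewrite lE (r0 isT) l1 !mulr0 addr0.
(* The rank condition at the particle is stated for [tau]; it is carried to [T] by the differential
   of [k], which is injective at 0. *)
have dPh0 a : 'd Ph 0 a = 0 -> a = 0.
  move=> da; have [TT' E] := gauss_diff ee1 dT dF dPh TT TF a.
  have FF0 : form22 ((X \o T) 0) ((X \o T) 0) = -1 by rewrite /= T0.
  have [_ De0] := De_vec_metric ee1 (nbhs_singleton TT) (nbhs_singleton TF) FF0 TT' (FF a).
  have {De0} De0 : De e T (X \o T) 0 a = 0 by apply: De0; exact: etrans (esym E) da.
  have dtau := smooth_differentiable Ctau U0.
  have dk := smooth_differentiable CkB1 B10.
  have dXt : differentiable (X \o tau) 0.
    apply: differentiable_comp; first exact: dtau.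
    by rewrite tau0; exact: smooth_differentiable CX _ Dy.
  have dtau' : differentiable tau (k 0) by rewrite k0.
  have dXt' : differentiable (X \o tau) (k 0) by rewrite k0.
  have E1 : 'd T 0 a = 'd tau 0 ('d k 0 a).
    exact: (eq_ind _ (fun z : 'rV[R]_2 => 'd T 0 a = 'd tau z ('d k 0 a)) (diff_comp_inj dk dtau' a) _ k0).
  have E2 : 'd (X \o T) 0 a = 'd (X \o tau) 0 ('d k 0 a).
    exact: (eq_ind _ (fun z : 'rV[R]_2 => 'd (X \o T) 0 a = 'd (X \o tau) z ('d k 0 a)) (diff_comp_inj dk dXt' a) _ k0).
  have E3 : De e tau (X \o tau) 0 ('d k 0 a) = 0.
    have xE : tau 0 = T 0 by rewrite T0.
    have vE : (X \o tau) 0 = (X \o T) 0 by rewrite /= T0 tau0.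
    exact: etrans (De_vec_eq e xE vE (esym E1) (esym E2)) De0.
  apply: dk0; have [rl rr] := Xrank U tau ext.
  apply: rank2_inj E3; first exact: De_linear.
  case: e1 => ->.
    by rewrite (_ : De 1 _ _ _ = Dl tau (X \o tau) 0)// funeqE => b; rewrite Dl_De.
  by rewrite (_ : De (-1) _ _ _ = Dr tau (X \o tau) 0)// funeqE => b; rewrite Dr_De.
have Ph0 : Ph 0 = 0 by rewrite /Ph T0 Xy gab_axis.
have sec0 : forall rho : R, 0 <= rho -> 0 <= sector th (rho *: ee 0).
  by move=> rho r0; rewrite sector_ee0.
(* The first side, turned by [th], is again in the lifted surface because the gluing identifies the
   faces; being close to [y], it lies on the graph, over the second side. *)
have [dl dl0 ray] : exists2 dl : R, 0 < dl & forall rho : R, 0 <= rho < dl ->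
    [/\ B (rho *: ee 0), B (rho *: ee th), face (T (rho *: ee 0)) &
        T (rho *: ee th) = rotation th (T (rho *: ee 0))].
  have H1 : \forall x \near (0 : 'rV[R]_2), Om1 (rotation th (T x)).
    have crot : continuous (fun z : 'rV[R]_4 => rotation th z).
      rewrite (_ : (fun z => _) = mulmxr (rotmx th)); last by rewrite funeqE => z; rewrite rotationE.
      exact: (linear_continuous_row (mulmxr (rotmx th))).
    have H : Om1 (rotation th (T 0)) by rewrite T0 axis_rotation.
    have c1 : {for 0, continuous (fun x => rotation th (T x))}.
      by apply: (@continuous_comp _ _ _ T (fun z => rotation th z)); [exact: smooth_continuous CT _ B0|exact: crot].
    by apply: c1; exact: open_nbhs_nbhs.
  have [dl /= dl0 dlP] := (nbhs_ballP _ _).1 (filterI nB H1).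
  exists dl => // rho /andP[r0 rdl].
  have inb b : ball (0 : 'rV[R]_2) dl (rho *: ee b).
    rewrite -ball_normE /= sub0r normrN.
    by apply: le_lt_trans (norm_Zee _ _) _; rewrite ger0_norm.
  have [Bx Omr] := dlP _ (inb 0); have [By _] := dlP _ (inb th).
  set x := rho *: ee 0 in Bx Omr *; set z := T x in Omr *.
  have lz : lifted_surface S j z by apply: lift => //; exact: sec0.
  have /rowP pz := projk x Bx.1; have pz0 := pz 0; have pz1 := pz 1.
  rewrite row2E0 !mxE /= cos0 mulr1 in pz0; rewrite row2E1 !mxE /= sin0 mulr0 in pz1.
  have fz : face z by split; [exact: TA|rewrite [z 0 0]pz0|exact: pz1].
  have [x' [B1x' zE _]] := invk _ Omr (lifted_rotation fz lz).
  have [w0 w1 _ _] := rotation_entries th z.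
  have x'E : x' = rho *: ee th.
    rewrite -(projk x' B1x') -zE; apply: row2P; rewrite /proj2 ?row2E0 ?row2E1 ?w0 ?w1 [z 0 0]pz0 [z 0 1]pz1 !mxE /=; ring.
  by split=> //; rewrite zE x'E.
(* One chart reads a point of the first face through [g], and its glued point through the rotation
   by [- th] followed by [g]. As [V] has one value there, the two values of [X] differ by the
   rotation. The centre, not covered by a chart, is treated apart. *)
have rotPh (rho : R) : 0 <= rho < dl -> Ph (rho *: ee th) = rot2 th (Ph (rho *: ee 0)).
  move=> rr; have [Bx By fz TE] := ray rho rr.
  have [r0 _] := andP rr.
  have [rho0|rho0] := eqVneq rho 0.
    by rewrite rho0 !scale0r Ph0; apply: row2P; rewrite !mxE /=; ring.
  have rho1 : 0 < rho by rewrite lt_neqAle eq_sym rho0.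
  set z := T (rho *: ee 0) in fz TE.
  have lz : lifted_surface S j z by apply: lift => //; exact: sec0.
  have az : ~ axis z.
    move=> /axisT => /(_ Bx) /(congr1 (@enorm R)); rewrite enorm_Zee// => E.
    have := @enorm0 R.
    by rewrite -E => /eqP; rewrite (negbTE rho0).
  have [i [g [iz gi gE gE']]] := lifted_chart lz az.
  have [_ pE] := pchart_rotation fz lz.1.
  have lr := lifted_rotation fz lz.
  have ir : cdom i (pchart j (rotation th z)) by rewrite pE.
  have gi' := AdS_isomM (AdS_isom_rotmx (- th)) gi.
  have gE2 : \forall w \near rotation th z, pdom j w -> chart i (pchart j w) = w *m (rotmx (- th) *m g).
    by apply: filterS (gE' fz) => w H dw; rewrite mulmxA -rotationE H.
  have X1 := Xcompat i z g Bx.2 lz iz gi gE.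
  have Dr : D (rotation th z) by rewrite -TE; exact: By.2.
  have X2 := Xcompat i _ _ Dr lr ir gi' gE2.
  have ug := linear_isom_unit (AdS_isom_linear gi).
  have XE : X (rotation th z) = rotation th (X z).
    rewrite pE mulmxA -rotationE in X2.
    have {}X2 : rotation (- th) (X (rotation th z)) = X z.
      by rewrite -[LHS](mulmxK ug) X2 -X1 mulmxK.
    by rewrite -X2 rotationVK.
  by rewrite /Ph TE XE gab_rotation.
have [s [c [eta [a [v [N [ss prot sch]]]]]]] :=
  sector_chart_exists th2 oB B0 CPh Ph0 dPh0 dl0 rotPh.
pose Om := Om1 `&` @proj2 R @^-1` B.
have oOm' : open Om by apply: openI => //; apply: open_comp => // z _; exact: continuous_proj2.
have Omy' : Om y.
  split=> //; rewrite /preimage /=; have -> : proj2 y = 0; last exact: B0.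
  by have [_ y0 y1] := ay; apply: row2P; rewrite /proj2 ?row2E0 ?row2E1 mxE.
have liftP z : Om z -> lifted_surface S j z -> exists x, [/\ B x, z = T x & 0 <= sector th x].
  move=> [Oz Bz] lz; have [x [B1x zE sx]] := invk z Oz lz.
  by exists x; split=> //; rewrite -(projk x B1x) -[tau _]zE.
unshelve eexists.
  apply: (@ConeData e j y T X B Om dl s c eta a v N).
  - by split.
  - by split.
  - by move=> x Bx; exact: smooth_continuous CT _ Bx.
  - by move=> x Bx; exact: smooth_continuous CPh _ Bx.
  - by move=> x [B1x _]; exact: projk.
  - exact: lift.
  - exact: liftP.
  - by move=> x i g Bx sx ix gi gE; apply: Xcompat => //; [exact: Bx.2|exact: lift].
  - exact: ray.
  - exact: ss.
  - exact: prot.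
  - exact: sch.
exact: I.
Qed.

End ConeData.

(** Separates the adjacent sheets, whose study involves the sign of [sector], from the farther ones,
    excluded by the size of the angle. *)
Lemma int_near_cases (m k : int) :
  m <= k - 2 \/ m = k - 1 \/ m = k \/ m = k + 1 \/ k + 2 <= m.
Proof.
case: (ltgtP m k) => [|km|->]; [|right; right; right|by do 2 right; left].
  rewrite -lezD1 le_eqVlt => /orP[/eqP <-|]; first by right; left; rewrite addrK.
  by rewrite -lezD1 => h; left; lra.
by move: km; rewrite -lezD1 le_eqVlt => /orP[/eqP <-|]; [left|rewrite -lezD1 => h; right; lra].
Qed.

Lemma open_subspace_nearP (X : topologicalType) (A W : set X) : W `<=` A ->
  open (W : set (subspace A)) <-> forall x, W x -> \forall z \near x, A z -> W z.
Proof.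
move=> WA; rewrite (open_subspace_subP WA); split.
  move=> [V oV WE] x Wx; have Vx : V x by move: Wx; rewrite WE => -[].
  by apply: filterS (open_nbhs_nbhs (conj oV Vx)) => z Vz Az; rewrite WE.
move=> H; exists [set x | A x -> W x]°; first exact: open_interior.
apply/seteqP; split=> x; first by move=> Wx; split; [exact: WA|exact: H].
by move=> [Ax /nbhs_singleton]; exact.
Qed.

(** * The coordinates of the hyperbolic cone *)

Section ConeChart.
Variables (R : realType) (M : spacetime R) (S : set M) (V : cindex M -> M -> 'rV[R]_4).
Variables (e : R) (j : pindex M) (y : 'rV[R]_4) (D : cone_data S V e j y).
Hypotheses (ly : lifted_surface S j y) (ay : axis y).

Local Notation th := (pangle j).
Local Notation T := (cd_T D).
Local Notation eta := (cd_eta D).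
Local Notation a := (cd_a D).
Local Notation v := (cd_v D).
Local Notation pol := (polar (cd_s D) (cd_c D)).
Local Notation Ph := (cd_gab D).

Let th2 : 0 < th < 2 * pi := pangle_bounds j.

Lemma cone_bounds : [/\ 0 < eta, 0 < a, a < th / 2 & a < pi - th / 2].
Proof. by have [] := cd_chart D. Qed.

Lemma cone_small O : nbhs (0 : 'rV[R]_2) O -> exists2 eps : R, 0 < eps &
  forall u : 'rV[R]_2, 0 <= u 0 0 < eps -> O (v u).
Proof. by have [_ _ [_ H] _ _] := cd_chart D; exact: H. Qed.

Lemma cone_v (u : 'rV[R]_2) : 0 <= u 0 0 < eta ->
  [/\ {for u, continuous v}, Ph (v u) = pol u, cd_N D (v u) & cd_B D (v u)].
Proof.
move=> ur; have [_ [_ _ NB] [H _] _ _] := cd_chart D; have [h1 h2 h3] := H u ur.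
by split=> //; exact: NB.
Qed.

Lemma cone_uniq (x u : 'rV[R]_2) : cd_N D x -> 0 <= u 0 0 < eta -> Ph x = pol u -> x = v u.
Proof. by have [_ _ _ H _] := cd_chart D; exact: H. Qed.

Lemma cone_v0 (u : 'rV[R]_2) : u 0 0 = 0 -> v u = 0.
Proof.
move=> u0; apply/eqP/negPn/negP => vn; have vp : 0 < `|v u| by rewrite normr_gt0.
have [eps eps0 /(_ u)] := cone_small (nbhsx_ballx (0 : 'rV[R]_2) _ vp).
by rewrite u0 lexx eps0 => /(_ isT); rewrite -ball_normE /= sub0r normrN ltxx.
Qed.

Lemma cone_gab0 : Ph 0 = 0.
Proof.
have [eta0 _ _ _] := cone_bounds.
have [|_ + _ _] := @cone_v 0; first by rewrite mxE lexx.
by rewrite cone_v0 ?mxE// => ->; rewrite polarE mxE sinh0 scale0r.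
Qed.

Lemma enorm_polar s c (u : 'rV[R]_2) : 0 <= u 0 0 -> enorm (polar s c u) = sinh (u 0 0).
Proof.
move=> u0; rewrite polarE enorm_Zee//.
by move: u0; rewrite le_eqVlt => /orP[/eqP <-|/sinh_gt0 /ltW//]; rewrite sinh0.
Qed.

Lemma cone_inj (u w : 'rV[R]_2) : 0 <= u 0 0 < eta -> 0 <= w 0 0 < eta -> v u = v w ->
  u 0 0 = w 0 0 /\ (u 0 0 = 0 \/ ee (cd_s D * u 0 1 + cd_c D) = ee (cd_s D * w 0 1 + cd_c D)).
Proof.
move=> ur wr E; have [_ Eu _ _] := cone_v ur; have [_ Ew _ _] := cone_v wr.
have EP : pol u = pol w by rewrite -Eu -Ew E.
have uw : u 0 0 = w 0 0.
  apply: sinh_inj; have [u0 _] := andP ur; have [w0 _] := andP wr.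
  by rewrite -(enorm_polar (cd_s D) (cd_c D) u0) EP enorm_polar.
split=> //; have [u0|u0] := eqVneq (u 0 0) 0; [by left|right].
move: EP; rewrite !polarE -uw => /scalerI; apply.
by rewrite gt_eqF// sinh_gt0// lt_neqAle eq_sym u0; have [] := andP ur.
Qed.

Lemma cone_s : cd_s D = 1 \/ cd_s D = -1.
Proof.
have : (cd_s D - 1) * (cd_s D + 1) = 0 by have := cd_s2 D; lra.
by move/eqP; rewrite mulf_eq0 => /orP[] /eqP h; [left|right]; lra.
Qed.

Lemma ee_period_sign b : ee (cd_s D * (b + 2 * pi) + cd_c D) = ee (cd_s D * b + cd_c D).
Proof.
case: cone_s => ->; first by rewrite -[RHS]ee_period; congr ee; ring.
by rewrite -[LHS]ee_period; congr ee; ring.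
Qed.

Lemma cone_period (r b : R) : 0 <= r < eta -> v (row2 r (b + 2 * pi)) = v (row2 r b).
Proof.
move=> rr; have ur b' : 0 <= (row2 r b' : 'rV[R]_2) 0 0 < eta by rewrite row2E0.
have [_ E Nv _] := cone_v (ur (b + 2 * pi)).
by apply: cone_uniq => //; rewrite E !polarE !row2E0 !row2E1 ee_period_sign.
Qed.

Definition cone_arc (r g : R) : Prop := exists rho : R,
  [/\ [/\ - a < g < a, 0 < rho < cd_dl D, v (row2 r g) = rho *: ee 0 &
          v (row2 r (g + th)) = rho *: ee th],
      forall b : R, g < b < g + th -> 0 < sector th (v (row2 r b)) &
      forall b : R, g + th < b < g + 2 * pi -> sector th (v (row2 r b)) < 0].

(* The angle at which the circle of radius [r] enters the lifted surface. *)
Definition cone_start (r : R) : R := xget 0 (cone_arc r).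

Local Notation gam := cone_start.

Lemma cone_startP (r : R) : 0 < r < eta -> cone_arc r (gam r).
Proof.
move=> rr; apply: xgetPex; have [_ _ _ _ H] := cd_chart D.
exact: H rr.
Qed.

(* The multiple of [th] to subtract from the angle to reach the fundamental domain
   of angles from [cone_start r] to [cone_start r + th]. *)
Definition cone_sheet (u : 'rV[R]_2) : int := Num.floor ((u 0 1 - gam (u 0 0)) / th).

Local Notation kk := cone_sheet.

(** The sheet is a separate argument: for a fixed [m] the lift is continuous, whereas [cone_sheet]
    jumps. *)
Definition cone_lift (m : int) (u : 'rV[R]_2) : 'rV[R]_2 :=
  v (row2 (u 0 0) (u 0 1 - m%:~R * th)).

(** The jumps of [cone_sheet] are harmless after gluing: where the angle leaves the fundamental
    domain by one side, the lift re-enters it at the glued point of the other. *)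
Definition cone_map (u : 'rV[R]_2) : M := pchart j (T (cone_lift (kk u) u)).

Local Notation cc := cone_map.

Lemma cone_sheetP (u : 'rV[R]_2) :
  gam (u 0 0) <= u 0 1 - (kk u)%:~R * th < gam (u 0 0) + th.
Proof.
case/andP: th2 => t0 _; have := floor_itv ((u 0 1 - gam (u 0 0)) / th).
rewrite -/(kk u) ler_pdivlMr// ltr_pdivrMr// intrD mulrDl mul1r; lra.
Qed.

Lemma cone_sheet_uniq (u : 'rV[R]_2) (m : int) :
  gam (u 0 0) <= u 0 1 - m%:~R * th < gam (u 0 0) + th -> kk u = m.
Proof.
case/andP: th2 => t0 _ H; apply: floor_def.
by rewrite ler_pdivlMr// ltr_pdivrMr// intrD mulrDl mul1r; move: H; lra.
Qed.

Lemma cone_map0 (u : 'rV[R]_2) : u 0 0 = 0 -> cone_map u = pchart j y.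
Proof.
move=> u0; rewrite /cone_map /cone_lift cone_v0 ?row2E0//.
by have [-> _ _] := cd_T0 D.
Qed.

Lemma sector_arc (r b : R) : 0 < r < eta -> gam r <= b <= gam r + th ->
  0 <= sector th (v (row2 r b)).
Proof.
move=> rr /andP[b0 b1]; have [rho [[_ /andP[r0 _] v0 v1] H _]] := cone_startP rr.
move: b0 b1; rewrite le_eqVlt => /orP[/eqP <- _|b0]; first by rewrite v0 sector_ee0 ?lexx// ltW.
rewrite le_eqVlt => /orP[/eqP ->|b1]; first by rewrite v1 sector_eeth ?lexx// ltW.
by apply/ltW/H/andP.
Qed.

Lemma cone_lift_range m (u : 'rV[R]_2) : 0 <= u 0 0 < eta ->
  0 <= (row2 (u 0 0) (u 0 1 - m%:~R * th) : 'rV[R]_2) 0 0 < eta.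
Proof. by rewrite row2E0. Qed.

Lemma cone_lift_sector (u : 'rV[R]_2) : 0 <= u 0 0 < eta ->
  0 <= sector th (cone_lift (kk u) u).
Proof.
case/andP; rewrite le_eqVlt => /orP[/eqP u0 _|u0 u1].
  by rewrite /cone_lift cone_v0 ?row2E0// sector0.
apply: sector_arc; first by rewrite u0.
by have /andP[-> /ltW ->] := cone_sheetP u.
Qed.

Lemma cone_lift_lifted (u : 'rV[R]_2) : 0 <= u 0 0 < eta ->
  lifted_surface S j (T (cone_lift (kk u) u)).
Proof.
move=> ur; apply: cd_lift; last exact: cone_lift_sector.
by have [] := cone_v (cone_lift_range (kk u) ur).
Qed.

Lemma cone_map_S (u : 'rV[R]_2) : 0 <= u 0 0 < eta -> S (cone_map u).
Proof. by move=> /cone_lift_lifted []. Qed.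

Lemma cone_T_inj (x x' : 'rV[R]_2) : cd_B D x -> cd_B D x' -> T x = T x' -> x = x'.
Proof. by move=> Bx Bx' E; rewrite -(cd_proj Bx) -(cd_proj Bx') E. Qed.

(* On the half-open fundamental domain no two distinct points are glued. *)
Lemma cone_not_glued (u w : 'rV[R]_2) : 0 <= u 0 0 < eta -> 0 <= w 0 0 < eta ->
  face (T (cone_lift (kk u) u)) ->
  T (cone_lift (kk w) w) = rotation th (T (cone_lift (kk u) u)) ->
  cone_lift (kk w) w = cone_lift (kk u) u.
Proof.
move=> ur wr fu E.
have [_ _ _ Bu] := cone_v (cone_lift_range (kk u) ur).
have [_ _ _ Bw] := cone_v (cone_lift_range (kk w) wr).
have Pu : proj2 (T (cone_lift (kk u) u)) = cone_lift (kk u) u := cd_proj Bu.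
have Pw : proj2 (T (cone_lift (kk w) w)) = cone_lift (kk w) w := cd_proj Bw.
have [z0 z1 _ _] := rotation_entries th (T (cone_lift (kk u) u)).
have [_ f0 f1] := fu.
set rho := T (cone_lift (kk u) u) 0 0 in z0 z1 f0.
have xu : cone_lift (kk u) u = rho *: ee 0.
  by rewrite -Pu; apply: row2P; rewrite /proj2 ?row2E0 ?row2E1 !mxE /= ?cos0 ?sin0 ?f1 -/rho; ring.
have xw : cone_lift (kk w) w = rho *: ee th.
  by rewrite -Pw E; apply: row2P; rewrite /proj2 ?row2E0 ?row2E1 !mxE /= -?/rho ?f1; ring.
have [w0|w0] := eqVneq (w 0 0) 0.
  have : enorm (cone_lift (kk w) w) = 0.
    by rewrite /cone_lift cone_v0 ?row2E0// enorm0.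
  by rewrite xw enorm_Zee// => rho0; rewrite xu rho0 !scale0r.
have [w1 w2] := andP wr; have w3 : 0 < w 0 0 by rewrite lt_neqAle eq_sym w0.
have wr' : 0 < w 0 0 < eta by rewrite w3.
have [rho' [[_ /andP[r0 _] v0 _] H _]] := cone_startP wr'.
have := cone_sheetP w; set b := w 0 1 - _ => /andP[]; rewrite le_eqVlt => /orP[/eqP b0 _|b0 b1].
  have xw' : cone_lift (kk w) w = rho' *: ee 0 by rewrite -v0 b0.
  have rr : rho = rho' by rewrite -(enorm_Zee th f0) -xw xw' enorm_Zee// ltW.
  move: xw; rewrite xw' rr => /scalerI E'.
  have {}E' : ee 0 = ee th by apply: E'; rewrite gt_eqF.
  have : 0 = th by apply: ee_inj E' _; case/andP: th2 => t0 t1; apply/andP; split; lra.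
  by case/andP: th2 => t0 _ t; move: t0; rewrite -t ltxx.
have : 0 < sector th (cone_lift (kk w) w) by apply: (H b); rewrite b0 b1.
by rewrite xw sector_eeth ?ltxx.
Qed.

(** Points with the same image have the same lift by [cone_not_glued]; their reduced angles then
    differ by less than [th], hence by less than a full turn, and [ee_inj] makes them equal. *)
Lemma cone_map_eq (u w : 'rV[R]_2) : 0 <= u 0 0 < eta -> 0 <= w 0 0 < eta ->
  cone_map u = cone_map w <->
  u 0 0 = w 0 0 /\ (u 0 0 = 0 \/ exists k : int, u 0 1 = w 0 1 + k%:~R * th).
Proof.
move=> ur wr; split; last first.
  move=> [uw [u0|[k ukw]]]; first by rewrite !cone_map0// -uw.
  have kE : kk u = kk w + k.
    apply: cone_sheet_uniq; rewrite uw ukw intrD mulrDl.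
    by have := cone_sheetP w; lra.
  rewrite /cone_map /cone_lift kE uw; congr (pchart j (T (v (row2 _ _)))).
  by rewrite ukw intrD; ring.
have lu := cone_lift_lifted ur; have lw := cone_lift_lifted wr.
move=> /(pchart_glued lu.1 lw.1) gl.
have E : cone_lift (kk u) u = cone_lift (kk w) w.
  have [_ _ _ Bu] := cone_v (cone_lift_range (kk u) ur).
  have [_ _ _ Bw] := cone_v (cone_lift_range (kk w) wr).
  case: gl => [E|[f E]|[f E]]; first exact: cone_T_inj.
    exact/esym/cone_not_glued.
  exact: cone_not_glued.
have [] := cone_inj (cone_lift_range (kk u) ur) (cone_lift_range (kk w) wr) E.
rewrite !row2E0 !row2E1 => uw EE; split=> //; case: EE => [|EE]; [by left|right].
exists (kk u - kk w).
have bu := cone_sheetP u; have bw := cone_sheetP w; rewrite uw in bu.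
suff : u 0 1 - (kk u)%:~R * th = w 0 1 - (kk w)%:~R * th by rewrite intrD intrN; lra.
case/andP: th2 => t0 t1.
have := ee_inj EE.
case: cone_s => ->.
  by move=> H; suff : 1 * (u 0 1 - (kk u)%:~R * th) + cd_c D = 1 * (w 0 1 - (kk w)%:~R * th) + cd_c D; [lra|apply: H; lra].
by move=> H; suff : -1 * (u 0 1 - (kk u)%:~R * th) + cd_c D = -1 * (w 0 1 - (kk w)%:~R * th) + cd_c D; [lra|apply: H; lra].
Qed.

Lemma cone_lift_cont m (u : 'rV[R]_2) : 0 <= u 0 0 < eta ->
  {for u, continuous (cone_lift m)}.
Proof.
move=> ur; have [Cv _ _ _] := cone_v (cone_lift_range m ur).
pose f (w : 'rV[R]_2) : 'rV[R]_2 := row2 (w 0 0) (w 0 1 - m%:~R * th).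
apply: (@continuous_comp _ _ _ f v) => //; apply: continuous_row => k.
have [->|->] := ord2P k.
  by rewrite (_ : (fun w => _) = (fun w : 'rV[R]_2 => w 0 0)); [exact: continuous_entry2|rewrite funeqE => w; rewrite row2E0].
rewrite (_ : (fun w => _) = (fun w : 'rV[R]_2 => w 0 1 - m%:~R * th)); last by rewrite funeqE => w; rewrite row2E1.
by apply: (@continuousB _ _ _ (fun w : 'rV[R]_2 => w 0 1 : R)); [exact: continuous_entry2|exact: cst_continuous].
Qed.

Lemma open_annulus : open [set u : 'rV[R]_2 | 0 < u 0 0 < eta].
Proof.
have H : open ((fun u : 'rV[R]_2 => u 0 0 : R) @^-1` `]0, eta[).
  by apply: open_comp; [move=> u _; exact: continuous_entry2|exact: interval_open].
by rewrite (_ : mkset _ = (fun u : 'rV[R]_2 => u 0 0 : R) @^-1` `]0, eta[)//; apply/seteqP; split=> u; rewrite /preimage /= in_itv.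
Qed.

Lemma sector_lift_neg m (u : 'rV[R]_2) : 0 < u 0 0 < eta ->
  sector th (cone_lift m u) < 0 -> \forall w \near u, sector th (cone_lift m w) < 0.
Proof.
move=> ur s0; have ur' : 0 <= u 0 0 < eta by have [/ltW -> ->] := andP ur.
have C : {for u, continuous (sector th \o cone_lift m)}.
  by apply: continuous_comp; [exact: cone_lift_cont|exact: continuous_sector].
exact: (C _ (lt_nbhsl s0)).
Qed.

Lemma near_entry1 (u : 'rV[R]_2) (ep : R) : 0 < ep ->
  \forall w \near u, u 0 1 - ep < (w : 'rV[R]_2) 0 1 < u 0 1 + ep.
Proof.
move=> ep0; have C := @continuous_entry2 R 1 u.
have H1 : \forall w \near u, u 0 1 - ep < (w : 'rV[R]_2) 0 1.
  by apply: (C _ (lt_nbhsr _)); rewrite ltrBlDr ltrDl.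
have H2 : \forall w \near u, (w : 'rV[R]_2) 0 1 < u 0 1 + ep.
  by apply: (C _ (lt_nbhsl _)); rewrite ltrDl.
by apply: filterS2 H1 H2 => w -> ->.
Qed.

(** Nothing is known of the variation of [gam] beyond the bounds [- a] and [a]. They exclude sheets
    two or more away; an adjacent sheet either has its angle out of these bounds or puts [u0] in the
    complementary arc, where [sector] is negative, and both persist nearby. The exception is the
    start of the arc, where the preceding sheet reaches the second side. *)
Lemma cone_sheet_near (u0 : 'rV[R]_2) : 0 < u0 0 0 < eta ->
  \forall u \near u0, kk u = kk u0 \/
    (kk u = kk u0 - 1 /\ u0 0 1 - (kk u0)%:~R * th = gam (u0 0 0)).
Proof.
move=> ur; have ur' : 0 <= u0 0 0 < eta by have [/ltW -> ->] := andP ur.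
have [eta0 a0 a1 a2] := cone_bounds; case/andP: (th2) => t0 t1.
have [rho [[/andP[g0 g1] _ _ _] _ neg]] := cone_startP ur.
have /andP[b0 b1] := cone_sheetP u0.
set be := u0 0 1 - _ in b0 b1; set k0 := kk u0 in be b0 b1 *.
have step (m : int) (u : 'rV[R]_2) : u 0 1 - (k0 + m)%:~R * th = u 0 1 - k0%:~R * th - m%:~R * th.
  by rewrite intrD mulrDl; ring.
have E0 : \forall u \near u0, 0 < (u : 'rV[R]_2) 0 0 < eta by apply: open_nbhs_nbhs; split=> //; exact: open_annulus.
have ep0 : 0 < th - 2 * a by lra.
have E2 := near_entry1 u0 ep0.
have E3 : \forall u \near u0, ~ (- a < (u : 'rV[R]_2) 0 1 - (k0 + 1)%:~R * th /\ 0 <= sector th (cone_lift (k0 + 1) u)).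
  have [h|h] := leP (- a) (be - th).
    have : sector th (cone_lift (k0 + 1) u0) < 0.
      rewrite /cone_lift step -/be -cone_period// mul1r; apply: neg; apply/andP; split; lra.
    by move/(sector_lift_neg ur); apply: filterS => u un [_]; rewrite leNgt un.
  have d0 : 0 < - a - (be - th) by lra.
  apply: filterS (near_entry1 u0 d0) => u /andP[_ h'] [h2 _].
  by move: h2; rewrite step mul1r; rewrite /be in h'; lra.
have E4 : be = gam (u0 0 0) \/ \forall u \near u0, ~ ((u : 'rV[R]_2) 0 1 - (k0 - 1)%:~R * th < a + th /\ 0 <= sector th (cone_lift (k0 - 1) u)).
  move: b0; rewrite le_eqVlt => /orP[/eqP ->|b0]; [by left|right].
  have [h|h] := leP (be + th) (a + th).
    have : sector th (cone_lift (k0 - 1) u0) < 0.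
      rewrite /cone_lift step -/be; apply: neg; apply/andP; split; lra.
    by move/(sector_lift_neg ur); apply: filterS => u un [_]; rewrite leNgt un.
  have d0 : 0 < be + th - (a + th) by lra.
  apply: filterS (near_entry1 u0 d0) => u /andP[h' _] [h2 _].
  by move: h2; rewrite step mulN1r; rewrite /be in h'; lra.
have main (u : 'rV[R]_2) : 0 < u 0 0 < eta -> u0 0 1 - (th - 2 * a) < u 0 1 < u0 0 1 + (th - 2 * a) ->
    ~ (- a < u 0 1 - (k0 + 1)%:~R * th /\ 0 <= sector th (cone_lift (k0 + 1) u)) ->
    (be = gam (u0 0 0) \/ ~ (u 0 1 - (k0 - 1)%:~R * th < a + th /\ 0 <= sector th (cone_lift (k0 - 1) u))) ->
    kk u = k0 \/ (kk u = k0 - 1 /\ be = gam (u0 0 0)).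
  move=> vr /andP[h1 h2] h3 h4.
  have vr' : 0 <= u 0 0 < eta by have [/ltW -> ->] := andP vr.
  have su := cone_lift_sector vr'.
  have [rho' [[/andP[g0' g1'] _ _ _] _ _]] := cone_startP vr.
  have /andP[c0 c1] := cone_sheetP u.
  set m := kk u in su c0 c1 *.
  rewrite /be in b0 b1; case: (int_near_cases m k0) => [mk|[mE|[->|[mE|mk]]]].
  - have : m%:~R * th <= (k0 - 2)%:~R * th by rewrite ler_pM2r// ler_int.
    by rewrite intrD mulrDl mulrNz; lra.
  - right; split=> //; case: h4 => // h4; exfalso; apply: h4.
    by rewrite -mE; split=> //; lra.
  - by left.
  - by exfalso; apply: h3; rewrite -mE; split=> //; lra.
  - have : (k0 + 2)%:~R * th <= m%:~R * th by rewrite ler_pM2r// ler_int.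
    by rewrite intrD mulrDl; lra.
case: E4 => E4.
  near=> u; apply: main; [near: u; exact: E0|near: u; exact: E2|near: u; exact: E3|by left].
near=> u; apply: main; [near: u; exact: E0|near: u; exact: E2|near: u; exact: E3|right; near: u; exact: E4].
Unshelve. all: by end_near. Qed.

Lemma cone_lift_axis m (u : 'rV[R]_2) : 0 < u 0 0 < eta -> ~ axis (T (cone_lift m u)).
Proof.
move=> ur; have ur' : 0 <= u 0 0 < eta by have [/ltW -> ->] := andP ur.
have [_ E _ B] := cone_v (cone_lift_range m ur').
have Pr : proj2 (T (cone_lift m u)) = cone_lift m u := cd_proj B.
move=> [_ z0 z1]; have x0 : cone_lift m u = 0.
  by rewrite -Pr; apply: row2P; rewrite /proj2 ?row2E0 ?row2E1 mxE.
have := enorm_polar (cd_s D) (cd_c D) (andP (cone_lift_range m ur')).1.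
have {}E : Ph (cone_lift m u) = pol (row2 (u 0 0) (u 0 1 - m%:~R * th)) := E.
rewrite -E x0 cone_gab0 row2E0 enorm0.
by move=> s0; have := sinh_gt0 (andP ur).1; rewrite -s0 ltxx.
Qed.

Lemma cone_lift_T_cont m (u : 'rV[R]_2) : 0 <= u 0 0 < eta ->
  {for u, continuous (T \o cone_lift m)}.
Proof.
move=> ur; have [_ _ _ B] := cone_v (cone_lift_range m ur).
by apply: continuous_comp; [exact: cone_lift_cont|exact: cd_Tc].
Qed.

(* Near a point of the first face, the lift jumps to the other face. *)
Lemma cone_transfer (u0 : 'rV[R]_2) (A B : set 'rV[R]_4) : 0 < u0 0 0 < eta ->
  let z := T (cone_lift (kk u0) u0) in
  (\forall w \near z, A w) -> (face z -> \forall w \near rotation th z, B w) ->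
  \forall u \near u0, (kk u = kk u0 /\ A (T (cone_lift (kk u) u))) \/
    (kk u = kk u0 - 1 /\ B (T (cone_lift (kk u) u))).
Proof.
move=> ur z nA nB; have ur' : 0 <= u0 0 0 < eta by have [/ltW -> ->] := andP ur.
have HA : \forall u \near u0, A (T (cone_lift (kk u0) u)) by exact: (cone_lift_T_cont ur' nA).
have HS := cone_sheet_near ur.
have [gE|gE] := pselect (u0 0 1 - (kk u0)%:~R * th = gam (u0 0 0)); last first.
  by apply: filterS2 HS HA => u [->|[_ //]] Au; left.
have [rho [[_ /andP[rho0 rho1] v0 v1] _ _]] := cone_startP ur.
have z0 : z = T (rho *: ee 0) by rewrite /z /cone_lift gE v0.
have rr : 0 <= rho < cd_dl D by rewrite ltW.
have [_ _ fz zth] := cd_ray rr.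
(* On the preceding sheet the start of the arc is read at the angle [gam + th], that is, at the
   point of the second side glued to [z]. *)
have HB : \forall u \near u0, B (T (cone_lift (kk u0 - 1) u)).
  apply: (cone_lift_T_cont (m := kk u0 - 1) ur').
  have -> : (T \o cone_lift (kk u0 - 1)) u0 = rotation th z.
    rewrite z0 -zth -v1 /= /cone_lift -gE; congr (T (v (row2 _ _))).
    by rewrite intrD; ring.
  by apply: nB; rewrite z0.
by apply: filterS3 HS HA HB => u [->|[-> _]] Au Bu; [left|right].
Qed.

Lemma cone_map_cont (u0 : 'rV[R]_2) (O : set M) : 0 < u0 0 0 < eta -> open O ->
  O (cc u0) -> \forall u \near u0, O (cc u).
Proof.
move=> ur oO Ou; have ur' : 0 <= u0 0 0 < eta by have [/ltW -> ->] := andP ur.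
have lz := cone_lift_lifted ur'.
have E0 : \forall u \near u0, 0 < (u : 'rV[R]_2) 0 0 < eta by apply: open_nbhs_nbhs; split=> //; exact: open_annulus.
have nA := open_quotient_within (pchart_quotient j) oO lz.1 Ou.
have nB : face (T (cone_lift (kk u0) u0)) ->
    \forall w \near rotation th (T (cone_lift (kk u0) u0)), pdom j w -> O (pchart j w).
  move=> fz; have [dr pE] := pchart_rotation fz lz.1.
  apply: (open_quotient_within (pchart_quotient j) oO dr).
  by rewrite pE.
apply: filterS2 E0 (cone_transfer ur nA nB) => u vr.
have vr' : 0 <= u 0 0 < eta by have [/ltW -> ->] := andP vr.
have lu := cone_lift_lifted vr'.
by case=> -[_]; apply; exact: lu.1.
Qed.

Lemma rot2K t (q : 'rV[R]_2) : rot2 (- t) (rot2 t q) = q.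
Proof.
have cs := cos2Dsin2 t.
apply: row2P; rewrite /rot2 ?row2E0 ?row2E1 cosN sinN.
  by transitivity ((cos t ^+ 2 + sin t ^+ 2) * q 0 0); [ring|rewrite cs mul1r].
by transitivity ((cos t ^+ 2 + sin t ^+ 2) * q 0 1); [ring|rewrite cs mul1r].
Qed.

(** The sheet is absorbed in the phase, which leaves a function smooth in [u] for a fixed [k]. *)
Definition cone_branch (k : int) (u : 'rV[R]_2) : 'rV[R]_2 :=
  polar (cd_s D) (cd_c D - cd_s D * (k%:~R * th)) u.

Lemma cone_branchE k (u : 'rV[R]_2) :
  pol (row2 (u 0 0) (u 0 1 - k%:~R * th)) = cone_branch k u.
Proof. by rewrite /cone_branch !polarE row2E0 row2E1; congr (_ *: ee _); ring. Qed.

Hypothesis e1 : e = 1 \/ e = -1.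

(** Across the glued edge the sheet drops by one, which turns the Gauss map by [th], while the chart
    reads the other face after a rotation by [- th]. The two cancel, so a single smooth branch
    serves on both sides: this is why the cone has the angle of the particle. *)
Lemma cone_near_gauss (u0 : 'rV[R]_2) : 0 < u0 0 0 < eta ->
  exists i h, [/\ linear_isom h, cdom i (cc u0) &
    \forall u \near u0, gab e (chart i (cc u) *m h) (V i (cc u) *m h) = cone_branch (kk u0) u].
Proof.
move=> ur; have ur' : 0 <= u0 0 0 < eta by have [/ltW -> ->] := andP ur.
have lz := cone_lift_lifted ur'; set z := T _ in lz.
have [i [g [iz gi gE gE']]] := lifted_chart lz (cone_lift_axis ur).
have gl := AdS_isom_linear gi; have ug := linear_isom_unit gl.
exists i, (invmx g); split=> //; first exact: linear_isomV.
have nA : \forall w \near z, (pdom j w -> cdom i (pchart j w)) /\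
    \forall w' \near w, pdom j w' -> chart i (pchart j w') = w' *m g.
  by apply: filterI; [exact: (open_quotient_within (pchart_quotient j) (@dom_open _ M i) lz.1 iz)|exact: nbhs_interior gE].
have nB : face z -> \forall w \near rotation th z, (pdom j w -> cdom i (pchart j w)) /\
    \forall w' \near w, pdom j w' -> chart i (pchart j w') = rotation (- th) w' *m g.
  move=> fz; have [dr pE] := pchart_rotation fz lz.1.
  apply: filterI; last exact: nbhs_interior (gE' fz).
  by apply: (open_quotient_within (pchart_quotient j) (@dom_open _ M i) dr); rewrite pE.
have E0 : \forall u \near u0, 0 < (u : 'rV[R]_2) 0 0 < eta by apply: open_nbhs_nbhs; split=> //; exact: open_annulus.
apply: filterS2 E0 (cone_transfer ur nA nB) => u vr H.
have vr' : 0 <= u 0 0 < eta by have [/ltW -> ->] := andP vr.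
have [dw Sw] := cone_lift_lifted vr'.
have [_ PE _ Bx] := cone_v (cone_lift_range (kk u) vr').
have sx := cone_lift_sector vr'.
rewrite /cone_map; set x := cone_lift (kk u) u in H dw Sw sx *.
have {}PE : gab e (T x) (cd_X D (T x)) = cone_branch (kk u) u by rewrite -cone_branchE -PE.
case: H => -[kE [iw nw]]; have {}iw := iw dw.
  have VE := cd_field Bx sx iw gi nw.
  rewrite -[V i _]VE (nbhs_singleton nw dw) !mulmxK//.
  by rewrite PE kE.
have gi' := AdS_isomM (AdS_isom_rotmx (- th)) gi.
have nw' : \forall w' \near T x, pdom j w' -> chart i (pchart j w') = w' *m (rotmx (- th) *m g).
  by apply: filterS nw => w H dw'; rewrite mulmxA -rotationE H.
have VE := cd_field Bx sx iw gi' nw'.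
rewrite -[V i _]VE (nbhs_singleton nw dw) mulmxA -rotationE !mulmxK//.
rewrite gab_rotation ?PE ?(sign_sqr e1)// kE -!cone_branchE.
have -> : u 0 1 - (kk u0 - 1)%:~R * th = u 0 1 - (kk u0)%:~R * th + th by rewrite intrD; ring.
by rewrite -cd_polar rot2K.
Qed.

Hypothesis trV : transverse S V.

(** Near [u0], [cone_map] coincides with the parametrization that [local_param] builds from polar
    coordinates: both have the same Gauss map, which is injective on [N], and continuity keeps the
    values of [cone_map] in the image of [N]. *)
Lemma cone_local (u0 : 'rV[R]_2) : closed_spacelike_orthogonal_surface S ->
  0 < u0 0 0 < eta -> exists P : set 'rV[R]_2,
  [/\ P u0, surface_param S P cc & forall i b, cdom i (cc u0) ->
     signed_metric V e i cc u0 b = b 0 0 ^+ 2 + sinh (u0 0 0) ^+ 2 * b 0 1 ^+ 2].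
Proof.
move=> [_ Sreg _] ur; have ur' : 0 <= u0 0 0 < eta by have [/ltW -> ->] := andP ur.
have [i [h [hi iu gE]]] := cone_near_gauss ur.
have Su := cone_map_S ur'.
have ru : @regular R M (cc u0) by exists i.
have [U [s [w [sP Uw sw _]]]] := Sreg _ Su ru.
pose Q := [set u : 'rV[R]_2 | 0 < u 0 0 < eta].
have Cq : smooth Q (cone_branch (kk u0)) by exact: smooth_polar open_annulus.
have dq0 b : 'd (cone_branch (kk u0)) u0 b = 0 -> b = 0.
  by apply: diff_polar_inj; [exact: cd_s2|have [] := andP ur].
have qE : cone_branch (kk u0) u0 = gauss_map V e h i s w.
  by rewrite -(nbhs_singleton gE) /gauss_map sw.
have iw : cdom i (s w) by rewrite sw.
have [N [P [sg [[oN Nw ND] [oP Pu PQ sgP] sgu uniq metr]]]] :=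
  local_param trV e1 hi sP Uw iw open_annulus ur Cq dq0 qE.
have [oU _ [sinj sq] _] := sP.
have NU : N `<=` U by move=> n /ND [].
have [G oG GN] : exists2 G, open G & s @` N = S `&` G.
  apply: (open_quotient_image sq NU) => [p n Up Nn E|]; last by exists N => //; rewrite setIC; apply/esym/setIidl.
  by rewrite (sinj _ _ Up (NU _ Nn) E).
have Gu : G (cc u0).
  have : (s @` N) (cc u0) by exists w.
  by rewrite GN => -[].
have nP : \forall u \near u0, P u by exact: open_nbhs_nbhs.
have near_s : \forall u \near u0, P u /\ (s \o sg) u = cc u.
  have nO := cone_map_cont ur oG Gu.
  apply: filterS3 nP nO gE => u Pu' Gu' gu; split=> //.
  have vr : 0 <= u 0 0 < eta by have /andP[/ltW -> ->] := PQ u Pu'.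
  have : (s @` N) (cc u) by rewrite GN; split=> //; exact: cone_map_S.
  move=> [n Nn nE]; rewrite /= -nE; congr s; apply/esym.
  by apply: uniq => //; rewrite /gauss_map nE.
have [W [oW Wu] WP] : exists2 W : set 'rV[R]_2, open W /\ W u0 & forall u, W u -> P u /\ (s \o sg) u = cc u.
  move: near_s; rewrite /prop_near1 nbhsE; case=> W [oW Wu] WP.
  by exists W.
have Cid : smooth W (id : 'rV[R]_2 -> 'rV[R]_2).
  move=> k; apply/CkP => // l; exact: Cks_entry.
have did b : 'd (id : 'rV[R]_2 -> 'rV[R]_2) u0 b = 0 -> b = 0.
  have E : ('d (id : 'rV[R]_2 -> 'rV[R]_2) u0 : 'rV[R]_2 -> 'rV[R]_2) = id by exact: diff_val.
  by move=> H; apply: etrans H; exact: (congr1 (fun f => f b) (esym E)).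
have [P' [oP' P'u P'W P'P]] := surface_param_comp sgP oW Wu Cid (fun u Wu => (WP u Wu).1) did.
have ccP : surface_param S P' cc.
  by apply: surface_param_eq P'P => u /P'W /WP [_ <-].
exists P'; split=> // i' b iu'.
have scc : s (sg u0) = cc u0 by have [_] := WP u0 Wu.
have isu : cdom i' ((s \o sg) u0) by rewrite /= scc.
have mE := metr i' u0 b Pu isu.
have Du : (P `&` (s \o sg) @^-1` cdom i') u0 by [].
have [_ _ _ sch] := sgP.
have df := smooth_differentiable (sch i').1 Du.
have dF := smooth_differentiable (transverse_smooth trV i' sgP) Du.
have Ef : \forall u \near u0, (chart i' \o (s \o sg)) u = (chart i' \o cc) u.
  by apply: filterS near_s => u [_ E]; rewrite /= -E.
have EF : \forall u \near u0, (V i' \o (s \o sg)) u = (V i' \o cc) u.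
  by apply: filterS near_s => u [_ E]; rewrite /= -E.
have DE := De_near_eq e b Ef EF df dF.
rewrite /signed_metric -DE; apply: etrans mE _.
exact: hyperboloid_metric_polar (cd_s2 D).
Qed.

Lemma proj2_rotation t (z : 'rV[R]_4) : proj2 (rotation t z) = rot2 t (proj2 z).
Proof.
by have [z0 z1 _ _] := rotation_entries t z; rewrite /proj2 z0 z1 /rot2 !row2E0 !row2E1.
Qed.

Lemma proj2_axis : proj2 y = 0.
Proof. by have [_ y0 y1] := ay; apply: row2P; rewrite /proj2 ?row2E0 ?row2E1 mxE. Qed.

(* The neighbourhoods invariant under the rotations form a basis at a point of
   the axis, and they are saturated for the gluing. *)
Lemma pchart_open_axis (D0 : set 'rV[R]_4) : nbhs y D0 ->
  exists G, [/\ open G, G (pchart j y) & forall p, G p ->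
    exists z, [/\ pdom j z, D0 z & pchart j z = p]].
Proof.
move=> nD; have [ep /= ep0 epD] := (nbhs_ballP _ _).1 nD.
have h0 : 0 < ep / 2 by rewrite divr_gt0.
pose Q (z : 'rV[R]_4) := [/\ sqnorm (proj2 z) < (ep / 2) ^+ 2,
  `|z 0 2 - y 0 2| < ep / 2 & `|z 0 3 - y 0 3| < ep / 2].
have Qrot t z : Q (rotation t z) <-> Q z.
  by have [_ _ z2 z3] := rotation_entries t z; rewrite /Q proj2_rotation sqnorm_rot2 z2 z3.
have Qgl z z' : glued th z z' -> Q z -> Q z'.
  by case=> [->//|[_ ->]|[_ ->]] Qz; apply/(Qrot th).
have QD z : Q z -> D0 z.
  move=> [q0 q2 q3]; apply: epD; rewrite -ball_normE /= distrC.
  have sq k : proj2 z 0 k ^+ 2 <= (ep / 2) ^+ 2.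
    apply: le_trans (ltW q0); rewrite /sqnorm.
    have [->|->] := ord2P k.
      by rewrite lerDl sqr_ge0.
    by rewrite lerDr sqr_ge0.
  have le k : `|proj2 z 0 k| <= ep / 2.
    by rewrite -(ler_pXn2r (_ : (0 < 2)%N)) ?nnegrE ?normr_ge0 ?(ltW h0)// real_normK ?num_real.
  have le0 := le 0; have le1 := le 1; rewrite /proj2 row2E0 in le0; rewrite /proj2 row2E1 in le1.
  have [_ y0 y1] := ay.
  apply: (@le_lt_trans _ _ (ep / 2)); last by lra.
  apply: norm_row_le; first exact: ltW.
  move=> [[|[|[|[|//]]]] i]; rewrite !mxE.
  - by rewrite (_ : Ordinal i = 0) ?y0 ?subr0//; apply: val_inj.
  - by rewrite (_ : Ordinal i = 1) ?y1 ?subr0//; apply: val_inj.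
  - by rewrite (_ : Ordinal i = 2) ?(ltW q2)//; apply: val_inj.
  - by rewrite (_ : Ordinal i = 3) ?(ltW q3)//; apply: val_inj.
have nQ z : Q z -> \forall w \near z, Q w.
  move=> [q0 q2 q3].
  have H0 : \forall w \near z, sqnorm (proj2 w) < (ep / 2) ^+ 2.
    have C : {for z, continuous (@sqnorm R \o @proj2 R)}.
      by apply: continuous_comp; [exact: continuous_proj2|exact: continuous_sqnorm].
    exact: (C _ (lt_nbhsl q0)).
  have Hk (k : 'I_4) : `|z 0 k - y 0 k| < ep / 2 -> \forall w \near z, `|(w : 'rV[R]_4) 0 k - y 0 k| < ep / 2.
    move=> qk; have C : {for z, continuous (fun w : 'rV[R]_4 => `|w 0 k - y 0 k|)}.
      apply: (@continuous_comp _ _ _ (fun w : 'rV[R]_4 => w 0 k - y 0 k) Num.norm); last exact: norm_continuous.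
      by apply: (@continuousB _ _ _ (fun w : 'rV[R]_4 => w 0 k : R)); [exact: coord_continuous|exact: cst_continuous].
    exact: (C _ (lt_nbhsl qk)).
  by apply: filterS3 H0 (Hk 2 q2) (Hk 3 q3) => w; split.
exists (pchart j @` (pdom j `&` Q)); split.
- have [_ H] := pchart_quotient j.
  have : open ((pchart j @` (pdom j `&` Q) : set M) : set (subspace setT)).
    apply/H; first by move=> _ [z [dz _] <-]; exists z.
    rewrite (_ : _ `&` _ = pdom j `&` Q); last first.
      apply/seteqP; split=> z [dz]; last by move=> Qz; split=> //; exists z.
      by move=> [w [dw Qw] /(pchart_glued dw dz) gl]; split=> //; exact: Qgl gl Qw.
    apply/(open_subspace_nearP (@subIsetl _ _ _)) => z [dz Qz].
    by apply: filterS (nQ z Qz) => w Qw dw; split.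
  by move=> /(open_subspace_open openT (@subsetT _ _)).
- exists y => //; split; first exact: ly.1.
  by split; rewrite ?proj2_axis ?subrr ?normr0// /sqnorm !mxE expr0n /= addr0 exprn_gt0.
- by move=> _ [z [dz Qz] <-]; exists z; split=> //; exact: QD.
Qed.

Lemma sinh_surj (t r : R) : 0 < r -> 0 <= t < sinh r -> exists2 x, 0 <= x < r & sinh x = t.
Proof.
move=> r0 /andP[t0 t1].
have C : {within `[0, r], continuous (@sinh R)}.
  by apply: continuous_subspaceT => x; exact: continuous_sinh.
have sr := sinh_gt0 r0.
have [|x] := @IVT R (@sinh R) 0 r t (ltW r0) C.
  by rewrite sinh0 min_l ?max_r ?(ltW sr)// t0 ltW.
rewrite in_itv /= => /andP[x0 x1] xt; exists x => //; rewrite x0 lt_neqAle x1 andbT.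
by apply/eqP => xr; move: t1; rewrite -xt xr ltxx.
Qed.

Lemma cone_map_sheet0 (r b : R) : gam r <= b < gam r + th ->
  cc (row2 r b) = pchart j (T (v (row2 r b))).
Proof.
move=> br; have k0 : kk (row2 r b) = 0.
  by apply: cone_sheet_uniq; rewrite row2E0 row2E1 mul0r subr0.
by rewrite /cone_map k0 /cone_lift row2E0 row2E1 mul0r subr0.
Qed.

(** The range of angles is independent of [r], as the compactness argument at radius 0 requires. The
    end [gam r + th] of the arc belongs to another sheet and is replaced by [gam r] through the
    gluing. *)
Lemma cone_surj (r : R) (x : 'rV[R]_2) : 0 < r < eta -> cd_N D x ->
  enorm (Ph x) = sinh r -> 0 <= sector th x -> pdom j (T x) ->
  exists2 b, - a <= b <= a + th & cc (row2 r b) = pchart j (T x).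
Proof.
move=> rr Nx nx sx dx; have rr' : 0 <= r < eta by have [/ltW -> ->] := andP rr.
have [eta0 a0 a1 a2] := cone_bounds; case/andP: (th2) => t0 t1.
have [rho [[/andP[g0 g1] /andP[rho0 rho1] v0 v1] _ neg]] := cone_startP rr.
(* Centring the window half a turn after [gam r] yields an angle between [gam r] and
   [gam r + 2 * pi]; outside the arc it would contradict the sign of [sector]. *)
have [t /andP[tl tr] PE] := polar_decomposition (cd_s D * (gam r + pi) + cd_c D) (Ph x).
have [b br xE] : exists2 b, gam r <= b <= gam r + 2 * pi & x = v (row2 r b).
  exists (gam r + pi + cd_s D * t).
    by case: (cone_s) => ->; apply/andP; split; lra.
  apply: cone_uniq => //; first by rewrite row2E0.
  rewrite PE nx polarE row2E0 row2E1; congr (_ *: ee _).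
  by have ss := cd_s2 D; transitivity (cd_s D * (gam r + pi) + cd_c D + cd_s D * cd_s D * t); [rewrite ss mul1r|ring].
have [b' /andP[b0 b1] {}xE] : exists2 b, gam r <= b <= gam r + th & x = v (row2 r b).
  case/andP: br => b0 b1; have [h|h] := leP b (gam r + th); first by exists b => //; rewrite b0.
  move: b1; rewrite le_eqVlt => /orP[/eqP b1|b1].
    exists (gam r); first by rewrite lexx lerDl ltW.
    by rewrite xE b1 cone_period.
  by move: sx; rewrite xE leNgt neg// h.
move: b1; rewrite le_eqVlt => /orP[/eqP b1|b1]; last first.
  exists b'; first by apply/andP; split; lra.
  by rewrite cone_map_sheet0 ?b0// -xE.
exists (gam r); first by apply/andP; split; lra.
rewrite cone_map_sheet0 ?lexx ?ltrDl// v0 xE b1 v1.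
have rr2 : 0 <= rho < cd_dl D by rewrite ltW.
have [_ _ fz TE] := cd_ray rr2.
rewrite xE b1 v1 TE in dx.
have [_ <-] := pchart_rotation fz ((pdom_saturated j fz).2 dx).
by rewrite TE.
Qed.

(** Points of [S] close to the particle lift to the graph over the sector by [pchart_open_axis];
    their radius is the inverse [sinh] of the norm of the Gauss map. *)
Lemma cone_open0 (eps : R) : 0 < eps -> exists G : set M, [/\ open G, G (pchart j y) &
  forall q, S q -> G q -> exists r b : R,
    [/\ 0 <= r < eps, r < eta, - a <= b <= a + th & cc (row2 r b) = q]].
Proof.
move=> eps0; have [eta0 a0 a1 a2] := cone_bounds; case/andP: (th2) => t0 t1.
pose d := Num.min eps eta; have d0 : 0 < d by rewrite lt_min eps0.
have [T0 B0 Omy] := cd_T0 D; have [oB oOm] := cd_open D.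
have [_ [oN N0 _] _ _ _] := cd_chart D.
have s0 : 0 < sinh d / 2 by rewrite divr_gt0// sinh_gt0.
have nx : \forall x \near (0 : 'rV[R]_2), cd_N D x /\ ball (Ph 0) (sinh d / 2) (Ph x).
  apply: filterI; first exact: open_nbhs_nbhs.
  exact: (cd_gabc B0 (nbhsx_ballx _ _ s0)).
have nz : \forall z \near y, cd_Om D z /\ (cd_N D (proj2 z) /\ ball (Ph 0) (sinh d / 2) (Ph (proj2 z))).
  apply: filterI; first exact: open_nbhs_nbhs.
  have C : @proj2 R @ y --> (0 : 'rV[R]_2) by rewrite -proj2_axis; exact: continuous_proj2.
  exact: (C _ nx).
have [G [oG Gy GP]] := pchart_open_axis nz.
exists G; split=> // q Sq Gq.
have [z [dz [Oz [Nz Bz]] zq]] := GP q Gq.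
have lz : lifted_surface S j z by split; rewrite ?zq.
have [x [Bx zE sx]] := cd_liftP Oz lz.
have zx : proj2 z = x by rewrite zE cd_proj.
rewrite zx in Nz Bz.
have nP : enorm (Ph x) < sinh d.
  apply: le_lt_trans (enorm_le_norm _) _.
  by move: Bz; rewrite cone_gab0 -ball_normE /= sub0r normrN; lra.
have [|r /andP[r0 rd] rE] := @sinh_surj (enorm (Ph x)) d d0; first by rewrite enorm_ge0.
have [re rt] : r < eps /\ r < eta by move: rd; rewrite lt_min => /andP[].
move: r0; rewrite le_eqVlt => /orP[/eqP r0|r0].
  exists 0, 0; rewrite lexx eps0 eta0; split=> //; first by apply/andP; split; lra.
  rewrite cone_map0 ?row2E0// -zq zE; apply: (congr1 (pchart j)); apply: etrans (esym T0) _; apply: (congr1 T).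
  have P0 : Ph x = pol 0 by rewrite polarE mxE sinh0 scale0r; apply: enorm_eq0; rewrite -rE -r0 sinh0.
  by rewrite (cone_uniq Nz _ P0) ?cone_v0 ?mxE ?lexx.
have [||b br bE] := @cone_surj r x _ Nz (esym rE) sx; [by rewrite r0|by rewrite -zE|].
by exists r, b; rewrite (ltW r0); split=> //; rewrite bE -zE.
Qed.

Lemma cone_cont0 (G : set M) : open G -> G (pchart j y) -> exists2 eps : R, 0 < eps &
  forall u : 'rV[R]_2, 0 <= u 0 0 < eps -> u 0 0 < eta -> G (cc u).
Proof.
move=> oG Gy; have [T0 B0 _] := cd_T0 D.
have nA := open_quotient_within (pchart_quotient j) oG ly.1 Gy.
have nT : \forall x \near (0 : 'rV[R]_2), pdom j (T x) -> G (pchart j (T x)).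
  exact: (cd_Tc B0 (eq_ind_r (fun z => nbhs z _) nA T0)).
have [eps eps0 H] := cone_small nT.
exists eps => // u /andP[u0 u1] u2.
have ur : 0 <= u 0 0 < eta by rewrite u0.
apply: (H (row2 (u 0 0) (u 0 1 - (kk u)%:~R * th))); first by rewrite row2E0 u0.
by have [] := cone_lift_lifted ur.
Qed.

Lemma near_entry0 (u : 'rV[R]_2) (c : R) : u 0 0 < c -> \forall w \near u, (w : 'rV[R]_2) 0 0 < c.
Proof. by move=> uc; exact: (@continuous_entry2 R 0 u _ (lt_nbhsl uc)). Qed.

(** Tube lemma: all the angles at radius 0 stand for one point of the cone, and compactness gives
    one width [eps] for all of them. *)
Lemma tube_row2 (W : set 'rV[R]_2) (l m : R) :
  (forall b, l <= b <= m -> \forall u \near row2 0 b, 0 <= (u : 'rV[R]_2) 0 0 -> W u) ->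
  exists2 eps : R, 0 < eps & forall r b, 0 <= r < eps -> l <= b <= m -> W (row2 r b).
Proof.
move=> H.
have cov := (compact_near_coveringP (`[l, m] : set R)).1 (@segment_compact R l m).
have C : continuous (fun z : R * R => row2 z.2 z.1 : 'rV[R]_2).
  move=> z; apply: continuous_row => k.
  have [->|->] := ord2P k.
    by rewrite (_ : (fun w => _) = snd); [exact: cvg_snd|rewrite funeqE => w; rewrite row2E0].
  by rewrite (_ : (fun w => _) = fst); [exact: cvg_fst|rewrite funeqE => w; rewrite row2E1].
have : \forall r \near (0 : R), `[l, m] `<=` (fun b => 0 <= r -> W (row2 r b)).
  apply: (cov R (nbhs (0 : R)) (fun r b => 0 <= r -> W (row2 r b))) => b.
  rewrite /= in_itv /= => br.
  have N0 : nbhs (b, 0 : R) (fun z => 0 <= z.2 -> W (row2 z.2 z.1)).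
    have := C (b, 0) _ (H b br); rewrite /nbhs /= => H'.
    by apply: filterS H' => -[b' r]; rewrite /= row2E0.
  exact: N0.
move=> /nbhs_ballP[eps /= eps0 epsP]; exists eps => // r b /andP[r0 re] br.
apply: (epsP r) => //.
by rewrite -ball_normE /= sub0r normrN ger0_norm.
Qed.

Hypothesis clS : closed_spacelike_orthogonal_surface S.

(** At positive radius [cone_local] makes [cone_map] a local embedding. At radius 0, an open
    preimage contains a strip of uniform width over the angles from [- a] to [a + th], and by
    [cone_open0] these angles reach every nearby point of [S]. *)
Lemma cone_open_quotient :
  open_quotient [set u : 'rV[R]_2 | 0 <= u 0 0 < eta] S cc.
Proof.
have [eta0 a0 a1 a2] := cone_bounds; case/andP: (th2) => t0 t1.
set A := mkset _.
split; first by move=> _ [u Au <-]; exact: cone_map_S.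
move=> B BA; have BS : B `<=` S by move=> q /BA[u Au <-]; exact: cone_map_S.
split.
  move=> /(open_subspace_subP BS)[G oG BE].
  apply/(open_subspace_nearP (@subIsetl _ _ _)) => u [Au Bu].
  have Gu : G (cc u) by move: Bu; rewrite /preimage /= BE => -[].
  suff : \forall w \near u, A w -> G (cc w).
    by apply: filterS => w H Aw; split=> //; rewrite /preimage /= BE; split; [exact: cone_map_S|exact: H].
  have [u0 u1] := andP Au; move: u0; rewrite le_eqVlt => /orP[/eqP u0|u0].
    rewrite (cone_map0 (esym u0)) in Gu.
    have [eps eps0 H] := cone_cont0 oG Gu.
    have ue : u 0 0 < eps by rewrite -u0.
    by apply: filterS (near_entry0 ue) => w we /andP[w0 w1]; apply: H => //; rewrite w0.
  have ur : 0 < u 0 0 < eta by rewrite u0.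
  by apply: filterS (cone_map_cont ur oG Gu).
move=> /(open_subspace_nearP (@subIsetl _ _ _)) H.
apply/(open_subspace_nearP BS) => q Bq.
suff [G [oG Gq GB]] : exists G : set M, [/\ open G, G q & forall p, S p -> G p -> B p].
  by apply: filterS (open_nbhs_nbhs (conj oG Gq)) => p Gp Sp; exact: GB.
have [u Au uq] := BA q Bq.
have [u0 u1] := andP Au; move: u0; rewrite le_eqVlt => /orP[/eqP u0|u0].
  have qy : q = pchart j y by rewrite -uq cone_map0.
  have [|eps eps0 epsP] := @tube_row2 (fun w => w 0 0 < eta -> B (cc w)) (- a) (a + th).
    move=> b _; have Ab : A (row2 0 b) by rewrite /A /= row2E0 lexx.
    have Bb : (A `&` cc @^-1` B) (row2 0 b) by split=> //; rewrite /preimage /= cone_map0 ?row2E0// -qy.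
    by apply: filterS (H _ Bb) => w Hw w0 w1; apply: (Hw _).2; apply/andP.
  have [G [oG Gy GP]] := cone_open0 eps0.
  exists G; split=> //; first by rewrite qy.
  move=> p Sp Gp; have [r [b [rr r1 br <-]]] := GP p Sp Gp.
  by apply: epsP => //; rewrite row2E0.
have ur : 0 < u 0 0 < eta by rewrite u0.
have [P [Pu [oP _ [cinj cq] _] _]] := cone_local clS ur.
have Bu : (A `&` cc @^-1` B) u by split=> //; rewrite /preimage /= uq.
have := H u Bu; rewrite /prop_near1 nbhsE; case=> W [oW Wu] WP.
pose N := P `&` (W `&` [set u : 'rV[R]_2 | 0 < u 0 0 < eta]).
have oN : open N by apply: openI => //; apply: openI => //; exact: open_annulus.
have [G oG GE] : exists2 G, open G & cc @` N = S `&` G.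
  apply: (open_quotient_image cq (@subIsetl _ _ _)) => [z n Pz Nn E|].
    by rewrite (cinj _ _ Pz Nn.1 E).
  by exists N => //; apply/esym/setIidr => n [].
exists G; split=> //.
  have : (cc @` N) q by exists u.
  by rewrite GE => -[].
move=> p Sp Gp; have : (cc @` N) p by rewrite GE.
move=> [w [_ [Ww wr]] <-]; apply: (WP w Ww _).2.
by rewrite /A /=; have [/ltW -> ->] := andP wr.
Qed.

Lemma cone_data_cone_point : cone_point S (signed_metric V e) (pchart j y) th.
Proof.
have [eta0 _ _ _] := cone_bounds.
exists eta, cc; split.
- by split=> // u u0; exact: cone_map0.
- exact: cone_open_quotient.
- by move=> u w Au Aw; exact: cone_map_eq.
- move=> u /andP[_ u1] u0; have ur : 0 < u 0 0 < eta by rewrite u0.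
  by have [P [Pu sP _]] := cone_local clS ur; exists P.
- move=> i u b /andP[_ u1] u0; have ur : 0 < u 0 0 < eta by rewrite u0.
  by have [P [_ _ H]] := cone_local clS ur; exact: H.
Qed.

End ConeChart.

(** * Conclusion for both metrics *)

Lemma particle_cone_point (R : realType) (M : spacetime R) (S : set M)
    (V : cindex M -> M -> 'rV[R]_4) (e : R) (j : pindex M) (y : 'rV[R]_4) :
  e = 1 \/ e = -1 -> closed_spacelike_orthogonal_surface S -> transverse S V ->
  lifted_surface S j y -> axis y ->
  cone_point S (signed_metric V e) (pchart j y) (pangle j).
Proof.
move=> e1 clS trV ly ay; have [D _] := cone_data_exists trV e1 clS ly ay.
exact: (cone_data_cone_point D ly ay).
Qed.

Lemma signed_metric_cone (R : realType) (M : spacetime R) (S : set M)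
    (V : cindex M -> M -> 'rV[R]_4) (e : R) :
  e = 1 \/ e = -1 -> closed_spacelike_orthogonal_surface S -> transverse S V ->
  hyperbolic_with_cone_singularities S (signed_metric V e).
Proof.
move=> e1 clS trV; split; first exact: signed_metric_locally_hyperbolic.
move=> p Sp rp; have [j [y [dy yp]]] := particles_covered rp.
have ay : axis y.
  by apply: contrapT => /(pchart_regular dy); rewrite yp.
have ly : lifted_surface S j y by split; rewrite ?yp.
exists (pangle j); first by have /andP[] := pangle_bounds j.
by rewrite -yp; exact: particle_cone_point.
Qed.

Lemma mu_lE (R : realType) (M : spacetime R) (V : cindex M -> M -> 'rV[R]_4) :
  mu_l V = signed_metric V 1.
Proof.
by apply/funext => i; apply/funext => s; apply/funext => u; apply/funext => a;
  rewrite /mu_l /signed_metric Dl_De.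
Qed.

Lemma mu_rE (R : realType) (M : spacetime R) (V : cindex M -> M -> 'rV[R]_4) :
  mu_r V = signed_metric V (-1).
Proof.
by apply/funext => i; apply/funext => s; apply/funext => u; apply/funext => a;
  rewrite /mu_r /signed_metric Dr_De.
Qed.

Theorem proposition4p20 (R : realType) (M : spacetime R) (S : set M)
    (V : cindex M -> M -> 'rV[R]_4) :
  closed_spacelike_orthogonal_surface S ->
  transverse S V ->
  hyperbolic_with_cone_singularities S (mu_l V) /\
  hyperbolic_with_cone_singularities S (mu_r V) /\
  forall (j : pindex M) (y : 'rV[R]_4), lifted_surface S j y -> axis y ->
    cone_point S (mu_l V) (pchart j y) (pangle j) /\
    cone_point S (mu_r V) (pchart j y) (pangle j).
Proof.
move=> clS trV; have e1 : (1 : R) = 1 \/ (1 : R) = -1 by left.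
have e2 : (-1 : R) = 1 \/ (-1 : R) = -1 by right.
rewrite mu_lE mu_rE; split; first exact: signed_metric_cone.
split; first exact: signed_metric_cone.
by move=> j y ly ay; split; exact: particle_cone_point.
Qed.
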